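(* Let $p\in(1,\infty)$, $\gamma,\lambda\in\mathbb{R}$, $\theta\in(d-1,d-1+p)$, $\sigma>-\theta-\alpha p/2$ if $\mathcal{O}$ is bounded and $\sigma=0$ if $\mathcal{O}$ is a half space, $f\in\psi^{-\alpha/2}H^{\gamma}_{p,\theta}(\mathcal{O})$ and $g\in\psi^{\alpha/2}H^{\lambda}_{p,\theta,\sigma}(\overline{\mathcal{O}}^c)$, and let $u\in e_{\mathcal{O}}H^{\gamma+\alpha}_{p,\theta-\alpha p/2}(\mathcal{O})\oplus e_{\overline{\mathcal{O}}^c}H^{\lambda}_{p,\theta-\alpha p/2,\sigma}(\overline{\mathcal{O}}^c)$ be the unique weak solution in this class of $$\Delta^{\alpha/2}u=f\ \text{ in }\mathcal{O},\qquad u=g\ \text{ in }\overline{\mathcal{O}}^c.$$ Suppose $\gamma+\alpha-\frac dp\ge n+\delta$ with $n\in\{0,1,2,\dots\}$ and $\delta\in(0,1)$. Then $$\sum_{k=0}^n\left|\psi^{k+\frac\theta p-\frac\alpha2}D^k_xu\right|_{C_b(\mathcal{O})}+\left[\psi^{n+\delta+\frac\theta p-\frac\alpha2}D^n_xu\right]_{C^\delta(\mathcal{O})}\le N\|\psi^{-\alpha/2}r_{\mathcal{O}}u\|_{H^{\gamma+\alpha}_{p,\theta}(\mathcal{O})},$$ where $N$ depends only on $d,\gamma,p,\theta,\alpha$ (and on the fixed set $\mathcal{O}$).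
   Context: Setting. $d\in\mathbb{N}$, $\alpha\in(0,2)$; $\mathcal{O}\subset\mathbb{R}^d$ is either the half space $\mathbb{R}^d_+=\{x:x^1>0\}$ or a bounded $C^{1,1}$ open set; $\overline{\mathcal{O}}^c:=\mathbb{R}^d\setminus\overline{\mathcal{O}}$; $d_x:=\mathrm{dist}(x,\partial\mathcal{O})$; $\mathbf{O}$ denotes either $\mathcal{O}$ or $\overline{\mathcal{O}}^c$. $\mathcal{D}'(U)$ is the space of distributions on an open set $U$, $(f,\phi)_U$ the action of $f\in\mathcal{D}'(U)$ on $\phi\in C_c^\infty(U)$, $r_V$ restriction to an open set $V$, $e_U$ extension by zero from $U$ to $\mathbb{R}^d$. $\|f\|_{H^\gamma_p}:=\|(1-\Delta)^{\gamma/2}f\|_{L_p(\mathbb{R}^d)}$. $|v|_{C_b(\mathcal{O})}:=\sup_{\mathcal{O}}|v|$ and $[v]_{C^\delta(\mathcal{O})}:=\sup_{x\ne y\in\mathcal{O}}|v(x)-v(y)|/|x-y|^\delta$; $D^k_xu$ denotes the partial derivatives of order $k$. Weighted spaces. Fix nonnegative $\zeta_n\in C_c^\infty(\mathbf{O})$, $n\in\mathbb{Z}$, with $\mathrm{supp}\,\zeta_n\subset\{x\in\mathbf{O}:k_1e^{-n}<d_x<k_2e^{-n}\}$ for some $k_2>k_1>0$, $\sup|D^m_x\zeta_n|\le N(m)e^{mn}$ for all $m\ge0$, and $\sum_n\zeta_n>c>0$ on $\mathbf{O}$. $H^\gamma_{p,\theta,\sigma}(\mathbf{O})$ is the set of distributions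 $u$ on $\mathbf{O}$ with finite norm $$\|u\|^p_{H^\gamma_{p,\theta,\sigma}(\mathbf{O})}:=\sum_{n\in\mathbb{Z}}e^{n\theta}(1+e^n)^\sigma\|\zeta_{-n}(e^n\cdot)u(e^n\cdot)\|^p_{H^\gamma_p}$$ (different choices of $\{\zeta_n\}$ give equivalent norms). $H^\gamma_{p,\theta}:=H^\gamma_{p,\theta,0}$. Fix an infinitely differentiable $\psi$ on $\mathbb{R}^d\setminus\partial\mathcal{O}$ comparable to $d_x$ with $\sup_{\mathbb{R}^d\setminus\partial\mathcal{O}}|d_x^mD_x^{m+1}\psi|<\infty$ for all $m\ge0$. Write $u\in\psi^{-\nu}E$ if $\psi^{\nu}u\in E$. Constants may depend on the fixed choices of $\zeta_n,\psi$. Duality. If $1/p+1/p'=1$, $\theta/p+\theta'/p'=d$, $\sigma/p+\sigma'/p'=0$, then for $u\in H^\gamma_{p,\theta,\sigma}(\mathbf{O})$ the pairing $(u,\phi)_{\mathbf{O}}$ extends continuously from $C_c^\infty(\mathbf{O})$ to $\phi\in H^{-\gamma}_{p',\theta',\sigma'}(\mathbf{O})$, the dual space of $H^\gamma_{p,\theta,\sigma}(\mathbf{O})$. Extension by zero. For $v\in H^{\gamma+\alpha}_{p,\theta-\alpha p/2}(\mathcal{O})$, $w\in H^{\lambda}_{p,\theta-\alpha p/2,\sigma}(\overline{\mathcal{O}}^c)$, the distributions $e_{\mathcal{O}}v,e_{\overline{\mathcal{O}}^c}w\in\mathcal{D}'(\mathbb{R}^d)$ are defined by $\eta\mapsto(v,r_{\mathcal{O}}\eta)_{\mathcal{O}}$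 and $\eta\mapsto(w,r_{\overline{\mathcal{O}}^c}\eta)_{\overline{\mathcal{O}}^c}$ (duality pairings); the space $e_{\mathcal{O}}H^{\gamma+\alpha}_{p,\theta-\alpha p/2}(\mathcal{O})\oplus e_{\overline{\mathcal{O}}^c}H^{\lambda}_{p,\theta-\alpha p/2,\sigma}(\overline{\mathcal{O}}^c)$ consists of all $e_{\mathcal{O}}v+e_{\overline{\mathcal{O}}^c}w$. Weak solution. For $\phi\in C_c^\infty(\mathcal{O})$ (extended by $0$), $\Delta^{\alpha/2}\phi(x)=c_d\lim_{\varepsilon\downarrow0}\int_{|y|>\varepsilon}\frac{\phi(x+y)-\phi(x)}{|y|^{d+\alpha}}dy$, $c_d=\frac{2^\alpha\Gamma(\frac{d+\alpha}{2})}{\pi^{d/2}|\Gamma(-\alpha/2)|}$; for $u\in e_{\mathcal{O}}H^{\gamma+\alpha}_{p,\theta-\alpha p/2}(\mathcal{O})\oplus e_{\overline{\mathcal{O}}^c}H^{\lambda}_{p,\theta-\alpha p/2,\sigma}(\overline{\mathcal{O}}^c)$, $(\Delta^{\alpha/2}u,\phi)_{\mathcal{O}}:=(r_{\mathcal{O}}u,r_{\mathcal{O}}\Delta^{\alpha/2}(e_{\mathcal{O}}\phi))_{\mathcal{O}}+(r_{\overline{\mathcal{O}}^c}u,r_{\overline{\mathcal{O}}^c}\Delta^{\alpha/2}(e_{\mathcal{O}}\phi))_{\overline{\mathcal{O}}^c}$. $u$ is a weak solution if $u=g$ on $\overline{\mathcal{O}}^c$ and $(\Delta^{\alpha/2}u,\phi)_{\mathcal{O}}=(f,\phi)_{\mathcal{O}}$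 for all $\phi\in C_c^\infty(\mathcal{O})$. (If $p\in(1,\infty)$, $\gamma,\lambda\in\mathbb{R}$, $\theta\in(d-1,d-1+p)$, $\sigma>-\theta-\alpha p/2$ for bounded $\mathcal{O}$ and $\sigma=0$ for a half space, $f\in\psi^{-\alpha/2}H^{\gamma}_{p,\theta}(\mathcal{O})$ and $g\in\psi^{\alpha/2}H^{\lambda}_{p,\theta,\sigma}(\overline{\mathcal{O}}^c)$, there is exactly one weak solution in $e_{\mathcal{O}}H^{\gamma+\alpha}_{p,\theta-\alpha p/2}(\mathcal{O})\oplus e_{\overline{\mathcal{O}}^c}H^{\lambda}_{p,\theta-\alpha p/2,\sigma}(\overline{\mathcal{O}}^c)$.)
   Formalization: N may also depend on δ: a bound uniform in δ∈(0,1) fails when γ+α−d/p is a positive integer (d=1, p=2, γ+α=3/2, n=0, δ→1 would give a Lipschitz bound on H^{3/2}_2). For a half space, ζ_n need only be smooth with support in the strip, not compact. *)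

(* Defs.v *)
From HB Require Import structures.
From mathcomp Require Import all_boot all_order all_algebra.
From mathcomp Require Import all_classical all_reals all_analysis.

Set Implicit Arguments.
Unset Strict Implicit.
Unset Printing Implicit Defensive.

Import Order.TTheory GRing.Theory Num.Theory.
Import numFieldTopology.Exports numFieldNormedType.Exports.

Local Open Scope classical_set_scope.
Local Open Scope ring_scope.

(* Conventions: R^d is 'rV[R]_d, with the library's topology and derivatives;
   functions and distributions are real-valued; integrals over R^d are taken
   with respect to the d-dimensional Lebesgue measure, which is built on
   d.-tuple R, the type that carries the product sigma-algebra. *)

Section lebesgue_measure_tuple.
Context (R : realType).
Local Notation T n := (n.-tuple (measurableTypeR R)).

Definition tuple_cons n (x : measurableTypeR R * T n) : T n.+1 :=
  [tuple of x.1 :: x.2].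

Lemma measurable_tuple_cons n : measurable_fun setT (@tuple_cons n).
Proof. exact: measurable_cons. Qed.

Section step.
Context (n : nat) (m : {sigma_finite_measure set (T n) -> \bar R}).

Definition tuple_cons_measure : set (T n.+1) -> \bar R :=
  pushforward (lebesgue_measure \x m)%E (@tuple_cons n).

Let mu0 : tuple_cons_measure set0 = 0%E.
Proof. by rewrite /tuple_cons_measure /pushforward preimage_set0 measure0. Qed.

Let mu_ge0 A : (0 <= tuple_cons_measure A)%E.
Proof. by rewrite /tuple_cons_measure /pushforward; apply: measure_ge0. Qed.

Let mu_sigma_additive : semi_sigma_additive tuple_cons_measure.
Proof.
move=> F mF tF mUF; rewrite /tuple_cons_measure /pushforward preimage_bigcup.
have mc k : measurable (@tuple_cons n @^-1` F k).
  by rewrite -[X in measurable X]setTI; exact: measurable_tuple_cons.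
apply: measure_semi_sigma_additive => //.
- apply/trivIsetP => /= i j _ _ ij; rewrite -preimage_setI.
  by move/trivIsetP : tF => /(_ _ _ _ _ ij) ->//; rewrite preimage_set0.
- exact: bigcup_measurable.
Qed.

HB.instance Definition _ := isMeasure.Build _ _ _ tuple_cons_measure
  mu0 mu_ge0 mu_sigma_additive.

Let mu_sigma_finite : sigma_finite setT tuple_cons_measure.
Proof.
have /sigma_finiteP[F [TF ndF Foo]] := sigma_finiteT (@lebesgue_measure R).
have /sigma_finiteP[G [TG ndG Goo]] := sigma_finiteT m.
pose g (t : T n.+1) : measurableTypeR R * T n := (thead t, [tuple of behead t]).
have mg : measurable_fun setT g.
  apply/measurable_fun_pairP; split.
    exact: (@measurable_tnth _ _ _ ord0).
  exact: measurable_behead.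
have gK x : g (tuple_cons x) = x.
  by case: x => a t; rewrite /g theadE; congr pair; exact/val_inj.
exists (fun k => g @^-1` (F k `*` G k)).
  rewrite -preimage_bigcup predeqE => t; split=> // _.
  have [k _ Fk] : (\bigcup_i F i) (g t).1 by rewrite -TF.
  have [j _ Gj] : (\bigcup_i G i) (g t).2 by rewrite -TG.
  exists (maxn k j) => //; split.
    by move: (g t).1 Fk; exact/subsetPset/ndF/leq_maxl.
  by move: (g t).2 Gj; exact/subsetPset/ndG/leq_maxr.
move=> k; have [mF Fk] := Foo k; have [mG Gk] := Goo k; split.
  by rewrite -[X in measurable X]setTI; apply: mg => //; exact: measurableX.
rewrite /tuple_cons_measure /pushforward.
rewrite (_ : _ @^-1` _ = F k `*` G k); last first.
  by apply/funext => x; rewrite -[in RHS](gK x).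
by rewrite product_measure1E// lte_mul_pinfty// ge0_fin_numE.
Qed.

HB.instance Definition _ := Measure_isSigmaFinite.Build _ _ _
  tuple_cons_measure mu_sigma_finite.
End step.

Fixpoint tuple_lebesgue n : {sigma_finite_measure set (T n) -> \bar R} :=
  match n with
  | 0 => @dirac _ (T 0) [tuple] R
  | n.+1 => tuple_cons_measure (tuple_lebesgue n)
  end.
End lebesgue_measure_tuple.

Section euclidean_space.
Context (R : realType) (d : nat).
Local Notation Rd := 'rV[R]_d.

Definition dot (x y : Rd) : R := \sum_(i < d) x 0 i * y 0 i.

(* The library's norm on 'rV[R]_d is the sup norm; this is the Euclidean one. *)
Definition enorm (x : Rd) : R := Num.sqrt (dot x x).

Definition dist (x : Rd) (A : set Rd) : R := inf [set enorm (x - y) | y in A].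

Definition boundary (A : set Rd) : set Rd := closure A `\` interior A.

Definition row_of_tuple (t : d.-tuple (measurableTypeR R)) : Rd :=
  \row_(i < d) tnth t i.

Definition integral_on (D : set Rd) (f : Rd -> R) : R :=
  (\int[@tuple_lebesgue R d]_(t in row_of_tuple @^-1` D) f (row_of_tuple t))%R.

Definition Lp_norm (p : R) (f : Rd -> R) : \bar R :=
  Lnorm (@tuple_lebesgue R d) p%:E (fun t => (f (row_of_tuple t))%:E).

Definition Lp (p : R) (f : Rd -> R) : Prop :=
  measurable_fun setT (f \o row_of_tuple) /\ (Lp_norm p f < +oo)%E.

Definition partial (i : 'I_d) (f : Rd -> R) : Rd -> R :=
  'D_(delta_mx 0 i : Rd) f.

(* D^s f for s = [:: i_1; ...; i_k], a partial derivative of order k = size s *)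
Definition partials (s : seq 'I_d) (f : Rd -> R) : Rd -> R :=
  foldr partial f s.

Definition gradient (f : Rd -> R) (x : Rd) : Rd := \row_(i < d) partial i f x.

Definition Ck_on (k : nat) (U : set Rd) (f : Rd -> R) : Prop :=
  forall s, (size s <= k)%N -> forall x, U x ->
    {for x, continuous (partials s f)} /\
    ((size s < k)%N -> differentiable (partials s f) x).

Definition smooth_on (U : set Rd) (f : Rd -> R) : Prop :=
  forall k, Ck_on k U f.

(* C_c^oo(U); test functions are extended by zero to R^d, so that restriction
   and extension of test functions are the identity on underlying functions *)
Definition test_function (U : set Rd) (phi : Rd -> R) : Prop :=
  smooth_on setT phi /\
  exists K, [/\ compact K, K `<=` U & forall x, ~ K x -> phi x = 0].

(* D'(U): only the values on C_c^oo(U) matter, so that r_V u, for V `<=` U, is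
   represented by the same function as u *)
Definition distribution_on (U : set Rd) (T : (Rd -> R) -> R) : Prop :=
  (forall (a : R) phi1 phi2, test_function U phi1 -> test_function U phi2 ->
     T (fun x => a * phi1 x + phi2 x) = a * T phi1 + T phi2) /\
  (forall K, compact K -> K `<=` U -> exists (m : nat) (C : R),
     forall (phi : Rd -> R) (M : R), test_function U phi ->
       (forall x, ~ K x -> phi x = 0) ->
       (forall s x, (size s <= m)%N -> `|partials s phi x| <= M) ->
       `|T phi| <= C * M).

Definition eq_on (U : set Rd) (T1 T2 : (Rd -> R) -> R) : Prop :=
  forall phi, test_function U phi -> T1 phi = T2 phi.

Definition regular (f : Rd -> R) (phi : Rd -> R) : R :=
  integral_on setT (fun x => f x * phi x).

(* (1 - Delta)^(gamma/2) phi = F^-1 ((1 + |xi|^2)^(gamma/2) F phi) for a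
   Schwartz function phi; as phi is real and the symbol even, only the real part
   of the inverse transform remains. *)
Definition bessel (gamma : R) (phi : Rd -> R) (x : Rd) : R :=
  (2 * pi) ^- d * integral_on setT (fun xi =>
    (1 + enorm xi ^+ 2) `^ (gamma / 2) *
    (cos (dot x xi) * integral_on setT (fun y => phi y * cos (dot y xi)) +
     sin (dot x xi) * integral_on setT (fun y => phi y * sin (dot y xi)))).

(* |T|_{H^gamma_p} = |h|_{L_p} if (1 - Delta)^(gamma/2) T = h is in L_p, that is
   if T = (1 - Delta)^(-gamma/2) h; it is +oo if there is no such h. *)
Definition H_norm (gamma p : R) (T : (Rd -> R) -> R) : \bar R :=
  ereal_inf [set Lp_norm p h | h in [set h | Lp p h /\
    forall phi, test_function setT phi ->
      T phi = integral_on setT (fun x => h x * bessel (- gamma) phi x)]].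

(* the distribution zeta_{-n}(e^n .) u(e^n .) on R^d, obtained by the change of
   variables x -> e^{-n} x *)
Definition localize (zeta : int -> Rd -> R) (u : (Rd -> R) -> R) (n : int)
    (phi : Rd -> R) : R :=
  expR (- (n%:~R * d%:R)) *
  u (fun x => zeta (- n) x * phi (expR (- n%:~R) *: x)).

Definition weighted_norm (zeta : int -> Rd -> R) (gamma p theta sigma : R)
    (u : (Rd -> R) -> R) : \bar R :=
  ((\esum_(n in [set: int])
      ((expR (n%:~R * theta) * (1 + expR n%:~R) `^ sigma)%:E *
       H_norm gamma p (localize zeta u n) `^ p)) `^ p^-1)%E.

(* H^gamma_{p,theta,sigma}(U) *)
Definition weighted_space (U : set Rd) (zeta : int -> Rd -> R)
    (gamma p theta sigma : R) (u : (Rd -> R) -> R) : Prop :=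
  distribution_on U u /\ (weighted_norm zeta gamma p theta sigma u < +oo)%E.

(* The support of zeta_n is a closed subset of R^d contained in the strip; when
   the boundary is bounded, this makes it compact. For a half space in dimension
   d >= 2, compactness cannot be required: finitely many compact supports would
   have to cover a hyperplane. *)
Definition weight_family (O U : set Rd) (zeta : int -> Rd -> R) : Prop :=
  [/\ forall n x, 0 <= zeta n x,
      forall n, smooth_on setT (zeta n),
      exists k1 k2 : R, [/\ 0 < k1, k1 < k2 & forall n,
        closure [set x | zeta n x != 0] `<=`
        [set x | U x /\ k1 * expR (- n%:~R) < dist x (boundary O)
                        < k2 * expR (- n%:~R)]],
      forall m : nat, exists N : R, forall n s x, size s = m ->
        `|partials s (zeta n) x| <= N * expR (m%:R * n%:~R) &
      exists c : R, 0 < c /\ forall x, U x ->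
        (c%:E < \esum_(n in [set: int]) (zeta n x)%:E)%E].

Definition regularized_distance (O : set Rd) (psi : Rd -> R) : Prop :=
  [/\ smooth_on (~` boundary O) psi,
      exists c1 c2 : R, [/\ 0 < c1, 0 < c2 & forall x, ~ boundary O x ->
        c1 * dist x (boundary O) <= psi x <= c2 * dist x (boundary O)] &
      forall m : nat, exists N : R, forall s x, size s = m.+1 ->
        ~ boundary O x ->
        `|dist x (boundary O) ^+ m * partials s psi x| <= N].

(* the distribution psi^a u *)
Definition psi_mul (psi : Rd -> R) (a : R) (u : (Rd -> R) -> R)
    (phi : Rd -> R) : R := u (fun x => psi x `^ a * phi x).

(* psi^(-nu) H^gamma_{p,theta,sigma}(U) *)
Definition psi_weighted_space (U : set Rd) (zeta : int -> Rd -> R)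
    (psi : Rd -> R) (nu gamma p theta sigma : R) (u : (Rd -> R) -> R) : Prop :=
  distribution_on U u /\
  weighted_space U zeta gamma p theta sigma (psi_mul psi nu u).

(* (u, Phi)_U = l for u in H^gamma_{p,theta,sigma}(U) and a function Phi in the
   dual space H^{-gamma}_{p',theta',sigma'}(U): l is the limit of u(phi_k) as
   phi_k in C_c^oo(U) tends to Phi in the dual space. *)
Definition dual_pairing (U : set Rd) (zeta : int -> Rd -> R)
    (gamma p theta sigma : R) (u : (Rd -> R) -> R) (Phi : Rd -> R) (l : R)
    : Prop :=
  let p' := p / (p - 1) in
  let theta' := p' * (d%:R - theta / p) in
  let sigma' := - (p' * (sigma / p)) in
  let approx (phi_ : nat -> Rd -> R) :=
    (forall k, test_function U (phi_ k)) /\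
    weighted_norm zeta (- gamma) p' theta' sigma'
      (regular (fun x => phi_ k x - Phi x)) @[k --> \oo] --> 0%E in
  [/\ weighted_space U zeta (- gamma) p' theta' sigma' (regular Phi),
      exists phi_, approx phi_ &
      forall phi_, approx phi_ -> u (phi_ k) @[k --> \oo] --> l].

(* Euler's Gamma function on ]-1, +oo[ `\ 0 *)
Definition Gamma (z : R) : R :=
  let G (y : R) := (\int[@lebesgue_measure R]_(t in `]0%R, +oo[)
                      (t `^ (y - 1) * expR (- t)))%R in
  if 0 < z then G z else G (z + 1) / z.

(* Delta^{alpha/2} phi *)
Definition fractional_laplacian (alpha : R) (phi : Rd -> R) (x : Rd) : R :=
  2 `^ alpha * Gamma ((d%:R + alpha) / 2) /
    (pi `^ (d%:R / 2) * `|Gamma (- (alpha / 2))|) *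
  lim (integral_on [set y | eps < enorm y]
         (fun y => (phi (x + y) - phi x) / enorm y `^ (d%:R + alpha))
       @[eps --> 0^'+]).

(* u = e_O v + e_{Oc} w with v and w in the weighted spaces, where Oc is the
   complement of the closure of O *)
Definition extension_space (O : set Rd) (zetaO zetaC : int -> Rd -> R)
    (alpha gamma lambda p theta sigma : R) (u : (Rd -> R) -> R) : Prop :=
  let Oc := ~` closure O in
  let theta1 := theta - alpha * p / 2 in
  distribution_on setT u /\
  exists v w, [/\ weighted_space O zetaO (gamma + alpha) p theta1 0 v,
    weighted_space Oc zetaC lambda p theta1 sigma w &
    forall eta, test_function setT eta -> exists a b,
      [/\ dual_pairing O zetaO (gamma + alpha) p theta1 0 v eta a,
          dual_pairing Oc zetaC lambda p theta1 sigma w eta b &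
          u eta = a + b]].

(* Delta^{alpha/2} u = f in O and u = g in Oc *)
Definition weak_solution (O : set Rd) (zetaO zetaC : int -> Rd -> R)
    (alpha gamma lambda p theta sigma : R) (f g u : (Rd -> R) -> R) : Prop :=
  let Oc := ~` closure O in
  let theta1 := theta - alpha * p / 2 in
  eq_on Oc u g /\
  forall phi, test_function O phi -> exists a b,
    [/\ dual_pairing O zetaO (gamma + alpha) p theta1 0 u
          (fractional_laplacian alpha phi) a,
        dual_pairing Oc zetaC lambda p theta1 sigma u
          (fractional_laplacian alpha phi) b &
        a + b = f phi].

Definition sup_norm (O : set Rd) (v : Rd -> R) : \bar R :=
  ereal_sup [set `|v x|%:E | x in O].

Definition holder_seminorm (O : set Rd) (delta : R) (v : Rd -> R) : \bar R :=
  ereal_sup [set (`|v z.1 - v z.2| / enorm (z.1 - z.2) `^ delta)%:E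
            | z in [set z : Rd * Rd | [/\ O z.1, O z.2 & z.1 <> z.2]]].

(* For a family indexed by the partial derivatives of order k, such as D^k u,
   the maximum over the members of the family is taken. *)
Definition max_partials (k : nat) (F : seq 'I_d -> \bar R) : \bar R :=
  (\big[Order.max/0]_(s : k.-tuple 'I_d) F s)%E.

End euclidean_space.

Section domains.
Context (R : realType) (d : nat) (d_gt0 : (0 < d)%N).
Local Notation i0 := (Ordinal d_gt0).

Definition half_space : set 'rV[R]_d := [set x | 0 < x 0 i0].

(* Near each boundary point z, O lies above the graph of a C^{1,1} function in
   some orthonormal coordinate system centred at z; the vertical coordinate is
   the first one, and col' i0 y collects the d - 1 others. *)
Definition C11_open_set (O : set 'rV[R]_d) : Prop :=
  open O /\
  exists r0 L : R, [/\ 0 < r0, 0 < L & forall z, boundary O z ->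
    exists (G : 'rV[R]_d.-1 -> R) (Q : 'M[R]_d),
    [/\ Q *m Q^T = 1%:M,
        G 0 = 0 /\ gradient G 0 = 0,
        forall y, differentiable G y /\ enorm (gradient G y) <= L,
        forall y1 y2,
          enorm (gradient G y1 - gradient G y2) <= L * enorm (y1 - y2) &
        forall x, enorm (x - z) < r0 ->
          let y := (x - z) *m Q in O x <-> G (col' i0 y) < y 0 i0]].

End domains.

(* Main.v *)
Require Import Defs.
From HB Require Import structures.
From mathcomp Require Import all_boot all_order all_algebra.
From mathcomp Require Import all_classical all_reals all_analysis.
From mathcomp Require Import measurable_realfun ring lra.

(** The estimate is the Sobolev embedding of [H^mu_p], [mu = gamma + alpha], into
    the Hoelder space of order [n + delta], applied at every scale of the
    distance [d_x] to the boundary.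

    The embedding on the whole space. A distribution of finite norm is
    [T = (1 - Delta)^(-mu/2) h] with [h] in [L_p]. With [t = e^r], the symbol
    [(1 + |xi|^2)^(-mu/2)] is an average of the Gaussians
    [exp (- e^r |xi|^2)] with the weight [exp (r mu/2 - e^r) dr]. Hence [T] is a
    function, namely a superposition of convolutions of [h] with heat kernels of
    width [e^(r/2)] ([bessel_heat], [bessel_representation]). Derivatives fall on
    the kernels; each one costs a factor [e^(-r/2)], and Hoelder's inequality in
    space costs [e^(-r d/(2p))]. So the derivatives of order [k] are controlled by
    the integral of [exp (r (mu - k - d/p)/2 - e^r)], which converges as long as
    [mu - k - d/p > 0] ([potential_bound]). For the increment over a vector [z]
    there is a further factor [min (1, |z| e^(-r/2))], and the integral is then
    at most a multiple of [|z|^delta], including the limiting case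
    [delta = mu - k - d/p] ([integral_min_weight], [potential_holder]). This is
    [sobolev_embedding].

    Localization. Let [W] be the norm on the right-hand side and
    [omega = psi^(-alpha/2) u]. By the definition of [W], the distribution
    [zeta_(-m)(e^m .) omega(e^m .)] has norm at most [e^(-m theta/p) W], so it is a
    function [g_m] to which the embedding applies. With
    [S = sum_m zeta_(-m)^2], the distribution [u] is on [O] the function
    [v = sum_m psi^(alpha/2) S^(-1) zeta_(-m) g_m(e^(-m) .)] ([glue_regular]).
    On the ball of radius [d_x / 2] about [x], a bounded number of the terms are
    nonzero, those with [e^m] comparable to [d_x]. Each factor obeys there bounds
    on its derivatives and their increments in units of the length [d_x]; such
    bounds ([holder_class]) are stable under sums, products and real powers, so
    that the bound for [v] comes out by multiplying constants ([gluing]), and the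
    powers of [d_x] cancel against the powers of [psi] in the statement
    ([weighted_bounds]). Two points further apart than half their distances to the
    boundary are compared through the size of the values alone.

    If [W] is infinite, only the existence of [v] is at stake. It follows from the
    same gluing, applied with the exponent [0] in place of [- alpha / 2] to the
    interior part of [u] as a member of the extension space
    ([extension_space_restriction]). *)

Set Implicit Arguments.
Unset Strict Implicit.
Unset Printing Implicit Defensive.

Import Order.TTheory GRing.Theory Num.Theory.
Import numFieldTopology.Exports numFieldNormedType.Exports.

Local Open Scope classical_set_scope.
Local Open Scope ring_scope.

(** * Euclidean norm and distance to the boundary *)

Lemma continuous_dist_ltP (R : realType) (V : normedModType R) (f : V -> R) (x : V) :
  {for x, continuous f} <-> forall e, 0 < e -> exists2 r, 0 < r & forall y,
    `|x - y| < r -> `|f x - f y| < e.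
Proof.
split=> [/cvgrPdist_lt h e e0|h].
  have /nbhs_normP[r r0 hr] := h e e0.
  by exists r.
apply/cvgrPdist_lt => e /h[r r0 hr]; apply/nbhs_normP; exists r => //.
Qed.

Section euclid.
Context (R : realType) (d : nat).
Local Notation Rd := 'rV[R]_d.
Implicit Types x y z : Rd.

Lemma dotC x y : dot x y = dot y x.
Proof. by apply: eq_bigr => i _; rewrite mulrC. Qed.

Lemma dotDl x y z : dot (x + y) z = dot x z + dot y z.
Proof. by rewrite -big_split; apply: eq_bigr => i _; rewrite mxE mulrDl. Qed.

Lemma dotZl a x y : dot (a *: x) y = a * dot x y.
Proof. by rewrite /dot mulr_sumr; apply: eq_bigr => i _; rewrite mxE mulrA. Qed.

Lemma dotDr x y z : dot z (x + y) = dot z x + dot z y.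
Proof. by rewrite dotC dotDl !(dotC z). Qed.

Lemma dotZr a x y : dot x (a *: y) = a * dot x y.
Proof. by rewrite dotC dotZl dotC. Qed.

Lemma dot_ge0 x : 0 <= dot x x.
Proof. by apply: sumr_ge0 => i _; rewrite -expr2 sqr_ge0. Qed.

Lemma enorm_ge0 x : 0 <= enorm x.
Proof. exact: sqrtr_ge0. Qed.

Lemma enorm_sqr x : enorm x ^+ 2 = dot x x.
Proof. by rewrite sqr_sqrtr ?dot_ge0. Qed.

Lemma enormZ a x : enorm (a *: x) = `|a| * enorm x.
Proof.
by rewrite /enorm dotZl dotZr mulrA -expr2 sqrtrM ?sqr_ge0// sqrtr_sqr.
Qed.

Lemma enormN x : enorm (- x) = enorm x.
Proof. by rewrite -scaleN1r enormZ normrN1 mul1r. Qed.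

Lemma enormB x y : enorm (x - y) = enorm (y - x).
Proof. by rewrite -opprB enormN. Qed.

Lemma enorm0 : enorm (0 : Rd) = 0.
Proof. by rewrite -(scale0r 0) enormZ normr0 mul0r. Qed.

Lemma coord_le_enorm x i : `|x 0 i| <= enorm x.
Proof.
rewrite -sqrtr_sqr ler_sqrt ?dot_ge0// /dot (bigD1 i)//= -expr2 lerDl.
by apply: sumr_ge0 => j _; rewrite -expr2 sqr_ge0.
Qed.

Lemma enorm_eq0 x : enorm x = 0 -> x = 0.
Proof.
move=> x0; apply/rowP => i; rewrite mxE; apply/eqP.
by rewrite -normr_le0 -x0 coord_le_enorm.
Qed.

Lemma dot_le_enorm x y : dot x y <= enorm x * enorm y.
Proof.
have [x0|x0] := eqVneq (enorm x) 0.
  by rewrite x0 mul0r (enorm_eq0 x0) /dot big1// => i _; rewrite mxE mul0r.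
have xp : 0 < enorm x by rewrite lt_def x0 enorm_ge0.
have := dot_ge0 (enorm y *: x - enorm x *: y).
rewrite -scaleNr !(dotDl, dotDr, dotZl, dotZr) -!enorm_sqr (dotC y x).
have [y0|y0] := eqVneq (enorm y) 0.
  rewrite (enorm_eq0 y0) enorm0 mulr0 /dot big1// => i _; by rewrite mxE mulr0.
have yp : 0 < enorm y by rewrite lt_def y0 enorm_ge0.
move=> h; have xy : 0 < enorm x * enorm y by rewrite mulr_gt0.
have {}h : 0 <= 2 * (enorm x * enorm y) * (enorm x * enorm y - dot x y) by nra.
by move: h; rewrite pmulr_rge0 ?mulr_gt0// subr_ge0.
Qed.

Lemma ler_enormD x y : enorm (x + y) <= enorm x + enorm y.
Proof.
rewrite -(@ler_pXn2r _ 2)// ?nnegrE ?addr_ge0 ?enorm_ge0//.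
rewrite enorm_sqr !(dotDl, dotDr) -!enorm_sqr (dotC y x) sqrrD.
have := dot_le_enorm x y; lra.
Qed.

Lemma ler_enorm_dist x y z : enorm (x - z) <= enorm (x - y) + enorm (y - z).
Proof. by rewrite (le_trans _ (ler_enormD _ _))// addrA subrK. Qed.

Lemma norm_le_enorm x : `|x| <= enorm x.
Proof.
rewrite [leLHS]/Num.norm /= mx_normrE; apply/bigmax_leP; split => [|[i j] _ /=].
  exact: enorm_ge0.
by rewrite ord1 coord_le_enorm.
Qed.

Lemma coord_le_norm x i : `|x 0 i| <= `|x|.
Proof.
rewrite [leRHS]/Num.norm /= mx_normrE.
by apply/bigmax_geP; right => /=; exists (0, i).
Qed.

Lemma sum_coord_le_norm x : \sum_i `|x 0 i| <= d%:R * `|x|.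
Proof.
apply: (@le_trans _ _ (\sum_(i < d) `|x|)).
  by apply: ler_sum => i _; exact: coord_le_norm.
by rewrite sumr_const card_ord mulr_natl.
Qed.

Lemma enorm_le_norm x : enorm x <= d%:R * `|x|.
Proof.
apply: le_trans (sum_coord_le_norm x).
rewrite -(@ler_pXn2r _ 2)// ?nnegrE ?enorm_ge0 ?sumr_ge0//.
rewrite enorm_sqr expr2 mulr_suml; apply: ler_sum => i _.
rewrite (le_trans (ler_norm _))// normrM ler_wpM2l//.
by rewrite (bigD1 i)//= lerDl sumr_ge0.
Qed.

Lemma sum_coord_le_enorm x : \sum_i `|x 0 i| <= d%:R * enorm x.
Proof.
apply: le_trans (sum_coord_le_norm x) _.
by rewrite ler_wpM2l// norm_le_enorm.
Qed.

Lemma enorm_continuous : continuous (@enorm R d).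
Proof.
move=> x; apply/continuous_dist_ltP => e e0.
have d0 : 0 < (d%:R + 1 : R) by rewrite ltr_wpDl.
exists (e / (d%:R + 1)); first by rewrite divr_gt0.
move=> y xy; have : enorm (x - y) < e.
  apply: le_lt_trans (enorm_le_norm _) _.
  apply: (@le_lt_trans _ _ ((d%:R + 1) * `|x - y|)).
    by rewrite ler_wpM2r// lerDl.
  by rewrite -ltr_pdivlMl// mulrC.
apply: le_lt_trans; rewrite ler_norml.
have := ler_enormD (x - y) y; have := ler_enormD (y - x) x.
by rewrite !subrK (enormB y x) => h1 h2; apply/andP; split; lra.
Qed.

Lemma open_eball x (r : R) : open [set y | enorm (x - y) < r].
Proof.
rewrite (_ : mkset _ = (fun y => enorm (x - y)) @^-1` [set t | t < r])//.
apply: open_comp; last exact: open_lt.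
move=> y _; apply: (@continuous_comp _ _ _ (fun y => x - y) (@enorm R d)).
  by apply: continuousB; [exact: cst_continuous|exact: cvg_id].
exact: enorm_continuous.
Qed.

Let has_inf_dist x A : A !=set0 -> has_inf [set enorm (x - y) | y in A].
Proof.
move=> [a Aa]; split; first by exists (enorm (x - a)), a.
by exists 0 => _ [y _ <-]; exact: enorm_ge0.
Qed.

Lemma dist_le x (A : set Rd) a : A a -> dist x A <= enorm (x - a).
Proof.
by move=> Aa; apply: ge_inf; [have [] := has_inf_dist x (ex_intro _ _ Aa)|exists a].
Qed.

Lemma dist_lipschitz x y (A : set Rd) : dist x A <= enorm (x - y) + dist y A.
Proof.
have [->|/set0P A0] := eqVneq A set0.
  by rewrite /dist !image_set0 inf0 addr0 enorm_ge0.
rewrite -lerBlDl; apply: lb_le_inf; first exact: (has_inf_dist y A0).1.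
move=> _ [a Aa <-]; rewrite lerBlDl.
by apply: le_trans (dist_le x Aa) _; exact: ler_enorm_dist.
Qed.

(** A segment that starts in [O] and leaves it crosses the boundary. *)
Lemma eball_sub_open (O : set Rd) x y : open O -> O x ->
  enorm (x - y) < dist x (boundary O) -> O y.
Proof.
move=> oO Ox xy; apply: contrapT => nOy.
pose g (t : R) : Rd := x + t *: (y - x).
have cg : continuous g.
  move=> t; apply: cvgD; first exact: cvg_cst.
  by apply: cvgZr_tmp; exact: cvg_id.
pose A := g @^-1` O.
have oA : open A by apply: open_comp => // t _; exact: cg.
have nA t : 0 <= t <= 1 -> closure A t -> A t.
  move=> /andP[t0 t1] cAt; apply: contrapT => nAt.
  have bt : boundary O (g t).
    split; last by rewrite (interior_id O).1.
    move=> B /cg Bt; have [s [As Bs]] := cAt _ Bt.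
    by exists (g s).
  have := le_lt_trans (dist_le x bt) (le_lt_trans _ xy) => h.
  have : enorm (x - g t) <= enorm (x - y).
    rewrite /g opprD addrA subrr add0r enormN enormZ ger0_norm//.
    by rewrite enormB ler_piMl ?enorm_ge0.
  move=> h'; have := dist_le x bt; lra.
have : A 1.
  have : `[0, 1]%classic `&` A = `[0, 1]%classic.
    have c : connected (`[0, 1]%classic : set R) by exact: segment_connected.
    apply: c.
    - by exists 0; split; rewrite /= ?in_itv/= ?lexx ?ler01// /A /= /g scale0r addr0.
    - by exists A => //.
    - exists (closure A); first exact: closed_closure.
      apply/seteqP; split=> t [t01 At]; split=> //; first exact: subset_closure.
      by apply: nA => //; move: t01; rewrite /= in_itv.
  move=> /seteqP[_ /(_ 1)]; rewrite /= in_itv/= lexx ler01 => /(_ isT)[] //.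
by rewrite /A /= /g scale1r addrC subrK.
Qed.

End euclid.

(** * Partial derivatives and the classes C^k *)

Section differential.
Context (R : realType).

Lemma differentiable_of_approx (V : normedModType R) (f : V -> R) (x : V)
    (L : {linear V -> R}) : continuous L ->
  (forall e, 0 < e -> exists2 r, 0 < r & forall h, `|h| < r ->
     `|f (h + x) - f x - L h| <= e * `|h|) ->
  differentiable f x /\ ('d f x = L :> (V -> R)).
Proof.
move=> cL fL.
have E : f \o shift x = cst (f x) + L +o_ 0 id.
  apply/eqaddoP => e /= /fL[r r0 hr].
  apply/nbhs_normP; exists r => // h /=; rewrite sub0r normrN => /hr.
  by rewrite !fctE/= opprD addrA.
have D : ('d f x = L :> (V -> R)) by exact: diff_unique.
by split=> //; apply/diff_locallyP; rewrite D.
Qed.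

Context (d : nat).
Local Notation Rd := 'rV[R]_d.
Implicit Types (x z : Rd) (f g : Rd -> R).

Lemma derive_partial f x z : differentiable f x ->
  'D_z f x = \sum_i z 0 i * partial i f x.
Proof.
move=> df; rewrite deriveE// [in LHS](row_sum_delta z) linear_sum.
by apply: eq_bigr => i _; rewrite linearZ/= /partial deriveE.
Qed.

Lemma is_derive_line f x z (t : R) : differentiable f (x + t *: z) ->
  is_derive t 1 (fun t => f (x + t *: z))
    (\sum_i z 0 i * partial i f (x + t *: z)).
Proof.
move=> df; rewrite -derive_partial//.
have E : (fun h : R => h^-1 *: (((fun t => f (x + t *: z)) \o shift t) (h *: 1)
   - f (x + t *: z))) =
  (fun h : R => h^-1 *: ((f \o shift (x + t *: z)) (h *: z) - f (x + t *: z))).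
  apply/funext => h /=; congr (_ *: (f _ - _)).
  by rewrite [h *: 1]mulr1 scalerDl addrCA.
by apply: DeriveDef; [rewrite /derivable E; exact: diff_derivable|rewrite /derive E].
Qed.

(** The mean value theorem along a segment; both the Lipschitz bound and the
    first-order Taylor estimate are read off from it. *)
Lemma mvt_segment f x z :
  (forall t : R, 0 <= t <= 1 -> differentiable f (x + t *: z)) ->
  exists2 t : R, 0 <= t <= 1 &
    f (x + z) - f x = \sum_i z 0 i * partial i f (x + t *: z).
Proof.
move=> df; pose F (t : R) := f (x + t *: z).
pose dF (t : R) := \sum_i z 0 i * partial i f (x + t *: z).
have dFE (t : R) : 0 <= t <= 1 -> is_derive t 1 F (dF t).
  by move=> t01; apply: is_derive_line; exact: df.
have h1 (t : R) : t \in `]0, 1[%R -> is_derive t 1 F (dF t).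
  by rewrite in_itv/= => /andP[t0 t1]; apply: dFE; rewrite !ltW.
have h2 : {within `[0, 1], continuous F}.
  by apply: derivable_within_continuous => t; rewrite in_itv/= => /dFE [].
have [c] := MVT_segment ler01 h1 h2.
rewrite in_itv/= => c01; rewrite subr0 mulr1 /F scale1r scale0r addr0 => E.
by exists c.
Qed.

(** A remainder of order [1 + k] is what the potentials below provide; it yields
    the differential and identifies the partial derivatives at once. *)
Lemma differentiable_of_partial_bound f x (a : 'I_d -> R) (C k : R) : 0 < k ->
  (forall z, `|f (x + z) - f x - \sum_i z 0 i * a i| <= C * enorm z `^ (1 + k)) ->
  differentiable f x /\ forall i, partial i f x = a i.
Proof.
move=> k0 H; pose l (z : Rd) := \sum_i z 0 i * a i.
have l_lin : linear l.
  move=> b u v; rewrite /l scaler_sumr -big_split; apply: eq_bigr => i _ /=.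
  by rewrite !mxE mulrDl -mulrA.
pose lM := GRing.isLinear.Build _ _ _ _ _ l_lin.
pose L : {linear Rd -> R} := HB.pack l lM.
have cL : continuous L.
  move=> z; apply/continuous_dist_ltP => e e0.
  pose A := \sum_i `|a i| + 1.
  have A0 : 0 < A by rewrite ltr_wpDl// sumr_ge0.
  exists (e / A); first by rewrite divr_gt0.
  move=> y; rewrite ltr_pdivlMr// => zy; apply: le_lt_trans zy.
  rewrite -[L z - L y]linearB /= /l (le_trans (ler_norm_sum _ _ _))//.
  rewrite /A mulrDr mulr1 mulr_sumr (@le_trans _ _ (\sum_i `|z - y| * `|a i|))//.
    by apply: ler_sum => i _; rewrite normrM ler_wpM2r// coord_le_norm.
  by rewrite lerDl.
have [|df E] := @differentiable_of_approx _ f x L cL.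
  move=> e e0; pose B := (`|C| + 1) * d%:R `^ (1 + k) + 1.
  have B0 : 0 < B by rewrite ltr_wpDl// mulr_ge0 ?powR_ge0// addr_ge0.
  exists ((e / B) `^ k^-1); first by rewrite powR_gt0 ?divr_gt0.
  move=> h hr; rewrite (addrC h x); apply: le_trans (H h) _.
  have [->|h0] := eqVneq h 0.
    by rewrite enorm0 normr0 mulr0 powR0 ?mulr0// gt_eqF// ltr_wpDl.
  have hp : 0 < `|h| by rewrite normr_gt0.
  have hk : `|h| `^ k <= e / B.
    rewrite -[leRHS]powRr1; last by rewrite divr_ge0// ltW.
    rewrite -(@mulVf _ k) ?gt_eqF// powRrM ge0_ler_powR//.
    - exact: ltW.
    - by rewrite nnegrE.
    - by rewrite nnegrE powR_ge0.
    - exact: ltW.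
  apply: (@le_trans _ _ (B * (`|h| * `|h| `^ k))).
    rewrite -{1}[`|h|]powRr1// -powRD; last first.
      by rewrite (gt_eqF hp) implybT.
    apply: (@le_trans _ _ ((`|C| + 1) * (d%:R * `|h|) `^ (1 + k))).
      apply: (@le_trans _ _ ((`|C| + 1) * enorm h `^ (1 + k))).
        by rewrite ler_wpM2r ?powR_ge0// (le_trans (ler_norm _))// lerDl.
      rewrite ler_wpM2l ?addr_ge0// ge0_ler_powR ?nnegrE ?enorm_ge0//.
      - by rewrite addr_ge0// ltW.
      exact: enorm_le_norm.
    by rewrite powRM// mulrA ler_wpM2r ?powR_ge0// /B lerDl.
  by rewrite mulrCA mulrC ler_wpM2r// -ler_pdivlMl// mulrC.
split=> // i; rewrite /partial deriveE// E /= /l (bigD1 i)//= big1.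
  by rewrite mxE !eqxx/= mul1r addr0.
by move=> j ji; rewrite mxE (negbTE ji) andbF mul0r.
Qed.

End differential.

Lemma continuous_eq_open (T : topologicalType) (R : realType) (U : set T)
    (f g : T -> R) x : open U -> U x -> (forall x, U x -> f x = g x) ->
  {for x, continuous f} -> {for x, continuous g}.
Proof.
move=> oU Ux fg h; have hx : f @ x --> g x by rewrite -fg.
apply: cvg_trans hx; apply: near_eq_cvg.
by apply: filterS fg _; exact: open_nbhs_nbhs.
Qed.

Section Ck.
Context (R : realType) (d : nat).
Local Notation Rd := 'rV[R]_d.
Implicit Types (U V : set Rd) (f g : Rd -> R) (s : seq 'I_d).

Lemma partials_cat s1 s2 f : partials (s1 ++ s2) f = partials s1 (partials s2 f).
Proof. by rewrite /partials foldr_cat. Qed.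

Lemma partials_rcons s i f : partials (rcons s i) f = partials s (partial i f).
Proof. by rewrite /partials foldr_rcons. Qed.

Lemma open_near U x (P : Rd -> Prop) : open U -> U x -> (forall y, U y -> P y) ->
  \forall y \near x, P y.
Proof. by move=> oU Ux UP; apply: filterS UP _; exact: open_nbhs_nbhs. Qed.

Lemma partial_eq_open U f g i : open U -> (forall x, U x -> f x = g x) ->
  forall x, U x -> partial i f x = partial i g x.
Proof.
by move=> oU fg x Ux; apply: near_eq_derive; exact: (open_near oU Ux).
Qed.

Lemma partials_eq_open U f g s : open U -> (forall x, U x -> f x = g x) ->
  forall x, U x -> partials s f x = partials s g x.
Proof. by move=> oU fg; elim: s => //= i s IH; exact: partial_eq_open. Qed.

Lemma differentiable_eq_open U f g x : open U -> U x ->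
  (forall x, U x -> f x = g x) -> differentiable f x -> differentiable g x.
Proof.
move=> oU Ux fg df.
have [//|L1 L2] := @differentiable_of_approx R _ g x ('d f x) (diff_continuous df).
  move=> e e0.
  have /eqaddoP/(_ e e0)/nbhs_normP[r r0 hr] := diff_locally df.
  have /nbhs_normP[r' r'0 hr'] := open_nbhs_nbhs (conj oU Ux).
  exists (Num.min r r'); first by rewrite lt_min r0.
  move=> h; rewrite lt_min => /andP[hr1 hr2]; rewrite -!fg//; last first.
    by apply: hr' => /=; rewrite opprD addrCA subrr addr0 normrN.
  have := hr h; rewrite /= sub0r normrN => /(_ hr1).
  by rewrite !fctE/= opprD addrA.
done.
Qed.

Lemma Ck_on0 U f : Ck_on 0 U f <-> forall x, U x -> {for x, continuous f}.
Proof.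
split=> [h x Ux|h s]; first by have [] := h [::] isT x Ux.
by rewrite leqn0 size_eq0 => /eqP-> x Ux; split => //; exact: h.
Qed.

(** Recursion on the order; the stability of [Ck_on] under the algebraic
    operations is proved by induction along it. *)
Lemma Ck_onS k U f : Ck_on k.+1 U f <->
  (forall x, U x -> differentiable f x) /\ forall i, Ck_on k U (partial i f).
Proof.
split=> [h|[df h] s].
  split=> [x Ux|i s sk x Ux]; first by have [_ /(_ isT)] := h [::] isT x Ux.
  by have := h (rcons s i); rewrite size_rcons ltnS partials_rcons; exact.
case/lastP: s => [_ x Ux|s i].
  by split=> [|_]; [apply: differentiable_continuous|]; exact: df.
by rewrite size_rcons partials_rcons => sk x Ux; exact: h.
Qed.

Lemma Ck_onW k l U f : (l <= k)%N -> Ck_on k U f -> Ck_on l U f.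
Proof.
move=> lk h s sl x Ux; have [h1 h2] := h s (leq_trans sl lk) x Ux.
by split=> // sl'; apply: h2; exact: leq_trans lk.
Qed.

Lemma Ck_on_sub k U V f : U `<=` V -> Ck_on k V f -> Ck_on k U f.
Proof. by move=> UV h s sk x Ux; apply: h => //; exact: UV. Qed.

Lemma Ck_on_continuous k U f : Ck_on k U f -> forall x, U x -> {for x, continuous f}.
Proof. by move=> /(Ck_onW (leq0n k))/Ck_on0. Qed.

Lemma Ck_on_partials k U f s : (size s <= k)%N -> Ck_on k U f ->
  Ck_on (k - size s) U (partials s f).
Proof.
move=> sk h t tk x Ux; rewrite -partials_cat.
have tsk : (size (t ++ s) <= k)%N.
  by rewrite size_cat addnC -(subnKC sk) leq_add2l.
have [h1 h2] := h (t ++ s) tsk x Ux.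
split=> // ts; apply: h2.
by rewrite size_cat addnC -(subnKC sk) ltn_add2l.
Qed.

Lemma Ck_on_eq k U f g : open U -> (forall x, U x -> f x = g x) ->
  Ck_on k U f -> Ck_on k U g.
Proof.
move=> oU; elim: k f g => [|k IH] f g fg.
  move=> /Ck_on0 h; apply/Ck_on0 => x Ux.
  exact: continuous_eq_open fg (h x Ux).
move=> /Ck_onS[df h]; apply/Ck_onS; split=> [x Ux|i].
  exact: (differentiable_eq_open oU Ux fg (df x Ux)).
by apply: IH (h i) => x Ux; exact: partial_eq_open Ux.
Qed.

Lemma partial_cst i (c : R) : partial i (fun _ : Rd => c) = fun _ => 0.
Proof. by apply/funext => x; rewrite /partial derive_cst. Qed.

Lemma Ck_on_cst k U (c : R) : Ck_on k U (fun _ => c).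
Proof.
elim: k c => [|k IH] c; first by apply/Ck_on0 => x _; exact: cst_continuous.
apply/Ck_onS; split=> [x _|i]; first exact: differentiable_cst.
by rewrite partial_cst; exact: IH.
Qed.

Lemma partialD i f g x : differentiable f x -> differentiable g x ->
  partial i (fun x => f x + g x) x = partial i f x + partial i g x.
Proof. by move=> df dg; rewrite /partial deriveD//; exact: diff_derivable. Qed.

Lemma partialM i f g x : differentiable f x -> differentiable g x ->
  partial i (fun x => f x * g x) x = f x * partial i g x + g x * partial i f x.
Proof. by move=> df dg; rewrite /partial deriveM//; exact: diff_derivable. Qed.

Lemma Ck_onD k U f g : open U -> Ck_on k U f -> Ck_on k U g ->
  Ck_on k U (fun x => f x + g x).
Proof.
move=> oU; elim: k f g => [|k IH] f g.
  move=> /Ck_on0 hf /Ck_on0 hg; apply/Ck_on0 => x Ux.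
  by apply: (@continuousD _ _ _ f g x); [exact: hf|exact: hg].
move=> /Ck_onS[df hf] /Ck_onS[dg hg]; apply/Ck_onS; split=> [x Ux|i].
  by apply: differentiableD; [exact: df|exact: dg].
apply: Ck_on_eq (IH _ _ (hf i) (hg i)) => // x Ux.
by rewrite partialD//; [exact: df|exact: dg].
Qed.

Lemma Ck_onM k U f g : open U -> Ck_on k U f -> Ck_on k U g ->
  Ck_on k U (fun x => f x * g x).
Proof.
move=> oU; elim: k f g => [|k IH] f g.
  move=> /Ck_on0 hf /Ck_on0 hg; apply/Ck_on0 => x Ux.
  by apply: (@continuousM _ _ f g x); [exact: hf|exact: hg].
move=> hf' hg'; move: (hf') (hg') => /Ck_onS[df hf] /Ck_onS[dg hg].
apply/Ck_onS; split=> [x Ux|i].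
  by apply: differentiableM; [exact: df|exact: dg].
have hf1 := Ck_onW (leqnSn k) hf'; have hg1 := Ck_onW (leqnSn k) hg'.
apply: Ck_on_eq (Ck_onD oU (IH _ _ hf1 (hg i)) (IH _ _ hg1 (hf i))) => // x Ux.
by rewrite partialM//; [exact: df|exact: dg].
Qed.

Lemma differentiable_scale f (a : R) x : differentiable f (a *: x) ->
  differentiable (fun x => f (a *: x)) x.
Proof.
by move=> df; apply: (@differentiable_comp _ _ _ _ ( *:%R a) f).
Qed.

Lemma partial_scale f (a : R) i x : differentiable f (a *: x) ->
  partial i (fun x => f (a *: x)) x = a * partial i f (a *: x).
Proof.
move=> df; rewrite /partial deriveE; last exact: differentiable_scale.
rewrite (@diff_comp _ _ _ _ ( *:%R a) f)//= diff_val /=.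
by rewrite linearZ/= deriveE.
Qed.

Lemma Ck_on_scale k U V f (a : R) : open U -> (forall x, U x -> V (a *: x)) ->
  Ck_on k V f -> Ck_on k U (fun x => f (a *: x)).
Proof.
move=> oU UV; elim: k f => [|k IH] f.
  move=> /Ck_on0 hf; apply/Ck_on0 => x Ux.
  apply: (@continuous_comp Rd Rd R (fun x => a *: x) f x); last exact/hf/UV.
  exact: scaler_continuous.
move=> /Ck_onS[df hf]; apply/Ck_onS; split=> [x Ux|i].
  by apply: differentiable_scale; exact/df/UV.
have h := Ck_onM oU (@Ck_on_cst k U a) (IH _ (hf i)).
apply: (Ck_on_eq oU _ h) => x Ux.
by rewrite partial_scale//; exact/df/UV.
Qed.

Lemma differentiable_powR f (b : R) x : 0 < f x -> differentiable f x ->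
  differentiable (fun x => f x `^ b) x.
Proof.
move=> f0 df; apply: (@differentiable_comp _ _ _ _ f (@powR R ^~ b)) => //.
by apply/derivable1_diffP/derivable_powR; rewrite in_itv/= andbT.
Qed.

Lemma partial_powR f (b : R) i x : 0 < f x -> differentiable f x ->
  partial i (fun x => f x `^ b) x = b * f x `^ (b - 1) * partial i f x.
Proof.
move=> f0 df.
have dp : differentiable (@powR R ^~ b) (f x).
  by apply/derivable1_diffP/derivable_powR; rewrite in_itv/= andbT.
rewrite /partial deriveE; last exact: differentiable_powR.
have E (t : R) : 'd (@powR R ^~ b) (f x) t = t * (b * f x `^ (b - 1)).
  rewrite -{1}(mulr1 t) -[t * 1]/(t *: (1 : R)) linearZ/= -deriveE// -derive1E.
  by rewrite powR_derive1// in_itv/= andbT.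
by rewrite (@diff_comp _ _ _ _ f (@powR R ^~ b))//= E -deriveE// mulrC.
Qed.

Lemma Ck_on_powR k U f (b : R) : open U -> (forall x, U x -> 0 < f x) ->
  Ck_on k U f -> Ck_on k U (fun x => f x `^ b).
Proof.
move=> oU f0; elim: k b => [|k IH] b hf.
  apply/Ck_on0 => x Ux; apply: (@continuous_comp _ _ _ f (@powR R ^~ b)).
    exact: (Ck_on_continuous hf).
  apply/differentiable_continuous/derivable1_diffP/derivable_powR.
  by rewrite in_itv/= andbT; exact: f0.
move: (hf) => /Ck_onS[df hf1]; apply/Ck_onS; split=> [x Ux|i].
  by apply: differentiable_powR; [exact: f0|exact: df].
have hk := IH (b - 1) (Ck_onW (leqnSn k) hf).
apply: Ck_on_eq (Ck_onM oU (Ck_onM oU (@Ck_on_cst k U b) hk) (hf1 i)) => // x Ux.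
by rewrite partial_powR//; [exact: f0|exact: df].
Qed.

End Ck.

(** * Affine changes of variables *)

Section affine_line.
Context (R : realType).
Local Notation leb := (@lebesgue_measure R).

Lemma lebesgue_affine (a b : R) (A : set (measurableTypeR R)) : 0 < a -> measurable A ->
  leb ((fun x => a * x + b) @^-1` A) = ((a^-1)%:E * leb A)%E.
Proof.
move=> a0 mA.
have ma : measurable_fun (setT : set (measurableTypeR R))
    (fun x : measurableTypeR R => a * x + b : measurableTypeR R).
  by apply: measurable_funD => //; exact: measurable_funM.
pose phi : measurableTypeR R -> measurableTypeR R := fun x => a * x + b.
have mphi : measurable_fun setT phi by exact: ma.
pose m : {measure set (measurableTypeR R) -> \bar R} :=
  mscale (NngNum (ltW a0)) (measure_function_pushforward__canonical__measure_function_Measure leb mphi).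
suff : leb A = m A.
  by move=> ->; rewrite /m/= /mscale/= muleA -EFinM mulVf ?gt_eqF// mul1e.
apply: lebesgue_measure_unique => // _ [[x y] _ <-].
rewrite /m/= /mscale/= /pushforward.
have -> : phi @^-1` `]x, y]%classic = `](x - b) / a, (y - b) / a]%classic.
  apply/seteqP; split=> z; rewrite /= !in_itv/= ltr_pdivrMr// ler_pdivlMr//;
    by rewrite ltrBlDr lerBrDr mulrC.
rewrite !lebesgue_measure_itv/= !lte_fin ltr_pM2r ?invr_gt0// ltrD2r.
case: ifPn => xy; last by rewrite mule0.
by rewrite -!EFinB -EFinM; congr EFin; field; rewrite gt_eqF.
Qed.

Lemma ge0_integral_affine (a b : R) (f : measurableTypeR R -> \bar R) : 0 < a ->
  measurable_fun setT f -> (forall x, (0 <= f x)%E) ->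
  (\int[leb]_x f (a * x + b)%R = (a^-1)%:E * \int[leb]_x f x)%E.
Proof.
move=> a0 mf f0.
have ma : measurable_fun (setT : set (measurableTypeR R))
    (fun x : measurableTypeR R => a * x + b : measurableTypeR R).
  by apply: measurable_funD => //; exact: measurable_funM.
pose phi : measurableTypeR R -> measurableTypeR R := fun x => a * x + b.
have av : 0 <= a^-1 by rewrite invr_ge0 ltW.
have := @ge0_integral_pushforward _ _ _ _ _ phi ma leb setT f measurableT mf
  (fun x _ => f0 x).
rewrite preimage_setT => <-.
rewrite -(@ge0_integral_mscale _ _ _ leb setT measurableT (NngNum av) f)//.
apply: eq_measure_integral => A mA _ /=.
by rewrite /pushforward /mscale/= lebesgue_affine.
Qed.

End affine_line.

Section tuple_measure.
Context (R : realType).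
Local Notation leb := (@lebesgue_measure R).
Local Notation T n := (n.-tuple (measurableTypeR R)).
Local Notation mu n := (@tuple_lebesgue R n).

Lemma ge0_integral_cons n (f : T n.+1 -> \bar R) : measurable_fun setT f ->
  (forall t, (0 <= f t)%E) ->
  (\int[mu n.+1]_t f t = \int[leb]_r \int[mu n]_t f (tuple_cons (r, t)))%E.
Proof.
move=> mf f0.
have := @ge0_integral_pushforward _ _ _ _ _ (@tuple_cons R n)
  (@measurable_tuple_cons R n) (leb \x mu n)%E setT f measurableT mf
  (fun x _ => f0 x).
rewrite preimage_setT => E; rewrite [LHS]E fubini_tonelli1//.
  by apply: measurableT_comp => //; exact: measurable_tuple_cons.
by move=> x; exact: f0.
Qed.

Definition tuple_affine n (a : R) (b : T n) (t : T n) : T n :=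
  [tuple a * tnth t i + tnth b i | i < n].

Lemma measurable_tuple_affine n (a : R) (b : T n) :
  measurable_fun setT (tuple_affine a b).
Proof.
apply/measurable_fun_tnthP => i; rewrite /comp.
under eq_fun do rewrite tnth_mktuple.
apply: measurable_funD => //; apply: measurable_funM => //.
exact: measurable_tnth.
Qed.

Lemma tuple_affine_cons n a (b : T n.+1) r (t : T n) :
  tuple_affine a b (tuple_cons (r, t)) =
  tuple_cons (a * r + tnth b ord0, tuple_affine a [tuple of behead b] t).
Proof.
apply: eq_from_tnth => i; rewrite tnth_mktuple.
case: (unliftP ord0 i) => [j|] ->; last by rewrite !tnth0.
by rewrite !tnthS tnth_mktuple tnth_behead// (_ : inord _ = lift ord0 j)//;
   apply/val_inj; rewrite /= inordK// ltnS.
Qed.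

(** By induction on the dimension, one coordinate at a time. *)
Lemma ge0_integral_tuple_affine n (a : R) (b : T n) (f : T n -> \bar R) :
  0 < a -> measurable_fun setT f -> (forall t, (0 <= f t)%E) ->
  (\int[mu n]_t f (tuple_affine a b t) = (a ^- n)%:E * \int[mu n]_t f t)%E.
Proof.
move=> a0; elim: n b f => [|n IH] b f mf f0.
  rewrite expr0 invr1 mul1e; apply: eq_integral => t _.
  by congr f; apply: eq_from_tnth => -[].
have mc := @measurable_tuple_cons R n.
rewrite ge0_integral_cons//; last first.
  by apply: measurableT_comp => //; exact: measurable_tuple_affine.
rewrite ge0_integral_cons//.
under eq_integral do under eq_integral do rewrite tuple_affine_cons.
have mf2 r : measurable_fun setT (fun t : T n => f (tuple_cons (r, t))).
  exact: measurableT_comp (measurableT_comp mf mc) (pair1_measurable r).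
under eq_integral do rewrite (IH _ (fun t => f (tuple_cons (_, t))))//.
have mg : measurable_fun setT (fun r => \int[mu n]_t f (tuple_cons (r, t)))%E.
  apply: (@measurable_fun_fubini_tonelli_F _ _ _ _ _ (mu n) (f \o @tuple_cons R n)).
    exact: measurableT_comp.
  by move=> ?; exact: f0.
have an : 0 <= a ^- n by rewrite invr_ge0 exprn_ge0// ltW.
have g0 r : (0 <= \int[mu n]_t f (tuple_cons (r, t)))%E by exact: integral_ge0.
rewrite (@ge0_integral_affine R a (tnth b ord0)
  (fun r => (a ^- n)%:E * \int[mu n]_t f (tuple_cons (r, t)))%E a0 (measurable_funeM _ mg)).
  by rewrite ge0_integralZl//= muleA -EFinM -invfM -exprS.
by move=> r; rewrite mule_ge0.
Qed.

Lemma integrable_tuple_affine n (a : R) (b : T n) (f : T n -> \bar R) :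
  0 < a -> (mu n).-integrable setT f ->
  (mu n).-integrable setT (f \o tuple_affine a b).
Proof.
move=> a0 /integrableP[mf fi]; apply/integrableP; split.
  by apply: measurableT_comp => //; exact: measurable_tuple_affine.
rewrite /= (@ge0_integral_tuple_affine n a b (fun t => `|f t|)%E)//; last first.
  exact: measurableT_comp.
rewrite lte_mul_pinfty// ?lee_fin ?invr_ge0 ?exprn_ge0// ltW//.
Qed.

Lemma integral_tuple_affine n (a : R) (b : T n) (f : T n -> \bar R) :
  0 < a -> (mu n).-integrable setT f ->
  (\int[mu n]_t f (tuple_affine a b t) = (a ^- n)%:E * \int[mu n]_t f t)%E.
Proof.
move=> a0 fi; have mf := measurable_int _ fi.
rewrite integralE [in RHS]integralE muleBr//; last first.
  apply: fin_num_adde_defr; apply: integrable_fin_num => //.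
  exact: integrable_funepos.
rewrite funepos_comp funeneg_comp !ge0_integral_tuple_affine//.
  exact: measurable_funeneg.
exact: measurable_funepos.
Qed.

End tuple_measure.

(** * Measurability and integrability of model functions *)

Section euclidean_integral.
Context (R : realType) (d : nat).
Local Notation Rd := 'rV[R]_d.
Local Notation T := (d.-tuple (measurableTypeR R)).
Local Notation mu := (@tuple_lebesgue R d).
Local Notation row := (@row_of_tuple R d).

Lemma measurable_grid (k : R) (z : {ffun 'I_d -> int}) :
  measurable [set t : T | forall i, Num.floor (k * tnth t i) = z i].
Proof.
rewrite (_ : mkset _ = \bigcap_(i in [set: 'I_d])
    (fun t : T => k * tnth t i) @^-1` `[(z i)%:~R, (z i + 1)%:~R[%classic).
  apply: fin_bigcap_measurable => [|i _]; first exact: finite_finset.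
  rewrite -[X in measurable X]setTI.
  have m : measurable_fun setT (fun t : T => k * tnth t i : measurableTypeR R).
    by apply: measurable_funM => //; exact: measurable_tnth.
  by apply: m => //; exact: measurable_itv.
apply/seteqP; split=> t /= h i.
  by move=> _ /=; rewrite in_itv/= -(h i) floor_itv.
by apply: floor_def; have := h i Logic.I; rewrite /= in_itv.
Qed.

(** Freezing a function on the cells of finer and finer grids yields functions
    that are measurable whatever the function is; continuity makes them
    converge to it. *)
Lemma measurable_continuous (f : Rd -> R) : continuous f ->
  measurable_fun setT (f \o row).
Proof.
move=> cf.
pose fl (k : nat) (t : T) : {ffun 'I_d -> int} :=
  [ffun i => Num.floor (k.+1%:R * tnth t i)].
pose F (k : nat) (z : {ffun 'I_d -> int}) : R :=
  f (\row_i ((z i)%:~R / k.+1%:R)).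
apply: (@measurable_fun_cvg _ _ _ _ (fun k t => F k (fl k t))).
  move=> k _ Y mY; rewrite setTI.
  rewrite (_ : _ @^-1` _ = \bigcup_n
     (if unpickle n is Some z then
        if `[< Y (F k z) >] then [set t : T | forall i, Num.floor (k.+1%:R * tnth t i) = z i] else set0
      else set0)).
    apply: bigcupT_measurable => n; case: unpickle => // z.
    by case: ifP => // _; exact: measurable_grid.
  apply/seteqP; split=> t /=.
    move=> Yt; exists (pickle (fl k t)) => //.
    by rewrite pickleK asboolT// => i; rewrite ffunE.
  case=> n _; case: unpickle => // z; case: asboolP => // Yz /= h.
  rewrite (_ : fl k t = z)//; apply/ffunP => i; by rewrite ffunE.
move=> t _ /=.
apply/cvgrPdist_lt => e e0.
have /continuous_dist_ltP/(_ e e0)[r r0 hr] := cf (row t).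
near=> k; apply: hr.
have k0 : 0 < k.+1%:R :> R by [].
rewrite [ltLHS]/Num.norm /= mx_normrE; apply/bigmax_ltP; split => // -[i j] _ /=.
rewrite !mxE ffunE ltr_norml.
have /andP[h1 h2] := floor_itv (k.+1%:R * tnth t j : R).
have hk : k.+1%:R^-1 < r.
  by near: k; exact: (near_infty_natSinv_lt (PosNum r0)).
set z := Num.floor _ in h1 h2 *.
have -> : tnth t j - z%:~R / k.+1%:R = (k.+1%:R * tnth t j - z%:~R) / k.+1%:R.
  by rewrite mulrBl mulrAC mulfV ?mul1r// gt_eqF.
apply/andP; split.
  by rewrite (@lt_le_trans _ _ 0)// ?oppr_lt0// divr_ge0// subr_ge0.
rewrite (le_lt_trans _ hk)// ler_piMl ?invr_ge0// lerBlDr.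
by move: h2; rewrite intrD addrC => /ltW.
Unshelve. all: by end_near. Qed.

End euclidean_integral.

Section integrable_line.
Context (R : realType).
Local Notation leb := (@lebesgue_measure R).

Lemma integrable_cauchy :
  leb.-integrable setT (fun r : R => ((1 + r ^+ 2)^-1)%:E).
Proof.
have m : measurable_fun (setT : set R) (fun r : R => (1 + r ^+ 2)^-1).
  by apply: continuous_measurable_fun; exact: continuous_oneDsqrV.
have ge0 (r : R) : 0 <= (1 + r ^+ 2)^-1.
  by rewrite invr_ge0 addr_ge0// sqr_ge0.
apply/integrableP; split; first exact/measurable_EFinP.
under eq_integral do rewrite gee0_abs ?lee_fin//.
rewrite ge0_symfun_integralT//=.
- rewrite -set_itvcy (@integral0y_oneDsqr R).
  by rewrite -EFinM ltry.
- exact: continuous_oneDsqrV.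
- by move=> r; rewrite /= sqrrN.
Qed.

Lemma integrable_exp_abs (k : R) : 0 < k ->
  leb.-integrable setT (fun r : R => (expR (- (k * `|r|)))%:E).
Proof.
move=> k0; have C0 : 0 < Num.min 1 (k ^+ 2 / 4).
  by rewrite lt_min ltr01 divr_gt0// exprn_gt0.
set C := Num.min _ _ in C0.
apply: (le_integrable _ _ _ (integrableZl measurableT C^-1 integrable_cauchy)) => //.
  apply/measurable_EFinP; apply: measurableT_comp => //.
  by apply: measurable_funN; apply: measurable_funM => //.
move=> r _ /=; rewrite lee_fin ger0_norm ?expR_ge0//.
apply: le_trans (ler_norm _).
rewrite expRN -invfM lef_pV2 ?posrE ?expR_gt0//; last first.
  by rewrite mulr_gt0// ltr_pwDl// sqr_ge0.
have h : 1 + k * `|r| / 2 <= expR (k * `|r| / 2) by exact: expR_ge1Dx.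
have h0 : 0 <= k * `|r| / 2 by rewrite divr_ge0// mulr_ge0// ltW.
have -> : expR (k * `|r|) = expR (k * `|r| / 2) ^+ 2.
  by rewrite expr2 -expRD -splitr.
apply: (@le_trans _ _ ((1 + k * `|r| / 2) ^+ 2)); last first.
  by rewrite ler_pXn2r// nnegrE ?expR_ge0// addr_ge0.
have -> : r ^+ 2 = `|r| ^+ 2 by rewrite real_normK ?num_real.
have C1 : C <= 1 by rewrite ge_min lexx.
have C2 : C <= k ^+ 2 / 4 by rewrite ge_min lexx orbT.
have : C * `|r| ^+ 2 <= (k ^+ 2 / 4) * `|r| ^+ 2 by rewrite ler_wpM2r ?exprn_ge0.
have -> : (1 + k * `|r| / 2) ^+ 2 = 1 + k ^+ 2 / 4 * `|r| ^+ 2 + 2 * (k * `|r| / 2).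
  by field.
rewrite mulrDr mulr1; nra.
Qed.

(** The exponential beats every power: in the variable [r = ln t], [t^a e^-t] is bounded. *)
Lemma exp_bound (a : R) : 0 <= a -> exists2 C, 0 < C & forall r : R,
  expR (a * r - expR r) <= C.
Proof.
rewrite le_eqVlt => /predU1P[<-|a0].
  exists 1 => // r; rewrite mul0r sub0r -expR0 ler_expR oppr_le0; exact: expR_ge0.
exists (expR (a * ln a)); first exact: expR_gt0.
move=> r; rewrite ler_expR.
have := expR_ge1Dx (r - ln a).
rewrite expRD expRN lnK ?posrE// ler_pdivlMr// => h.
have -> : a * r = (r - ln a) * a + a * ln a by ring.
nra.
Qed.

End integrable_line.

Section integrable_space.
Context (R : realType).
Local Notation T n := (n.-tuple (measurableTypeR R)).
Local Notation mu n := (@tuple_lebesgue R n).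

Lemma measurable_cauchy_prod n : measurable_fun setT
  (fun t : T n => \prod_(i < n) (1 + tnth t i ^+ 2)^-1).
Proof.
apply: measurable_prod => i _.
have -> : (fun t : T n => (1 + tnth t i ^+ 2)^-1) =
    (fun r : R => (1 + r ^+ 2)^-1) \o (fun t : T n => tnth t i) by [].
apply: measurableT_comp; last exact: measurable_tnth.
by apply: continuous_measurable_fun; exact: continuous_oneDsqrV.
Qed.

Lemma integrable_cauchy_prod n : (mu n).-integrable setT
  (fun t : T n => (\prod_(i < n) (1 + tnth t i ^+ 2)^-1)%:E).
Proof.
have p0 m (t : T m) : 0 <= \prod_(i < m) (1 + tnth t i ^+ 2)^-1.
  apply: prodr_ge0 => i _; rewrite invr_ge0 addr_ge0//.
  exact: (@sqr_ge0 R (tnth t i)).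
have mE m : measurable_fun setT (fun t : T m => (\prod_(i < m) (1 + tnth t i ^+ 2)^-1)%:E).
  by apply: measurableT_comp; [exact: EFin_measurable|exact: measurable_cauchy_prod].
apply/integrableP; split; first exact: mE.
under eq_integral do rewrite gee0_abs ?lee_fin//.
elim: n => [|n IH].
  rewrite /= integral_dirac//=; last exact: mE.
  by rewrite big_ord0 mule1 ltey_eq fin_num_measure.
rewrite ge0_integral_cons; [|exact: mE|by move=> t; rewrite lee_fin].
have c0 (r : R) : 0 <= (1 + r ^+ 2)^-1.
  by rewrite invr_ge0 addr_ge0// sqr_ge0.
set I := (\int[mu n]_t (\prod_(i < n) (1 + tnth t i ^+ 2)^-1)%:E)%E in IH.
have I0 : (0 <= I)%E by apply: integral_ge0 => t _; rewrite lee_fin.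
have E (r : measurableTypeR R) : (\int[mu n]_t
    (\prod_(i < n.+1) (1 + tnth (tuple_cons (r, t)) i ^+ 2)^-1)%:E =
    ((1 + (r : R) ^+ 2)^-1)%:E * I)%E.
  rewrite /I -ge0_integralZl//; first last.
  - by rewrite lee_fin; exact: c0.
  - by move=> t _; rewrite lee_fin.
  - exact: mE.
  apply: eq_integral => t _; rewrite big_ord_recl tnth0 EFinM.
  by congr (_ * _%:E)%E; apply: eq_bigr => i _; rewrite tnthS.
under eq_integral do rewrite E.
rewrite ge0_integralZr//; first last.
- by move=> r _; rewrite lee_fin; exact: c0.
- by have /integrableP[] := integrable_cauchy R.
rewrite lte_mul_pinfty//.
- by apply: integral_ge0 => r _; rewrite lee_fin; exact: c0.
- by apply: integrable_fin_num => //; exact: integrable_cauchy.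
Qed.

End integrable_space.

(** * Gaussians *)

Section gauss.
Context (R : realType) (d : nat).
Local Notation Rd := 'rV[R]_d.
Local Notation T := (d.-tuple (measurableTypeR R)).
Local Notation mu := (@tuple_lebesgue R d).
Local Notation row := (@row_of_tuple R d).

Definition gauss (x : Rd) : R := expR (- dot x x).

Lemma gauss_ge0 x : 0 <= gauss x. Proof. exact: expR_ge0. Qed.

Lemma gauss_enorm x : gauss x = expR (- enorm x ^+ 2).
Proof. by rewrite enorm_sqr. Qed.

Lemma gaussZ (c : R) x : gauss (c *: x) = expR (- (c ^+ 2 * enorm x ^+ 2)).
Proof. by rewrite gauss_enorm enormZ exprMn real_normK ?num_real. Qed.

Lemma gaussN x : gauss (- x) = gauss x.
Proof. by rewrite !gauss_enorm enormN. Qed.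

Lemma gauss_shift (c : R) x w :
  gauss (c *: (x + w)) <= expR (c ^+ 2 * enorm w ^+ 2) * gauss ((c / 2) *: x).
Proof.
rewrite !gaussZ -expRD ler_expR.
have : enorm x <= enorm (x + w) + enorm w.
  by rewrite -{1}(addrK w x) (le_trans (ler_enormD _ _))// enormN.
have := enorm_ge0 x; have := enorm_ge0 w; have := enorm_ge0 (x + w).
move: (enorm x) (enorm w) (enorm (x + w)) => p q r r0 q0 p0 h.
have h2 : p ^+ 2 / 4 <= q ^+ 2 + r ^+ 2.
  have : p ^+ 2 <= (r + q) ^+ 2 by rewrite ler_pXn2r ?nnegrE ?addr_ge0.
  nra.
have : c ^+ 2 * (p ^+ 2 / 4) <= c ^+ 2 * (q ^+ 2 + r ^+ 2).
  by rewrite ler_wpM2l ?sqr_ge0.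
have -> : (c / 2) ^+ 2 = c ^+ 2 / 4 by field.
lra.
Qed.

Lemma gauss_enormM x : enorm x * gauss x <= gauss (2^-1 *: x).
Proof.
rewrite gaussZ gauss_enorm expRN -[leLHS]mulrC ler_pdivrMl ?expR_gt0// -expRD.
apply: le_trans (expR_ge1Dx _); have := enorm_ge0 x; nra.
Qed.

Lemma partial_dot (z x : Rd) : differentiable (fun x : Rd => dot x z) x /\
  forall i, partial i (fun x : Rd => dot x z) x = z 0 i.
Proof.
apply: (@differentiable_of_partial_bound R d _ x (fun i => z 0 i) 0 1) => // w.
by rewrite dotDl [dot x z + _]addrC addrK -/(dot w z) subrr normr0 mul0r.
Qed.

Lemma derive_dot (z x v : Rd) : 'D_v (fun x : Rd => dot x z) x = dot v z.
Proof.
rewrite derive_partial; last exact: (partial_dot z x).1.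
by apply: eq_bigr => i _; rewrite (partial_dot z x).2.
Qed.

Lemma partial_dotxx x : differentiable (fun x : Rd => dot x x) x /\
  forall i, partial i (fun x : Rd => dot x x) x = 2 * x 0 i.
Proof.
apply: (@differentiable_of_partial_bound R d _ x (fun i => 2 * x 0 i) 1 1) => // w.
rewrite dotDl !dotDr (dotC w x).
have -> : \sum_i w 0 i * (2 * x 0 i) = 2 * dot x w.
  by rewrite /dot mulr_sumr; apply: eq_bigr => i _; ring.
rewrite (_ : _ - _ = dot w w); last by ring.
by rewrite mul1r ger0_norm ?dot_ge0// -enorm_sqr (_ : 1 + 1 = 2%:R)// powR_mulrn ?enorm_ge0.
Qed.

Lemma differentiable_gauss x : differentiable gauss x.
Proof.
apply: (@differentiable_comp _ _ _ _ (fun x : Rd => - dot x x) expR).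
  by apply: differentiableN; exact: (partial_dotxx x).1.
exact/derivable1_diffP/derivable_expR.
Qed.

Lemma partial_gauss i x : partial i gauss x = - 2 * x 0 i * gauss x.
Proof.
have df := (partial_dotxx x).1.
rewrite /partial deriveE; last exact: differentiable_gauss.
have dN : differentiable (fun x : Rd => - dot x x) x by exact: differentiableN.
have de : differentiable expR (- dot x x) by exact/derivable1_diffP/derivable_expR.
have E (t : R) : 'd expR (- dot x x) t = t * expR (- dot x x).
  rewrite -{1}(mulr1 t) -[t * 1]/(t *: (1 : R)) linearZ/= -deriveE//.
  by rewrite derive_val.
rewrite (@diff_comp _ _ _ _ (fun x : Rd => - dot x x) expR)//= E -deriveE//.
have h := (partial_dotxx x).2 i; rewrite /partial in h.
rewrite deriveN; last exact: diff_derivable.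
by rewrite h !mulNr.
Qed.

Lemma derive_gauss v x : 'D_v gauss x = - 2 * dot v x * gauss x.
Proof.
rewrite derive_partial; last exact: differentiable_gauss.
rewrite /dot mulr_sumr mulr_suml; apply: eq_bigr => i _.
by rewrite partial_gauss; ring.
Qed.

Lemma continuous_gauss : continuous gauss.
Proof. by move=> x; apply: differentiable_continuous; exact: differentiable_gauss. Qed.

End gauss.

Section gauss_integral.
Context (R : realType) (d : nat).
Local Notation Rd := 'rV[R]_d.
Local Notation T := (d.-tuple (measurableTypeR R)).
Local Notation mu := (@tuple_lebesgue R d).
Local Notation row := (@row_of_tuple R d).
Local Notation gauss := (@gauss R d).

Definition tuple_of_row (x : Rd) : T := [tuple x 0 i | i < d].

Lemma row_affine (a : R) (b : Rd) (t : T) :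
  row (tuple_affine a (tuple_of_row b) t) = a *: row t + b.
Proof. by apply/rowP => i; rewrite !mxE !tnth_mktuple. Qed.

Lemma dot_row (t : T) : dot (row t) (row t) = \sum_i tnth t i ^+ 2.
Proof. by apply: eq_bigr => i _; rewrite mxE expr2. Qed.

Lemma integrable_gauss : mu.-integrable setT (fun t => (gauss (row t))%:E).
Proof.
have m : measurable_fun setT (fun t => (gauss (row t))%:E).
  apply: measurableT_comp; first exact: EFin_measurable.
  by apply: measurable_continuous; exact: continuous_gauss.
apply: (le_integrable measurableT m _ (integrable_cauchy_prod R d)) => t _ /=.
rewrite lee_fin ger0_norm ?gauss_ge0//; apply: le_trans (ler_norm _).
rewrite /gauss expRN dot_row expR_sum -prodfV; apply: ler_prod => i _.
rewrite invr_ge0 expR_ge0/= lef_pV2 ?posrE ?expR_gt0 ?expR_ge1Dx//.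
by apply: ltr_pwDl => //; exact: (@sqr_ge0 R).
Qed.

Definition gauss_mass : R := \int[mu]_t gauss (row t).

Lemma gauss_massE : (\int[mu]_t (gauss (row t))%:E)%E = gauss_mass%:E.
Proof. by rewrite /gauss_mass /Rintegral fineK// integrable_fin_num// integrable_gauss. Qed.

Lemma gauss_mass_ge0 : 0 <= gauss_mass.
Proof. by apply: Rintegral_ge0 => t _; exact: gauss_ge0. Qed.

Lemma integral_gauss_affine (a : R) (b : Rd) : 0 < a ->
  (\int[mu]_t (gauss (a *: row t + b))%:E = (a ^- d * gauss_mass)%:E)%E.
Proof.
move=> a0; under eq_integral do rewrite -row_affine.
rewrite (@integral_tuple_affine R d a _ (fun t => (gauss (row t))%:E) a0).
  by rewrite gauss_massE EFinM.
exact: integrable_gauss.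
Qed.

Lemma integrable_gauss_affine (a : R) (b : Rd) : 0 < a ->
  mu.-integrable setT (fun t => (gauss (a *: row t + b))%:E).
Proof.
move=> a0; under eq_fun do rewrite -row_affine.
exact: (integrable_tuple_affine (tuple_of_row b) a0 integrable_gauss).
Qed.

(** Gaussian majorants survive translations, dilations and multiplication by
    polynomials, which makes this a convenient criterion. *)
Lemma integrable_le_gauss (F : Rd -> R) C c : 0 < c ->
  measurable_fun setT (F \o row) -> (forall x, `|F x| <= C * gauss (c *: x)) ->
  mu.-integrable setT (fun t => (F (row t))%:E).
Proof.
move=> c0 mF FC.
have i1 := integrableZl measurableT C (integrable_gauss_affine 0 c0).
apply: (le_integrable measurableT _ _ i1).
  by apply: measurableT_comp => //; exact: EFin_measurable.
move=> t _ /=; rewrite lee_fin addr0; exact: le_trans (FC _) (ler_norm _).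
Qed.

(** Integration by parts in the form used here: the integral of a translate does
    not depend on the translation, so the integral of the derivative vanishes. *)
Lemma integral_derive_eq0 (F : Rd -> R) (v : Rd) C c : 0 < c ->
  (forall x, differentiable F x) ->
  (forall x, `|F x| <= C * gauss (c *: x)) ->
  (forall x, `|'D_v F x| <= C * gauss (c *: x)) ->
  measurable_fun setT ('D_v F \o row) ->
  \int[mu]_t 'D_v F (row t) = 0.
Proof.
move=> c0 dF F1 F2 mdF.
have mF : measurable_fun setT (F \o row).
  apply: measurable_continuous => x; exact: differentiable_continuous.
have iF := integrable_le_gauss c0 mF F1.
pose h (k : nat) : R := k.+1%:R^-1.
have h0 k : 0 < h k by rewrite invr_gt0.
pose q (k : nat) (t : T) : R := (h k)^-1 * (F (1 *: row t + h k *: v) - F (row t)).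
have iFk k : mu.-integrable setT (fun t => (F (1 *: row t + h k *: v))%:E).
  under eq_fun do rewrite -row_affine.
  exact: (integrable_tuple_affine (tuple_of_row (h k *: v)) ltr01 iF).
have iq k : mu.-integrable setT (fun t => (q k t)%:E).
  exact: (integrableZl measurableT (h k)^-1 (integrableB measurableT (iFk k) iF)).
have q0 k : (\int[mu]_t (q k t)%:E)%E = 0%E.
  have iB := integrableB measurableT (iFk k) iF.
  rewrite [LHS](integralZl measurableT iB (h k)^-1) integralB//.
  under eq_integral do rewrite -row_affine.
  rewrite (@integral_tuple_affine R d 1 _ (fun t => (F (row t))%:E) ltr01 iF).
  rewrite expr1n invr1 mul1e subee ?mule0//.
  exact: integrable_fin_num.
pose C' := `|C| * expR (c ^+ 2 * enorm v ^+ 2).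
have C'0 : 0 <= C' by rewrite mulr_ge0// expR_ge0.
have c20 : 0 < c / 2 by rewrite divr_gt0.
have iG := integrableZl measurableT C' (integrable_gauss_affine 0 c20).
have [||||//|_ _] := @dominated_convergence _ T R mu setT measurableT
  (fun k t => (q k t)%:E) (fun t => ('D_v F (row t))%:E)
  (fun t => (C'%:E * (gauss ((c / 2) *: row t + 0))%:E)%E).
- by move=> k; exact: measurable_int (iq k).
- by apply: measurableT_comp => //; exact: EFin_measurable.
- apply: aeW => t _; apply: cvg_EFin; first exact: nearW.
  have := @diff_derivable _ _ _ F (row t) v (dF (row t)).
  move=> /cvg_ex[/= l hl].
  have El : 'D_v F (row t) = l by apply: cvg_lim.
  rewrite El.
  apply: (@cvg_trans _ ((fun e : R => e^-1 *: ((F \o shift (row t)) (e *: v) - F (row t))) \o h @ \oo)).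
    apply: near_eq_cvg; near=> k; rewrite /= /q scale1r.
    by rewrite [row t + _]addrC.
  have hd : h @ \oo --> (0 : R)^'.
    move=> A hA; have h1 : h @ \oo --> (0 : R) by exact: (@cvg_harmonic R).
    apply: (@filterS _ \oo _ (h @^-1` [set x | x != 0 -> A x]) (h @^-1` A)) (h1 _ hA) => k /=; apply.
    by rewrite gt_eqF.
  exact: cvg_comp hd hl.
- exact: iG.
- apply: aeW => t k _; rewrite lee_fin /q scale1r normrM ger0_norm ?invr_ge0 ?(ltW (h0 k))//.
  have [s s01 ->] := @mvt_segment R d F (row t) (h k *: v) (fun s _ => dF _).
  rewrite -derive_partial// .
  have -> : 'D_(h k *: v) F (row t + s *: (h k *: v)) = h k * 'D_v F (row t + s *: (h k *: v)).
    by rewrite !deriveE// linearZ.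
  rewrite normrM (ger0_norm (ltW (h0 k))) mulrA mulVf ?gt_eqF// mul1r.
  apply: le_trans (F2 _) _; rewrite addr0.
  apply: (@le_trans _ _ (`|C| * gauss (c *: (row t + s *: (h k *: v))))).
    by rewrite ler_wpM2r ?gauss_ge0// ler_norm.
  rewrite /C' -mulrA ler_wpM2l//.
  apply: le_trans (gauss_shift _ _ _) _.
  rewrite ler_wpM2r ?gauss_ge0// ler_expR ler_wpM2l ?sqr_ge0//.
  rewrite ler_pXn2r ?nnegrE ?enorm_ge0// !enormZ.
  rewrite mulrA ler_piMl ?enorm_ge0// mulr_ile1//.
  + by case/andP: s01 => s0 s1; rewrite ger0_norm.
  + by rewrite ger0_norm ?(ltW (h0 k))// invf_le1// ler1n.
rewrite (_ : (fun n : nat => _) = fun=> 0%E); last by apply/funext => k; rewrite q0.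
move=> hlim; rewrite /Rintegral.
have -> : (\int[mu]_t ('D_v F (row t))%:E)%E = 0%E; last by [].
by apply: cvg_unique hlim _ => //; exact: cvg_cst.
Unshelve. all: by end_near. Qed.

End gauss_integral.

(** * The Fourier transform of a Gaussian *)

Lemma is_derive_congr (R : realType) (f g : R -> R) (x a b : R) :
  is_derive x (1 : R) f a -> f =1 g -> a = b -> is_derive x (1 : R) g b.
Proof. by move=> h /funext <- <-. Qed.

Section gauss_fourier.
Context (R : realType) (d : nat).
Local Notation Rd := 'rV[R]_d.
Local Notation T := (d.-tuple (measurableTypeR R)).
Local Notation mu := (@tuple_lebesgue R d).
Local Notation row := (@row_of_tuple R d).
Local Notation gauss := (@gauss R d).

Lemma measurable_row_comp (F : Rd -> R) dP (P : measurableType dP) (g : P -> T) :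
  continuous F -> measurable_fun setT g -> measurable_fun setT (fun p => F (row (g p))).
Proof.
by move=> cF mg; apply: (measurableT_comp (measurable_continuous cF) mg).
Qed.

Lemma continuous_dot (z : Rd) : continuous (fun x : Rd => dot x z).
Proof. by move=> x; apply: differentiable_continuous; exact: (partial_dot z x).1. Qed.

Lemma continuousRd_comp (f : Rd -> R) (g : R -> R) :
  continuous f -> continuous g -> continuous (fun x => g (f x)).
Proof. by move=> cf cg x; exact: (@continuous_comp Rd R R f g x (cf x) (cg (f x))). Qed.

Lemma continuousRdM (f g : Rd -> R) :
  continuous f -> continuous g -> continuous (fun x => f x * g x).
Proof. by move=> cf cg x; exact: (@continuousM _ _ f g x (cf x) (cg x)). Qed.

Lemma continuousRdD (f g : Rd -> R) :
  continuous f -> continuous g -> continuous (fun x => f x + g x).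
Proof. by move=> cf cg x; exact: (@continuousD _ _ _ f g x (cf x) (cg x)). Qed.

Lemma gauss_le_half x : gauss x <= gauss (2^-1 *: x).
Proof.
rewrite gaussZ gauss_enorm ler_expR lerN2.
by have := sqr_ge0 (enorm x); nra.
Qed.

Section fourier_ode.
Variable z : Rd.
Let I (s : R) := \int[mu]_t (gauss (row t) * cos (s * dot (row t) z)).

Let norm_dot x : `|dot x z| <= enorm z * enorm x.
Proof.
rewrite ler_norml; have := dot_le_enorm x z; have := dot_le_enorm (- x) z.
rewrite enormN -scaleN1r dotZl => h1 h2; apply/andP; split; nra.
Qed.

Let cont_trig (f : R -> R) s : continuous f -> continuous (fun x : Rd => f (s * dot x z)).
Proof.
move=> cf; apply: (@continuousRd_comp (fun x => s * dot x z) f) => //.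
apply: (@continuousRdM (fun _ => s) (fun x => dot x z)); last exact: continuous_dot.
by move=> x; exact: cst_continuous.
Qed.

Let integrable_trig (f : R -> R) s : continuous f -> (forall x, `|f x| <= 1) ->
  mu.-integrable setT (fun t => (gauss (row t) * f (s * dot (row t) z))%:E).
Proof.
move=> cf f1.
apply: (@integrable_le_gauss R d (fun x => gauss x * f (s * dot x z)) 1 1) => //.
  apply: measurable_continuous.
  by apply: continuousRdM; [exact: continuous_gauss|exact: cont_trig].
by move=> x; rewrite scale1r mul1r normrM ger0_norm ?gauss_ge0// ler_piMr// gauss_ge0.
Qed.

Let bound_dot_gauss x (b : R) : `|b| <= 1 ->
  `|dot x z * gauss x * b| <= enorm z * gauss (2^-1 *: x).
Proof.
move=> b1; rewrite normrM (@le_trans _ _ `|dot x z * gauss x|)//.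
  by rewrite ler_piMr.
rewrite normrM (ger0_norm (gauss_ge0 _)).
apply: le_trans (_ : enorm z * enorm x * gauss x <= _).
  by rewrite ler_wpM2r ?gauss_ge0.
by rewrite -mulrA ler_wpM2l ?enorm_ge0// gauss_enormM.
Qed.

Let integrable_dot_sin s :
  mu.-integrable setT (fun t => (dot (row t) z * gauss (row t) * sin (s * dot (row t) z))%:E).
Proof.
apply: (@integrable_le_gauss R d (fun x => dot x z * gauss x * sin (s * dot x z)) (enorm z) 2^-1) => //.
  apply: measurable_continuous; apply: continuousRdM.
    by apply: continuousRdM; [exact: continuous_dot|exact: continuous_gauss].
  by apply: cont_trig; exact: continuous_sin.
by move=> x; exact: bound_dot_gauss (sin_max _).
Qed.

Let ibp s : 2 * \int[mu]_t (dot (row t) z * gauss (row t) * sin (s * dot (row t) z))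
  = s * dot z z * I s.
Proof.
pose F (x : Rd) := gauss x * sin (s * dot x z).
have dlin x : differentiable (fun x : Rd => s * dot x z) x.
  by apply: differentiableM => //; exact: (partial_dot z x).1.
have dsin x : differentiable (fun x : Rd => sin (s * dot x z)) x.
  apply: (@differentiable_comp _ _ _ _ (fun x : Rd => s * dot x z) sin) => //.
  exact/derivable1_diffP/derivable_sin.
have Dsin x : 'D_z (fun x : Rd => sin (s * dot x z)) x = cos (s * dot x z) * (s * dot z z).
  rewrite deriveE//.
  have ds : differentiable sin (s * dot x z) by exact/derivable1_diffP/derivable_sin.
  have E (t : R) : 'd sin (s * dot x z) t = t * cos (s * dot x z).
    rewrite -{1}(mulr1 t) -[t * 1]/(t *: (1 : R)) linearZ/= -deriveE//.
    by rewrite derive_val.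
  rewrite (@diff_comp _ _ _ _ (fun x : Rd => s * dot x z) sin)//= E -deriveE//.
  have -> : 'D_z (fun x : Rd => s * dot x z) x = s * dot z z.
    have := @deriveZ _ _ _ (fun x : Rd => dot x z) s x z.
    move=> ->; first by rewrite derive_dot.
    by apply: diff_derivable; exact: (partial_dot z x).1.
  by rewrite mulrC.
have dF x : differentiable F x.
  by apply: differentiableM => //; exact: differentiable_gauss.
have DF x : 'D_z F x = s * dot z z * (gauss x * cos (s * dot x z))
     - 2 * (dot x z * gauss x * sin (s * dot x z)).
  rewrite /F deriveM; [|exact/diff_derivable/differentiable_gauss|exact/diff_derivable].
  by rewrite Dsin derive_gauss (dotC z x) /GRing.scale /=; ring.
have := @integral_derive_eq0 R d F z (`|s| * dot z z + 2 * enorm z + 1) 2^-1.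
have E : 'D_z F \o row = (fun t => s * dot z z * (gauss (row t) * cos (s * dot (row t) z))
     - 2 * (dot (row t) z * gauss (row t) * sin (s * dot (row t) z))).
  by apply/funext => t; rewrite /= DF.
have bc0 : 0 <= `|s| * dot z z + 2 * enorm z.
  by rewrite addr_ge0// mulr_ge0// ?dot_ge0 ?enorm_ge0.
have bs : 0 <= `|s| * dot z z by rewrite mulr_ge0// dot_ge0.
have icos := integrable_trig s (@continuous_cos R) (fun x => cos_max x).
have isin := integrable_dot_sin s.
have iE : mu.-integrable setT (EFin \o ('D_z F \o row)).
  rewrite E.
  exact: (integrableB measurableT (integrableZl measurableT (s * dot z z) icos)
    (integrableZl measurableT 2 isin)).
move=> /(_ _ dF) H.
have : \int[mu]_t 'D_z F (row t) = 0.
  apply: H => //.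
  - move=> x; rewrite /F normrM (ger0_norm (gauss_ge0 _)).
    apply: (@le_trans _ _ (1 * gauss (2^-1 *: x))).
      rewrite mul1r; apply: le_trans (gauss_le_half x).
      by rewrite ler_piMr ?gauss_ge0// sin_max.
    by rewrite ler_wpM2r ?gauss_ge0// lerDr.
  - move=> x; rewrite DF (le_trans (ler_normB _ _))// normrM (normrM 2).
    rewrite [in leRHS]mulrDl mul1r [in leRHS]mulrDl -addrA lerD//.
      rewrite normrM (ger0_norm (dot_ge0 z)) ler_wpM2l//.
      rewrite normrM (ger0_norm (gauss_ge0 _)); apply: le_trans (gauss_le_half x).
      by rewrite ler_piMr ?gauss_ge0// cos_max.
    rewrite (ger0_norm (ler0n _ 2)) -[2 * enorm z * _]mulrA.
    rewrite (@le_trans _ _ (2 * (enorm z * gauss (2^-1 *: x))))//.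
      by rewrite ler_wpM2l// bound_dot_gauss// sin_max.
    by rewrite lerDl gauss_ge0.
  - by apply/measurable_EFinP; exact: measurable_int iE.
rewrite -[X in _ = X -> _](subrr (s * dot z z * I s)) => h.
have : \int[mu]_t 'D_z F (row t) = s * dot z z * I s
     - 2 * \int[mu]_t (dot (row t) z * gauss (row t) * sin (s * dot (row t) z)).
  transitivity (\int[mu]_t (s * dot z z * (gauss (row t) * cos (s * dot (row t) z))
     - 2 * (dot (row t) z * gauss (row t) * sin (s * dot (row t) z)))).
    by apply: eq_Rintegral => t _; rewrite DF.
  rewrite RintegralB//.
  - by rewrite !RintegralZl.
  - exact: (integrableZl measurableT (s * dot z z) icos).
  - exact: (integrableZl measurableT 2 isin).
by rewrite h => /addrI/oppr_inj.
Qed.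

Let dI (s : R) : is_derive s (1 : R) I (- (s / 2 * dot z z) * I s).
Proof.
pose f (s : R) (t : T) := gauss (row t) * cos (s * dot (row t) z).
have df (s' : R) (t : T) : is_derive s' (1 : R) (f ^~ t) (- (dot (row t) z * gauss (row t) * sin (s' * dot (row t) z))).
  rewrite /f; set a := gauss _; set b := dot _ _.
  have h : is_derive s' (1 : R) (fun s : R => s * b) b.
    apply: (is_derive_congr (@is_deriveM _ _ id (cst b) s' 1 1 0
      (is_derive_id s' (1 : R)) (is_derive_cst b s' (1 : R)))) => //.
    by rewrite /GRing.scale/= mulr0 add0r mulr1.
  have hc := @is_derive1_comp R cos (fun s : R => s * b) s' _ _ (is_derive_cos _) h.
  apply: (is_derive_congr (@is_deriveZ _ _ _ _ a s' (1 : R) _ hc)) => //.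
  by rewrite /GRing.scale/=; ring.
have I0 : `]s - 1, s + 1[%classic s.
  by rewrite /= in_itv/= ltrDl ltr01 gtrDl oppr_lt0 ltr01.
have G0 t : 0 <= enorm z * gauss (2^-1 *: row t) by rewrite mulr_ge0 ?enorm_ge0 ?gauss_ge0.
have iG : mu.-integrable setT (fun t => (enorm z * gauss (2^-1 *: row t))%:E).
  apply: (@integrable_le_gauss R d (fun x => enorm z * gauss (2^-1 *: x)) (enorm z) 2^-1) => //.
    apply: measurable_continuous; apply: (@continuousRdM (fun _ => enorm z)).
      by move=> x; exact: cst_continuous.
    move=> x; apply: (@continuous_comp Rd Rd R (fun x => 2^-1 *: x) gauss x).
      exact: scaler_continuous.
    exact: continuous_gauss.
  by move=> x; rewrite ger0_norm// mulr_ge0 ?enorm_ge0 ?gauss_ge0.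
have p1 (x : R) (t : T) : partial1of2 f x t = - (dot (row t) z * gauss (row t) * sin (x * dot (row t) z)).
  by rewrite partial1of2E; have [_] := df x t.
have h1 (x : R) : `]s - 1, s + 1[%classic x -> mu.-integrable setT (EFin \o f x).
  by move=> _; exact: (integrable_trig x (@continuous_cos R) (fun x => cos_max x)).
have h2 (x : R) (t : T) : `]s - 1, s + 1[%classic x -> setT t -> derivable (f ^~ t) x 1.
  by move=> _ _; have [] := df x t.
have h3 (x : R) (t : T) : `]s - 1, s + 1[%classic x -> setT t ->
    `|partial1of2 f x t| <= enorm z * gauss (2^-1 *: row t).
  by move=> _ _; rewrite p1 normrN bound_dot_gauss// sin_max.
have D1 := derivable_under_integral measurableT I0 h1 h2 G0 iG h3.
have D2 := differentiation_under_integral measurableT I0 h1 h2 G0 iG h3.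
apply: DeriveDef => //.
rewrite -derive1E D2; under eq_Rintegral do rewrite p1.
under eq_Rintegral do rewrite -mulN1r.
rewrite RintegralZl//; last exact: integrable_dot_sin.
have := ibp s; lra.
Qed.

(** The Fourier transform of a Gaussian, obtained along the ray through [z]
    from the differential equation that integration by parts provides. *)
Lemma fourier_gauss : \int[mu]_t (gauss (row t) * cos (dot (row t) z)) =
  gauss_mass R d * gauss (2^-1 *: z).
Proof.
pose M s := I s * expR (s ^+ 2 * (dot z z / 4)).
have dM (s : R) : is_derive s (1 : R) M 0.
  have h1 : is_derive s (1 : R) (fun s : R => s ^+ 2 * (dot z z / 4)) (s * (dot z z / 2)).
    have h0 := @is_deriveM _ _ id id s 1 1 1 (is_derive_id s (1 : R)) (is_derive_id s (1 : R)).
    apply: (is_derive_congr (@is_deriveZ _ _ _ _ (dot z z / 4) s (1 : R) _ h0)).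
      by move=> u; rewrite [RHS]mulrC expr2.
    by rewrite /GRing.scale/=; field.
  have h2 := @is_derive1_comp R expR (fun s : R => s ^+ 2 * (dot z z / 4)) s _ _ (is_derive_expR _) h1.
  apply: (is_derive_congr (@is_deriveM _ _ _ _ s (1 : R) _ _ (dI s) h2)) => //.
  by rewrite /GRing.scale/=; field.
have := is_derive_0_is_cst 1 0 dM; rewrite /M /I !expr1n expr0n/= !mul0r expR0 mulr1 mul1r.
under eq_Rintegral do rewrite mul1r.
under [RHS]eq_Rintegral do rewrite mul0r cos0 mulr1.
rewrite -/(gauss_mass R d) => <-.
rewrite gaussZ enorm_sqr -mulrA -expRD (_ : _ + _ = 0) ?expR0 ?mulr1//.
by field.
Qed.

End fourier_ode.
End gauss_fourier.

(** * Test functions and their Fourier transforms *)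

Section test_functions.
Context (R : realType) (d : nat).
Local Notation Rd := 'rV[R]_d.
Local Notation T := (d.-tuple (measurableTypeR R)).
Local Notation mu := (@tuple_lebesgue R d).
Local Notation row := (@row_of_tuple R d).
Local Notation gauss := (@gauss R d).
Implicit Types (U : set Rd) (phi : Rd -> R).

Lemma compact_closed_row (K : set Rd) : compact K -> closed K.
Proof. by apply: compact_closed; exact: norm_hausdorff. Qed.

Lemma smooth_onS U phi : smooth_on U phi ->
  (forall x, U x -> differentiable phi x) /\ forall i, smooth_on U (partial i phi).
Proof.
move=> h; split; first by have /Ck_onS[] := h 1%N.
by move=> i k; have /Ck_onS[_] := h k.+1; exact.
Qed.

Lemma smooth_on_continuous phi : smooth_on setT phi -> continuous phi.
Proof. by move=> h x; apply: (Ck_on_continuous (h 0%N)). Qed.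

Lemma test_function_sub U phi : test_function U phi -> test_function setT phi.
Proof. by move=> [h [K [cK _ K0]]]; split => //; exists K. Qed.

Lemma test_function_partial U phi i : test_function U phi ->
  test_function U (partial i phi).
Proof.
move=> [h [K [cK KU K0]]]; split; first exact: (smooth_onS h).2.
exists K; split => // x nKx.
have oK : open (~` K) by apply: closed_openC; exact: compact_closed_row.
by rewrite (@partial_eq_open R d (~` K) phi (fun _ => 0) i oK K0 x nKx) partial_cst.
Qed.

Lemma test_function_lin U (a : R) phi1 phi2 : test_function U phi1 ->
  test_function U phi2 -> test_function U (fun x => a * phi1 x + phi2 x).
Proof.
move=> [h1 [K1 [cK1 K1U K10]]] [h2 [K2 [cK2 K2U K20]]]; split.
  move=> k; apply: Ck_onD; [exact: openT| |exact: h2].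
  by apply: Ck_onM; [exact: openT|exact: Ck_on_cst|exact: h1].
exists (K1 `|` K2); split.
- exact: compactU.
- by move=> x [/K1U|/K2U].
- by move=> x /not_orP[n1 n2]; rewrite K10// K20// mulr0 addr0.
Qed.

(** A Gaussian majorant stands in for the compact support when integrability
    is at stake. *)
Lemma test_function_bound U phi : test_function U phi ->
  exists2 C, 0 <= C & forall x, `|phi x| <= C * gauss x.
Proof.
move=> [h [K [cK KU K0]]].
have cphi := smooth_on_continuous h.
have [M [_ HM]] := compact_bounded cK.
have cI : compact (phi @` K).
  by apply: continuous_compact cK; exact: continuous_subspaceT.
have [N [_ HN]] := compact_bounded cI.
exists (`|N + 1| * expR ((d%:R * `|M + 1|) ^+ 2)).
  by rewrite mulr_ge0// expR_ge0.
move=> x; have [Kx|nKx] := pselect (K x); last first.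
  by rewrite K0// normr0 mulr_ge0 ?gauss_ge0// mulr_ge0// expR_ge0.
have xM : `|x| <= M + 1 by apply: HM => //; rewrite ltrDl.
have fN : `|phi x| <= N + 1 by apply: HN; [rewrite ltrDl|exists x].
rewrite -mulrA; apply: (@le_trans _ _ (`|N + 1| * 1)).
  by rewrite mulr1 (le_trans fN)// ler_norm.
rewrite ler_wpM2l// gauss_enorm -expRD.
apply: le_trans (expR_ge1Dx _); rewrite lerDl subr_ge0.
rewrite ler_pXn2r ?nnegrE ?enorm_ge0 ?mulr_ge0//.
apply: le_trans (enorm_le_norm _) _; rewrite ler_wpM2l//.
by rewrite (le_trans xM)// ler_norm.
Qed.

Lemma integrable_test (phi : Rd -> R) (f : R -> R) (g : Rd -> R) : test_function setT phi ->
  continuous f -> continuous g -> (forall x, `|f x| <= 1) ->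
  mu.-integrable setT (fun t => (phi (row t) * f (g (row t)))%:E).
Proof.
move=> tphi cf cg f1; have [C C0 hC] := test_function_bound tphi.
apply: (@integrable_le_gauss R d (fun x => phi x * f (g x)) C 1) => //.
  apply: measurable_continuous; apply: continuousRdM.
    by apply: smooth_on_continuous; have [] := tphi.
  exact: continuousRd_comp.
move=> x; rewrite scale1r normrM; apply: le_trans (hC x).
by rewrite ler_piMr.
Qed.

(** The phase [a] takes the place of separate cosine and sine transforms:
    differentiating the function shifts it by [pi / 2]. *)
Definition cosine_transform (phi : Rd -> R) (a : R) (xi : Rd) : R :=
  \int[mu]_t (phi (row t) * cos (dot (row t) xi + a)).

Let cont_phase (xi : Rd) (a : R) : continuous (fun x : Rd => dot x xi + a).
Proof.
apply: (@continuousRdD R d _ (fun _ => a)); first exact: continuous_dot.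
by move=> x; exact: cst_continuous.
Qed.

Lemma cosine_transform_partial phi a i xi : test_function setT phi ->
  cosine_transform (partial i phi) a xi = xi 0 i * cosine_transform phi (a - pi / 2) xi.
Proof.
move=> tphi; pose e : Rd := delta_mx 0 i.
have tp := test_function_partial i tphi.
have dphi x : differentiable phi x by apply: (smooth_onS tphi.1).1.
have dlin x : differentiable (fun x : Rd => dot x xi + a) x.
  by apply: differentiableD => //; exact: (partial_dot xi x).1.
have dcos x : differentiable (fun x : Rd => cos (dot x xi + a)) x.
  apply: (@differentiable_comp _ _ _ _ (fun x : Rd => dot x xi + a) cos) => //.
  exact/derivable1_diffP/derivable_cos.
have de : dot e xi = xi 0 i.
  rewrite /dot (bigD1 i)//= big1 => [|j ji]; last by rewrite mxE (negbTE ji) andbF mul0r.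
  by rewrite mxE !eqxx mul1r addr0.
have Dcos x : 'D_e (fun x : Rd => cos (dot x xi + a)) x =
    - (xi 0 i * cos (dot x xi + (a - pi / 2))).
  rewrite deriveE//.
  have ds : differentiable cos (dot x xi + a) by exact/derivable1_diffP/derivable_cos.
  have E (t : R) : 'd cos (dot x xi + a) t = t * - sin (dot x xi + a).
    rewrite -{1}(mulr1 t) -[t * 1]/(t *: (1 : R)) linearZ/= -deriveE//.
    by rewrite derive_val.
  rewrite (@diff_comp _ _ _ _ (fun x : Rd => dot x xi + a) cos)//= E -deriveE//.
  have -> : 'D_e (fun x : Rd => dot x xi + a) x = xi 0 i.
    have h : derivable (fun x : Rd => dot x xi) x e.
      by apply: diff_derivable; exact: (partial_dot xi x).1.
    have := @deriveD _ _ _ (fun x : Rd => dot x xi) (cst a) x e h => ->//.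
    by rewrite derive_cst addr0 derive_dot de.
  by rewrite addrA cosB cos_pihalf sin_pihalf mulr0 add0r mulr1 mulrN.
pose F (x : Rd) := phi x * cos (dot x xi + a).
have dF x : differentiable F x by exact: differentiableM.
have DF x : 'D_e F x = partial i phi x * cos (dot x xi + a)
     - xi 0 i * (phi x * cos (dot x xi + (a - pi / 2))).
  rewrite /F deriveM; [|exact: diff_derivable|exact: diff_derivable].
  by rewrite Dcos /GRing.scale /= /partial -/e; ring.
have i1 := integrable_test tp (@continuous_cos R) (@cont_phase xi a) (fun x => cos_max x).
have i2 := integrable_test tphi (@continuous_cos R) (@cont_phase xi (a - pi / 2)) (fun x => cos_max x).
have i3 := integrableZl measurableT (xi 0 i) i2.
have [C1 C10 hC1] := test_function_bound tp.
have [C2 C20 hC2] := test_function_bound tphi.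
have : \int[mu]_t 'D_e F (row t) = 0.
  apply: (@integral_derive_eq0 R d F e (C1 + `|xi 0 i| * C2 + C2) 1) => //.
  - move=> x; rewrite scale1r /F normrM; apply: (@le_trans _ _ (C2 * gauss x)).
      by rewrite (le_trans _ (hC2 x))// ler_piMr// cos_max.
    rewrite ler_wpM2r ?gauss_ge0// lerDr addr_ge0// mulr_ge0//.
  - move=> x; rewrite scale1r DF (le_trans (ler_normB _ _))//.
    apply: (@le_trans _ _ (C1 * gauss x + `|xi 0 i| * (C2 * gauss x))).
      apply: lerD.
        by rewrite normrM (le_trans _ (hC1 x))// ler_piMr// cos_max.
      by rewrite normrM ler_wpM2l// normrM (le_trans _ (hC2 x))// ler_piMr// cos_max.
    by rewrite mulrA -mulrDl ler_wpM2r ?gauss_ge0// lerDl.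
  - have -> : 'D_e F \o row = (fun t => partial i phi (row t) * cos (dot (row t) xi + a)
        - xi 0 i * (phi (row t) * cos (dot (row t) xi + (a - pi / 2)))).
      by apply/funext => t; rewrite /= DF.
    by apply/measurable_EFinP; exact: measurable_int (integrableB measurableT i1 i3).
under eq_Rintegral do rewrite DF.
rewrite RintegralB; [|exact: measurableT|exact: i1|exact: i3].
by rewrite RintegralZl// => /eqP; rewrite subr_eq0 => /eqP.
Qed.

Lemma cosine_transform_laplacian phi a i xi : test_function setT phi ->
  cosine_transform (fun x => -1 * partial i (partial i phi) x + phi x) a xi =
  (1 + xi 0 i ^+ 2) * cosine_transform phi a xi.
Proof.
move=> tphi; have tp := test_function_partial i tphi.
have tpp := test_function_partial i tp.
have i1 := integrable_test tpp (@continuous_cos R) (@cont_phase xi a) (fun x => cos_max x).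
have i2 := integrable_test tphi (@continuous_cos R) (@cont_phase xi a) (fun x => cos_max x).
rewrite {1}/cosine_transform; under eq_Rintegral do rewrite mulrDl -mulrA.
rewrite RintegralD//; last exact: (integrableZl measurableT (-1) i1).
rewrite RintegralZl// -/(cosine_transform _ a xi) -/(cosine_transform _ a xi).
rewrite !cosine_transform_partial//.
have -> : cosine_transform phi (a - pi / 2 - pi / 2) xi = - cosine_transform phi a xi.
  rewrite /cosine_transform -[RHS]mulN1r -RintegralZl//; apply: eq_Rintegral => t _.
  rewrite -addrA -opprD -splitr addrA cosB cospi sinpi mulr0 addr0; ring.
ring.
Qed.

(** Applying [1 - d_i^2] to the test function multiplies its transform by
    [1 + xi_i^2]. As the result is again the transform of a test function, hence
    bounded, the transform itself decays. *)
Lemma cosine_transform_decay phi : test_function setT phi ->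
  exists2 C, 0 <= C & forall a xi,
    `|cosine_transform phi a xi| <= C * \prod_(i < d) (1 + xi 0 i ^+ 2)^-1.
Proof.
move=> tphi.
have p0 (x : R) : 0 < 1 + x ^+ 2 by rewrite ltr_pwDl// sqr_ge0.
suff H (s : seq 'I_d) : forall psi, test_function setT psi -> exists2 C, 0 <= C &
    forall (a : R) (xi : Rd), (\prod_(i <- s) (1 + xi 0 i ^+ 2)) * `|cosine_transform psi a xi| <= C.
  have [C C0 hC] := H (index_enum 'I_d) phi tphi; exists C => // a xi.
  by rewrite prodfV ler_pdivlMr ?prodr_gt0// mulrC; exact: hC.
elim: s => [|i s IH] psi tpsi.
  have [C C0 hC] := test_function_bound tpsi.
  have iG : mu.-integrable setT (fun t => (C * gauss (row t))%:E).
    exact: (integrableZl measurableT C (integrable_gauss R d)).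
  exists (C * gauss_mass R d); first by rewrite mulr_ge0// gauss_mass_ge0.
  move=> a xi; rewrite big_nil mul1r.
  have i1 := integrable_test tpsi (@continuous_cos R) (@cont_phase xi a) (fun x => cos_max x).
  apply: le_trans (le_normr_Rintegral measurableT i1) _.
  rewrite /gauss_mass -RintegralZl//; last exact: integrable_gauss.
  apply: le_Rintegral => //.
  - exact: (integrable_abse i1).
  - by move=> t _; rewrite normrM (le_trans _ (hC _))// ler_piMr// cos_max.
have tL : test_function setT (fun x => -1 * partial i (partial i psi) x + psi x).
  by apply: test_function_lin => //; do 2 apply: test_function_partial.
have [C C0 hC] := IH _ tL; exists C => // a xi.
have := hC a xi; rewrite cosine_transform_laplacian// normrM (ger0_norm (ltW (p0 _))).
by rewrite big_cons mulrCA mulrA.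
Qed.

End test_functions.

(** * Fubini, and the Gamma integral in logarithmic time *)

Section fubini_real.
Context d1 d2 (T1 : measurableType d1) (T2 : measurableType d2) (R : realType).
Variables (m1 : {sigma_finite_measure set T1 -> \bar R})
          (m2 : {sigma_finite_measure set T2 -> \bar R}).

Lemma integrable_tensor (f : T1 -> R) (g : T2 -> R) :
  m1.-integrable setT (EFin \o f) -> m2.-integrable setT (EFin \o g) ->
  (m1 \x m2)%E.-integrable setT (EFin \o (fun p => f p.1 * g p.2)).
Proof.
move=> fi gi.
have mf : measurable_fun setT f by apply/measurable_EFinP; exact: measurable_int fi.
have mg : measurable_fun setT g by apply/measurable_EFinP; exact: measurable_int gi.
have mF : measurable_fun setT (fun p : T1 * T2 => f p.1 * g p.2).
  by apply: measurable_funM; exact: measurableT_comp.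
apply/integrable12ltyP; first exact/measurable_EFinP.
under eq_integral => x _.
  under eq_integral do rewrite /= normrM EFinM.
  rewrite ge0_integralZl//; last first.
    by do 2 apply: measurableT_comp => //.
  over.
rewrite ge0_integralZr//; last 2 first.
- by do 2 apply: measurableT_comp => //.
- exact: integral_ge0.
have /integrableP[_ foo] := fi; have /integrableP[_ goo] := gi.
rewrite lte_mul_pinfty//.
- exact: integral_ge0.
- by rewrite ge0_fin_numE//; exact: integral_ge0.
Qed.

Lemma Rfubini (F : T1 * T2 -> R) : (m1 \x m2)%E.-integrable setT (EFin \o F) ->
  (forall x, m2.-integrable setT (fun y => (F (x, y))%:E)) ->
  (forall y, m1.-integrable setT (fun x => (F (x, y))%:E)) ->
  \int[m1]_x \int[m2]_y F (x, y) = \int[m2]_y \int[m1]_x F (x, y).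
Proof.
move=> iF i2 i1; rewrite /Rintegral.
under eq_integral do rewrite fineK ?integrable_fin_num//.
under [in RHS]eq_integral do rewrite fineK ?integrable_fin_num//.
by congr fine; exact: (Fubini iF).
Qed.

Lemma Rfubini_tensor (F : T1 * T2 -> R) (f : T1 -> R) (g : T2 -> R) :
  measurable_fun setT F ->
  m1.-integrable setT (EFin \o f) -> m2.-integrable setT (EFin \o g) ->
  (forall x y, `|F (x, y)| <= f x * g y) ->
  \int[m1]_x \int[m2]_y F (x, y) = \int[m2]_y \int[m1]_x F (x, y).
Proof.
move=> mF fi gi Ffg.
apply: Rfubini.
- apply: (le_integrable measurableT _ _ (integrable_tensor fi gi)).
    exact/measurable_EFinP.
  by move=> [x y] _ /=; rewrite lee_fin (le_trans (Ffg x y))// ler_norm.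
- move=> x; apply: (le_integrable measurableT _ _ (integrableZl measurableT (f x) gi)).
    exact/measurable_EFinP/(measurableT_comp mF (pair1_measurable x)).
  by move=> y _ /=; rewrite lee_fin (le_trans (Ffg x y))// ler_norm.
- move=> y; apply: (le_integrable measurableT _ _ (integrableZr measurableT (g y) fi)).
    exact/measurable_EFinP/(measurableT_comp mF (pair2_measurable y)).
  by move=> x _ /=; rewrite lee_fin (le_trans (Ffg x y))// ler_norm.
Qed.

End fubini_real.

Section heat_weight.
Context (R : realType).
Local Notation leb := (@lebesgue_measure R).

(** For [r <= 0] the factor [expR (a * r)] decays; for [r >= 0] the double
    exponential beats it. *)
Lemma heat_weight_le (a : R) : 0 < a -> exists k C : R, [/\ 0 < k, 0 <= C &
  forall r, expR (a * r - expR r) <= C * expR (- (k * `|r|))].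
Proof.
move=> a0; have [|C C0 hC] := @exp_bound R (a + 1); first by rewrite addr_ge0// ltW.
exists (Num.min a 1), (C + 1); split.
- by rewrite lt_min a0 ltr01.
- by rewrite addr_ge0// ltW.
move=> r; have [r0|r0] := leP 0 r.
  rewrite (ger0_norm r0).
  apply: (@le_trans _ _ (C * expR (- (Num.min a 1 * r)))); last first.
    by rewrite ler_wpM2r ?expR_ge0// lerDl.
  apply: (@le_trans _ _ (C * expR (- r))); last first.
    rewrite ler_wpM2l ?(ltW C0)// ler_expR lerN2 ler_piMl// ge_min lexx orbT//.
  rewrite expRN -ler_pdivrMr ?invr_gt0 ?expR_gt0// invrK -expRD.
  by apply: le_trans (hC r); rewrite ler_expR mulrDl mul1r addrAC.
rewrite (ltr0_norm r0) mulrN opprK (@le_trans _ _ (1 * expR (Num.min a 1 * r)))//; last first.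
  by rewrite ler_wpM2r ?expR_ge0// lerDr ltW.
rewrite mul1r ler_expR (@le_trans _ _ (a * r))//.
  by rewrite lerBlDr lerDl expR_ge0.
by rewrite ler_wnM2r// ?(ltW r0)// ge_min lexx.
Qed.

Lemma continuous_heat_weight (a : R) : continuous (fun r : R => expR (a * r - expR r)).
Proof.
move=> r; apply: (@continuous_comp _ _ _ (fun r : R => a * r - expR r) expR).
  apply: continuousB; last exact: continuous_expR.
  by apply: continuousM; [exact: cst_continuous|exact: cvg_id].
exact: continuous_expR.
Qed.

Lemma integrable_heat_weight (a : R) : 0 < a ->
  leb.-integrable setT (EFin \o (fun r : R => expR (a * r - expR r))).
Proof.
move=> a0; have [k [C [k0 C0 hC]]] := heat_weight_le a0.
have i := integrableZl measurableT C (integrable_exp_abs k0).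
apply: (le_integrable measurableT _ _ i).
  apply/measurable_EFinP; apply: continuous_measurable_fun.
  exact: continuous_heat_weight.
move=> r _ /=; rewrite lee_fin ger0_norm ?expR_ge0//.
exact: le_trans (hC r) (ler_norm _).
Qed.

(** Euler's Gamma integral at [a], after the substitution [t = e^r]: dilations of
    [t] become translations of [r]. *)
Definition heat_mass (a : R) : R := \int[leb]_r expR (a * r - expR r).

Lemma heat_mass_gt0 (a : R) : 0 < a -> 0 < heat_mass a.
Proof.
move=> a0; have i := integrable_heat_weight a0.
have mw := measurable_int _ i.
rewrite -lte_fin /heat_mass /Rintegral fineK; last exact: integrable_fin_num.
apply: (@lt_le_trans _ _ (\int[leb]_(r in `[0%R, 1%R]) (expR (- expR 1))%:E)%E).
  rewrite integral_cst//= lebesgue_measure_itv/= lte_fin ltr01 oppr0 adde0 mule1.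
  by rewrite lte_fin expR_gt0.
apply: (@le_trans _ _ (\int[leb]_(r in `[0%R, 1%R]) (expR (a * r - expR r))%:E)%E).
  apply: ge0_le_integral => //.
  - exact: measurable_funTS.
  - move=> r /=; rewrite in_itv/= => /andP[r0 r1].
    rewrite lee_fin ler_expR -[leLHS]add0r lerD// ?mulr_ge0 ?(ltW a0)//.
    by rewrite lerN2 ler_expR.
by apply: ge0_subset_integral => // r _; rewrite lee_fin expR_ge0.
Qed.

(** Translating [r] by [ln q] produces the power of [q]. With
    [q = 1 + |xi|^2] this writes the symbol of a Bessel potential as an average
    of Gaussians in [xi]. *)
Lemma heat_mass_scale (a q : R) : 0 < a -> 0 < q ->
  \int[leb]_r expR (a * r - expR r * q) = q `^ (- a) * heat_mass a.
Proof.
move=> a0 q0; have i := integrable_heat_weight a0.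
rewrite /heat_mass -RintegralZl//.
pose f r : \bar R := (q `^ (- a) * expR (a * r - expR r))%:E.
have E : (\int[leb]_r f (1 * r + ln q)%R = \int[leb]_r f r)%E.
  rewrite (@ge0_integral_affine R 1 (ln q) f ltr01) ?invr1 ?mul1e//.
  - exact: (measurable_int _ (integrableZl measurableT (q `^ (- a)) i)).
  - by move=> r; rewrite lee_fin mulr_ge0 ?powR_ge0 ?expR_ge0.
have P (r : R) : q `^ (- a) * expR (a * (1 * r + ln q) - expR (1 * r + ln q)) =
    expR (a * r - expR r * q).
  have E1 : q `^ (- a) = expR (- a * ln q) by rewrite /powR gt_eqF.
  have E2 : expR (1 * r + ln q) = expR r * q by rewrite mul1r expRD (lnK q0).
  rewrite E1 E2 mul1r -expRD; congr expR; ring.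
by rewrite /Rintegral; congr fine; rewrite -[RHS]E; apply: eq_integral => r _; rewrite /f P.
Qed.

End heat_weight.

(** * Bessel potentials as averages of heat kernels *)

Section bessel_heat.
Context (R : realType) (d : nat).
Local Notation Rd := 'rV[R]_d.
Local Notation T := (d.-tuple (measurableTypeR R)).
Local Notation mu := (@tuple_lebesgue R d).
Local Notation leb := (@lebesgue_measure R).
Local Notation row := (@row_of_tuple R d).
Local Notation gauss := (@gauss R d).
Local Notation A := (gauss_mass R d).

Lemma dotBr (x y z : Rd) : dot z (x - y) = dot z x - dot z y.
Proof. by rewrite dotDr -(scaleN1r y) dotZr mulN1r. Qed.

Lemma integral_onT (f : Rd -> R) : integral_on setT f = \int[mu]_t f (row t).
Proof. by rewrite /integral_on preimage_setT. Qed.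

Lemma fourier_gauss_scale (s : R) (z : Rd) : 0 < s ->
  \int[mu]_t (gauss (s *: row t) * cos (dot (row t) z)) =
  s ^- d * A * gauss ((2 * s)^-1 *: z).
Proof.
move=> s0; pose f (t : T) := gauss (row t) * cos (dot (row t) (s^-1 *: z)).
have fi : mu.-integrable setT (fun t => (f t)%:E).
  apply: (@integrable_le_gauss R d (fun x => gauss x * cos (dot x (s^-1 *: z))) 1 1) => //.
    apply: measurable_continuous; apply: continuousRdM; first exact: continuous_gauss.
    apply: (@continuousRd_comp R d (fun x => dot x (s^-1 *: z)) cos).
      exact: continuous_dot.
    exact: continuous_cos.
  move=> x; rewrite scale1r mul1r normrM ger0_norm ?gauss_ge0//.
  by rewrite ler_piMr ?gauss_ge0// cos_max.
have -> : \int[mu]_t (gauss (s *: row t) * cos (dot (row t) z)) =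
    \int[mu]_t f (tuple_affine s (tuple_of_row 0) t).
  apply: eq_Rintegral => t _; rewrite /f row_affine addr0 dotZl dotZr mulrA.
  by rewrite mulfV ?mul1r// gt_eqF.
rewrite /Rintegral (@integral_tuple_affine R d s _ (fun t => (f t)%:E) s0 fi).
rewrite fineM//; last exact: integrable_fin_num.
by rewrite [fine (integral _ _ _)](fourier_gauss (s^-1 *: z)) mulrA scalerA invfM.
Qed.

Lemma measurable_scale_row dP (P : measurableType dP) (s : P -> R) (g : P -> T) :
  measurable_fun setT s -> measurable_fun setT g ->
  exists2 h : P -> T, measurable_fun setT h & forall p, row (h p) = s p *: row (g p).
Proof.
move=> ms mg; exists (fun p => [tuple s p * tnth (g p) i | i < d]).
  apply/measurable_fun_tnthP => i; rewrite /comp.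
  under eq_fun do rewrite tnth_mktuple.
  apply: measurable_funM => //.
  exact: (measurableT_comp (@measurable_tnth _ _ d i) mg).
by move=> p; apply/rowP => i; rewrite !mxE tnth_mktuple.
Qed.

Lemma measurable_add_row dP (P : measurableType dP) (g1 g2 : P -> T) :
  measurable_fun setT g1 -> measurable_fun setT g2 ->
  exists2 h : P -> T, measurable_fun setT h & forall p, row (h p) = row (g1 p) + row (g2 p).
Proof.
move=> m1 m2; exists (fun p => [tuple tnth (g1 p) i + tnth (g2 p) i | i < d]).
  apply/measurable_fun_tnthP => i; rewrite /comp.
  under eq_fun do rewrite tnth_mktuple.
  apply: measurable_funD.
    exact: (measurableT_comp (@measurable_tnth _ _ d i) m1).
  exact: (measurableT_comp (@measurable_tnth _ _ d i) m2).
by move=> p; apply/rowP => i; rewrite !mxE tnth_mktuple.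
Qed.

Lemma measurable_dot_row dP (P : measurableType dP) (g1 g2 : P -> T) :
  measurable_fun setT g1 -> measurable_fun setT g2 ->
  measurable_fun setT (fun p => dot (row (g1 p)) (row (g2 p))).
Proof.
move=> m1 m2; rewrite /dot; apply: measurable_sum => i.
under eq_fun do rewrite !mxE.
apply: measurable_funM.
  exact: (measurableT_comp (@measurable_tnth _ _ d i) m1).
exact: (measurableT_comp (@measurable_tnth _ _ d i) m2).
Qed.

Lemma integrable_cauchy_row (C : R) : mu.-integrable setT
  (EFin \o (fun t => C * \prod_(i < d) (1 + row t 0 i ^+ 2)^-1)).
Proof.
have := integrableZl measurableT C (integrable_cauchy_prod R d).
apply: eq_integrable => // t _ /=; rewrite EFinM; congr (_ * _%:E)%E.
by apply: eq_bigr => i _; rewrite mxE.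
Qed.

Let row_tuple (x : Rd) : row (tuple_of_row x) = x.
Proof. by apply/rowP => i; rewrite mxE tnth_mktuple. Qed.

Variables (phi : Rd -> R) (tphi : test_function setT phi) (x : Rd).

Let trans (xi : Rd) := cosine_transform phi (- dot x xi) xi.

Let cphi : continuous phi. Proof. by apply: smooth_on_continuous; have [] := tphi. Qed.

Let measurable_phase : measurable_fun setT
  (fun p : T * T => phi (row p.2) * cos (dot (row p.2) (row p.1) - dot x (row p.1))).
Proof.
apply: measurable_funM; first exact: (measurableT_comp (measurable_continuous cphi)).
apply: (measurableT_comp (continuous_measurable_fun (@continuous_cos R))).
apply: measurable_funB; first exact: measurable_dot_row.
have -> : (fun p : T * T => dot x (row p.1)) =
    (fun p => dot (row ((cst (tuple_of_row x)) p)) (row p.1)).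
  by apply/funext => p; rewrite row_tuple.
exact: (measurable_dot_row (@measurable_cst _ _ _ _ setT (tuple_of_row x)) measurable_fst).
Qed.

(** Exchanging the integrals makes the Fourier transform fall on the Gaussian,
    where it is known. *)
Let gauss_phi_fubini (s : R) : 0 < s ->
  \int[mu]_t (gauss (s *: row t) * trans (row t)) =
  \int[mu]_t (phi (row t) * (s ^- d * A * gauss ((2 * s)^-1 *: (row t - x)))).
Proof.
move=> s0; have [C C0 hC] := test_function_bound tphi.
pose F (p : T * T) := gauss (s *: row p.1) *
  (phi (row p.2) * cos (dot (row p.2) (row p.1) - dot x (row p.1))).
have igs : mu.-integrable setT (EFin \o (fun t => gauss (s *: row t))).
  apply: (eq_integrable measurableT _ _ _ (integrable_gauss_affine (0 : Rd) s0)).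
  by move=> t _ /=; rewrite addr0.
have iph : mu.-integrable setT (EFin \o (fun t => C * gauss (row t))).
  exact: (integrableZl measurableT C (integrable_gauss R d)).
have cph t : phi (row t) = phi (row t) * cos 0 by rewrite cos0 mulr1.
have trE t : trans (row t) = \int[mu]_y (phi (row y) * cos (dot (row y) (row t) - dot x (row t))) by [].
transitivity (\int[mu]_t \int[mu]_y F (t, y)).
  apply: eq_Rintegral => t _; rewrite /F /= RintegralZl//.
  apply: (@integrable_test R d phi cos (fun y => dot y (row t) - dot x (row t))) => //.
  - exact: continuous_cos.
  - apply: continuousRdD; first exact: continuous_dot.
    by move=> ?; exact: cst_continuous.
  - by move=> ?; exact: cos_max.
rewrite (@Rfubini_tensor _ _ _ _ R mu mu F (fun t => gauss (s *: row t))
  (fun y => C * gauss (row y)))//; last 2 first.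
- apply: measurable_funM; last exact: measurable_phase.
  have mgs : measurable_fun setT (fun t => gauss (s *: row t)).
    by apply/measurable_EFinP; exact: measurable_int igs.
  exact: (measurableT_comp mgs measurable_fst).
- move=> t y; rewrite /F /= normrM (ger0_norm (gauss_ge0 _)) ler_wpM2l ?gauss_ge0//.
  by rewrite normrM (le_trans _ (hC _))// ler_piMr// cos_max.
apply: eq_Rintegral => y _; rewrite /F /=.
under eq_Rintegral => t _.
  rewrite mulrCA (_ : dot _ _ - _ = dot (row t) (row y - x)); last first.
    by rewrite dotBr (dotC x) (dotC (row y)).
  over.
rewrite RintegralZl//; first by rewrite fourier_gauss_scale.
apply: (le_integrable measurableT _ _ igs).
  apply/measurable_EFinP; apply: measurable_funM.
    by apply/measurable_EFinP; exact: measurable_int igs.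
  apply: (@measurable_continuous R d (fun u => cos (dot u (row y - x)))).
  apply: (@continuousRd_comp R d (fun u => dot u (row y - x)) cos).
    exact: continuous_dot.
  exact: continuous_cos.
move=> t _ /=; rewrite lee_fin normrM ger0_norm ?gauss_ge0// ler_piMr//.
  exact: gauss_ge0.
exact: cos_max.
Qed.

Let measurable_trans : measurable_fun setT (fun t => trans (row t)).
Proof.
have [C C0 hC] := test_function_bound tphi.
pose F (p : T * T) := gauss (row p.1) *
  (phi (row p.2) * cos (dot (row p.2) (row p.1) - dot x (row p.1))).
have ig := integrable_gauss R d.
have iph : mu.-integrable setT (EFin \o (fun t => C * gauss (row t))).
  exact: (integrableZl measurableT C ig).
have mg : measurable_fun setT (fun t => gauss (row t)).
  by apply: measurable_continuous; exact: continuous_gauss.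
have iF : (mu \x mu)%E.-integrable setT (EFin \o F).
  apply: (le_integrable measurableT _ _ (integrable_tensor ig iph)).
    apply/measurable_EFinP; apply: measurable_funM; last exact: measurable_phase.
    exact: (measurableT_comp mg).
  move=> [t y] _ /=; rewrite lee_fin; apply: le_trans (ler_norm _).
  rewrite /F /= normrM (ger0_norm (gauss_ge0 _)) ler_wpM2l ?gauss_ge0//.
  by rewrite normrM (le_trans _ (hC _))// ler_piMr// cos_max.
have mI := measurableT_comp (@fine_measurable R setT measurableT) (measurable_fubini_F iF).
have -> : (fun t => trans (row t)) =
    (fun t => expR (dot (row t) (row t)) * fine (fubini_F mu (EFin \o F) t)).
  apply/funext => t; rewrite /fubini_F /=.
  rewrite -[fine _]/(\int[mu]_y F (t, y)) /F /= RintegralZl//; last first.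
    apply: (@integrable_test R d phi cos (fun y => dot y (row t) - dot x (row t))) => //.
    - exact: continuous_cos.
    - apply: continuousRdD; first exact: continuous_dot.
      by move=> ?; exact: cst_continuous.
    - by move=> ?; exact: cos_max.
  by rewrite mulrA /gauss -expRD subrr expR0 mul1r.
apply: measurable_funM => //.
by apply: (measurableT_comp (@measurable_expR R)); exact: measurable_dot_row.
Qed.

(** [(1 + |xi|^2)^(-g/2)] is a superposition of Gaussians, so the Bessel
    potential is a superposition of heat kernels. *)
Lemma bessel_heat (g : R) : 0 < g -> bessel (- g) phi x =
  (2 * pi) ^- d * \int[leb]_r ((heat_mass (g / 2))^-1 * expR (g / 2 * r - expR r) *
    \int[mu]_t (phi (row t) * (expR (r / 2) ^- d * A *
      gauss ((2 * expR (r / 2))^-1 *: (row t - x))))).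
Proof.
move=> g0; have a0 : 0 < g / 2 by rewrite divr_gt0.
have M0 := heat_mass_gt0 a0; have [C C0 hC] := cosine_transform_decay tphi.
pose w (r : R) := (heat_mass (g / 2))^-1 * expR (g / 2 * r - expR r).
pose F (p : measurableTypeR R * T) :=
  w p.1 * (gauss (expR (p.1 / 2) *: row p.2) * trans (row p.2)).
have iw0 := integrable_heat_weight a0.
have iw : leb.-integrable setT (EFin \o w).
  exact: (integrableZl measurableT (heat_mass (g / 2))^-1 iw0).
have w0 r : 0 <= w r by rewrite mulr_ge0 ?expR_ge0// invr_ge0 ltW.
have qpos (xi : Rd) : 0 < 1 + enorm xi ^+ 2 by rewrite ltr_pwDl// sqr_ge0.
have E1 t : (1 + enorm (row t) ^+ 2) `^ (- g / 2) * trans (row t) =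
    \int[leb]_r F (r, t).
  have Ep : (1 + enorm (row t) ^+ 2) `^ (- (g / 2)) = (heat_mass (g / 2))^-1 *
      \int[leb]_r expR (g / 2 * r - expR r * (1 + enorm (row t) ^+ 2)).
    by rewrite heat_mass_scale// mulrCA mulVf ?mulr1// gt_eqF.
  have i : leb.-integrable setT (EFin \o (fun r : R => expR (g / 2 * r - expR r * (1 + enorm (row t) ^+ 2)))).
    apply: (le_integrable measurableT _ _ iw0).
      apply/measurable_EFinP; apply: (measurableT_comp (@measurable_expR R)).
      apply: measurable_funB; first exact: measurable_funM.
      by apply: measurable_funM => //; exact: measurable_expR.
    move=> r _ /=; rewrite lee_fin !ger0_norm ?expR_ge0// ler_expR lerD2l lerN2.
    by rewrite ler_peMr ?expR_ge0// lerDl sqr_ge0.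
  rewrite mulNr Ep /F /=; move: (trans (row t)) => tr.
  rewrite -RintegralZl// -RintegralZr//; last first.
    exact: (integrableZl measurableT _ i).
  apply: eq_Rintegral => r _; rewrite /w mulrA; congr (_ * _).
  rewrite -[RHS]mulrA; congr (_ * _); rewrite gaussZ -expRD; congr expR.
  have -> : expR (r / 2) ^+ 2 = expR r by rewrite expr2 -expRD -splitr.
  ring.
have mF : measurable_fun setT F.
  apply: measurable_funM.
    have mw : measurable_fun setT w by apply/measurable_EFinP; exact: measurable_int iw.
    exact: (measurableT_comp mw measurable_fst).
  apply: measurable_funM; last exact: (measurableT_comp measurable_trans).
  have ms : measurable_fun setT (fun p : measurableTypeR R * T => expR (p.1 / 2)).
    by apply: (measurableT_comp (@measurable_expR R)); exact: measurable_funM.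
  have [h mh hE] := measurable_scale_row ms measurable_snd.
  have -> : (fun p : measurableTypeR R * T => gauss (expR (p.1 / 2) *: row p.2)) =
    (fun p => gauss (row (h p))) by apply/funext => p; rewrite hE.
  exact: (measurable_row_comp (@continuous_gauss R d) mh).
have tE t : cos (dot x (row t)) * integral_on setT (fun y => phi y * cos (dot y (row t))) +
   sin (dot x (row t)) * integral_on setT (fun y => phi y * sin (dot y (row t))) = trans (row t).
  have ic f : continuous f -> (forall u, `|f u| <= 1) ->
      mu.-integrable setT (fun y => (phi (row y) * f (dot (row y) (row t)))%:E).
    move=> cf f1; apply: (@integrable_test R d phi f (fun y => dot y (row t))) => //.
    exact: continuous_dot.
  have i1 := ic cos (@continuous_cos R) (fun u => cos_max u).
  have i2 := ic sin (@continuous_sin R) (fun u => sin_max u).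
  rewrite !integral_onT -!RintegralZl// -RintegralD//.
  - by apply: eq_Rintegral => y _; rewrite cosB; ring.
  - exact: (integrableZl measurableT _ i1).
  - exact: (integrableZl measurableT _ i2).
have gle1 (u : Rd) : gauss u <= 1.
  by rewrite gauss_enorm -expR0 ler_expR oppr_le0 sqr_ge0.
have Fle r t : `|F (r, t)| <= w r * (C * \prod_(i < d) (1 + row t 0 i ^+ 2)^-1).
  rewrite /F /= normrM ger0_norm// ler_wpM2l//.
  rewrite normrM (ger0_norm (gauss_ge0 _)) (le_trans _ (hC (- dot x (row t)) (row t)))//.
  by rewrite ler_piMl.
rewrite /bessel integral_onT; congr (_ * _).
under eq_Rintegral do rewrite tE E1.
rewrite -(@Rfubini_tensor _ _ _ _ R leb mu F _ _ mF iw (integrable_cauchy_row C) Fle).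
apply: eq_Rintegral => r _; rewrite /F /= -gauss_phi_fubini ?expR_gt0//.
rewrite RintegralZl//.
apply: (le_integrable measurableT _ _ (integrable_cauchy_row C)).
  apply/measurable_EFinP; apply: measurable_funM; last exact: measurable_trans.
  have := integrable_gauss_affine (0 : Rd) (expR_gt0 (r / 2)).
  move=> /(measurable_int _) /measurable_EFinP.
  by under eq_fun do rewrite addr0.
move=> t _ /=; rewrite lee_fin (le_trans _ (ler_norm _))//.
rewrite normrM (ger0_norm (gauss_ge0 _)) (le_trans _ (hC (- dot x (row t)) (row t)))//.
by rewrite ler_piMl.
Qed.

End bessel_heat.

(** * Derivatives of the heat kernel *)

Section heat_kernel.
Context (R : realType) (d : nat).
Local Notation Rd := 'rV[R]_d.
Local Notation gauss := (@gauss R d).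
Implicit Types (x z : Rd) (s : seq 'I_d).

(** Formal polynomials: by recursion on this syntax, every derivative of the heat
    kernel is a polynomial times the heat kernel. *)
Inductive poly_expr : Type :=
| PolyConst of R
| PolyCoord of 'I_d
| PolyAdd of poly_expr & poly_expr
| PolyMul of poly_expr & poly_expr.

Fixpoint poly_eval (e : poly_expr) x : R :=
  match e with
  | PolyConst c => c
  | PolyCoord i => x 0 i
  | PolyAdd e1 e2 => poly_eval e1 x + poly_eval e2 x
  | PolyMul e1 e2 => poly_eval e1 x * poly_eval e2 x
  end.

Fixpoint poly_deriv (i : 'I_d) (e : poly_expr) : poly_expr :=
  match e with
  | PolyConst _ => PolyConst 0
  | PolyCoord j => PolyConst (i == j)%:R
  | PolyAdd e1 e2 => PolyAdd (poly_deriv i e1) (poly_deriv i e2)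
  | PolyMul e1 e2 => PolyAdd (PolyMul e1 (poly_deriv i e2)) (PolyMul e2 (poly_deriv i e1))
  end.

Lemma partial_coord i j x : partial i (fun x : Rd => x 0 j) x = (i == j)%:R.
Proof.
have -> : (fun x : Rd => x 0 j) = (fun x : Rd => dot x (delta_mx 0 j)).
  apply/funext => y; rewrite /dot (bigD1 j)//= big1 => [|k kj].
    by rewrite mxE !eqxx mulr1 addr0.
  by rewrite mxE (negbTE kj) andbF mulr0.
by rewrite (partial_dot _ x).2 mxE eqxx.
Qed.

Lemma poly_eval_differentiable e x : differentiable (poly_eval e) x.
Proof.
elim: e => [c|j|e1 h1 e2 h2|e1 h1 e2 h2] /=.
- exact: differentiable_cst.
- exact: differentiable_coord.
- exact: differentiableD.
- exact: differentiableM.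
Qed.

Lemma partial_poly_eval i e x : partial i (poly_eval e) x = poly_eval (poly_deriv i e) x.
Proof.
elim: e => [c|j|e1 h1 e2 h2|e1 h1 e2 h2] /=.
- by rewrite partial_cst.
- exact: partial_coord.
- by rewrite partialD ?h1 ?h2//; exact: poly_eval_differentiable.
- by rewrite partialM ?h1 ?h2//; exact: poly_eval_differentiable.
Qed.

Lemma poly_eval_bound e (eps : R) : 0 < eps -> exists2 C, 0 <= C &
  forall x, `|poly_eval e x| <= C * expR (eps * enorm x ^+ 2).
Proof.
elim: e eps => [c|j|e1 h1 e2 h2|e1 h1 e2 h2] eps eps0 /=.
- exists `|c|; first exact: normr_ge0.
  move=> x; rewrite ler_peMr// -expR0 ler_expR mulr_ge0 ?sqr_ge0//; exact: ltW.
- have ei0 : 0 <= eps^-1 by rewrite invr_ge0; exact: ltW.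
  exists (1 + eps^-1); first exact: addr_ge0.
  move=> x; have h := expR_ge1Dx (eps * enorm x ^+ 2).
  apply: (@le_trans _ _ ((1 + eps^-1) * (1 + eps * enorm x ^+ 2))); last first.
    by rewrite ler_wpM2l// addr_ge0.
  apply: le_trans (coord_le_enorm x j) _.
  have h2 : eps^-1 * (eps * enorm x ^+ 2) = enorm x ^+ 2 by rewrite mulKf// gt_eqF.
  have : 0 <= eps * enorm x ^+ 2 by rewrite mulr_ge0 ?sqr_ge0//; exact: ltW.
  have -> : (1 + eps^-1) * (1 + eps * enorm x ^+ 2) =
      1 + eps^-1 + eps * enorm x ^+ 2 + eps^-1 * (eps * enorm x ^+ 2) by ring.
  by rewrite h2; have := enorm_ge0 x; nra.
- have [C1 C10 H1] := h1 _ eps0; have [C2 C20 H2] := h2 _ eps0.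
  exists (C1 + C2); first exact: addr_ge0.
  by move=> x; rewrite mulrDl (le_trans (ler_normD _ _))// lerD.
- have e2' : 0 < eps / 2 by rewrite divr_gt0.
  have [C1 C10 H1] := h1 _ e2'; have [C2 C20 H2] := h2 _ e2'.
  exists (C1 * C2); first exact: mulr_ge0.
  move=> x; have -> : eps * enorm x ^+ 2 = eps / 2 * enorm x ^+ 2 + eps / 2 * enorm x ^+ 2.
    by field.
  by rewrite expRD mulrACA normrM ler_pM.
Qed.

(** The heat kernel at time 1, up to a constant factor. *)
Definition heat_kernel x : R := gauss (2^-1 *: x).

Definition heat_partial s : Rd -> R := partials s heat_kernel.

Lemma heat_partial_poly s : exists e, heat_partial s = fun x => poly_eval e x * heat_kernel x.
Proof.
have dK x : differentiable heat_kernel x.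
  by apply: differentiable_scale; exact: differentiable_gauss.
elim: s => [|i s [e he]].
  by exists (PolyConst 1); apply/funext => x /=; rewrite mul1r.
exists (PolyAdd (PolyMul (PolyMul (PolyConst (- 2^-1)) (PolyCoord i)) e) (poly_deriv i e)).
apply/funext => x /=; rewrite /heat_partial /= -/(heat_partial s) he.
rewrite partialM//; last exact: poly_eval_differentiable.
rewrite partial_poly_eval /heat_kernel partial_scale; last exact: differentiable_gauss.
by rewrite partial_gauss !mxE; field.
Qed.

Lemma heat_partial_differentiable s x : differentiable (heat_partial s) x.
Proof.
have [e ->] := heat_partial_poly s; apply: differentiableM.
  exact: poly_eval_differentiable.
by apply: differentiable_scale; exact: differentiable_gauss.
Qed.

Lemma heat_partial_continuous s : continuous (heat_partial s).
Proof.
by move=> x; apply: differentiable_continuous; exact: heat_partial_differentiable.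
Qed.

Lemma heat_partial_le_fourth s : exists2 C, 0 <= C &
  forall x, `|heat_partial s x| <= C * gauss (4^-1 *: x).
Proof.
have [e he] := heat_partial_poly s.
have [|C C0 hC] := @poly_eval_bound e 8^-1; first by [].
exists C => // x; rewrite he normrM (ger0_norm (gauss_ge0 _)).
apply: (@le_trans _ _ (C * expR (8^-1 * enorm x ^+ 2) * heat_kernel x)).
  by rewrite ler_wpM2r ?gauss_ge0.
rewrite -mulrA ler_wpM2l// /heat_kernel !gaussZ -expRD ler_expR.
have := sqr_ge0 (enorm x); lra.
Qed.

(** A Gaussian wide enough to absorb polynomial factors and translations of
    length at most 1 in the derivatives of [heat_kernel]. *)
Definition envelope x : R := gauss (8^-1 *: x).

Lemma envelope_ge0 x : 0 <= envelope x. Proof. exact: gauss_ge0. Qed.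

Lemma heat_partial_le s : exists2 C, 0 <= C &
  forall x, `|heat_partial s x| <= C * envelope x.
Proof.
have [C C0 hC] := heat_partial_le_fourth s; exists C => // x.
apply: le_trans (hC x) _; rewrite ler_wpM2l// /envelope !gaussZ ler_expR.
have := sqr_ge0 (enorm x); lra.
Qed.

(** A translation by at most [1] costs a constant factor and a wider Gaussian. *)
Lemma heat_partial_shift s : exists2 C, 0 <= C &
  forall x z, enorm z <= 1 -> `|heat_partial s (x + z)| <= C * envelope x.
Proof.
have [C C0 hC] := heat_partial_le_fourth s.
exists (C * expR 1); first by rewrite mulr_ge0// expR_ge0.
move=> x z z1; apply: le_trans (hC _) _; rewrite -mulrA ler_wpM2l//.
apply: le_trans (gauss_shift _ _ _) _.
rewrite /envelope (_ : 4^-1 / 2 = 8^-1); last by field.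
rewrite ler_wpM2r ?gauss_ge0// ler_expR.
have : enorm z ^+ 2 <= 1 by rewrite expr_le1// enorm_ge0.
have := sqr_ge0 (enorm z); lra.
Qed.

Lemma heat_partial_lipschitz_near s : exists2 C, 0 <= C &
  forall x z, enorm z <= 1 ->
    `|heat_partial s (x + z) - heat_partial s x| <= C * enorm z * envelope x.
Proof.
have /all_sig2[C C0 hC] : forall i, {C | 0 <= C &
    forall x z, enorm z <= 1 -> `|heat_partial (i :: s) (x + z)| <= C * envelope x}.
  by move=> i; apply: cid2; exact: heat_partial_shift.
exists (\sum_i C i); first exact: sumr_ge0.
move=> x z z1.
have [t /andP[t0 t1] ->] := @mvt_segment R d (heat_partial s) x z
  (fun t _ => heat_partial_differentiable s _).
apply: le_trans (ler_norm_sum _ _ _) _; rewrite 2!mulr_suml.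
apply: ler_sum => i _; rewrite normrM [C i * _]mulrC -mulrA.
apply: ler_pM; [exact: normr_ge0|exact: normr_ge0|exact: coord_le_enorm|].
by apply: hC; rewrite enormZ ger0_norm// (le_trans _ z1)// ler_piMl// enorm_ge0.
Qed.

(** First-order Taylor estimate near the base point, by two applications of
    the mean value theorem. *)
Lemma heat_partial_taylor_near s : exists2 C, 0 <= C & forall x z, enorm z <= 1 ->
    `|heat_partial s (x + z) - heat_partial s x - \sum_i z 0 i * heat_partial (i :: s) x|
    <= C * enorm z ^+ 2 * envelope x.
Proof.
have /all_sig2[C C0 hC] : forall i, {C | 0 <= C & forall x z, enorm z <= 1 ->
    `|heat_partial (i :: s) (x + z) - heat_partial (i :: s) x| <= C * enorm z * envelope x}.
  by move=> i; apply: cid2; exact: heat_partial_lipschitz_near.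
exists (\sum_i C i); first exact: sumr_ge0.
move=> x z z1.
have [t /andP[t0 t1] ->] := @mvt_segment R d (heat_partial s) x z
  (fun t _ => heat_partial_differentiable s _).
rewrite -sumrB; apply: le_trans (ler_norm_sum _ _ _) _; rewrite 2!mulr_suml.
have tz : enorm (t *: z) <= enorm z.
  by rewrite enormZ ger0_norm// ler_piMl// enorm_ge0.
apply: ler_sum => i _; rewrite -mulrBr normrM.
apply: (@le_trans _ _ (enorm z * (C i * enorm z * envelope x))); last first.
  by rewrite expr2 !mulrA [enorm z * C i]mulrC.
apply: ler_pM; [exact: normr_ge0|exact: normr_ge0|exact: coord_le_enorm|].
apply: le_trans (hC _ _ _ (le_trans tz z1)) _.
by rewrite ler_wpM2r ?envelope_ge0// ler_wpM2l.
Qed.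

(** For [enorm z > 1] only the size of the two values is used, whence the
    envelope at both points. *)
Lemma heat_partial_lipschitz s : exists2 C, 0 <= C & forall x z,
  `|heat_partial s (x + z) - heat_partial s x| <=
    C * Num.min 1 (enorm z) * (envelope x + envelope (x + z)).
Proof.
have [C1 C10 h1] := heat_partial_lipschitz_near s.
have [C2 C20 h2] := heat_partial_le s.
exists (C1 + C2); first exact: addr_ge0.
move=> x z; have ex := envelope_ge0 x; have exz := envelope_ge0 (x + z).
have [z1|z1] := leP (enorm z) 1.
  rewrite (le_trans (h1 x z z1))// ler_pM ?mulr_ge0 ?enorm_ge0//.
    by rewrite ler_wpM2r ?enorm_ge0// lerDl.
  by rewrite lerDl.
rewrite mulr1 (le_trans (ler_normB _ _))// mulrDl.
rewrite (le_trans (lerD (h2 _) (h2 _)))//.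
by rewrite -mulrDr [envelope (x + z) + _]addrC lerDr mulr_ge0// addr_ge0.
Qed.

(** Interpolates between the quadratic estimate for [enorm z <= 1] and the linear
    growth of the remainder for [enorm z > 1]; an exponent below 2 keeps the
    integrals over small widths of the kernel convergent later on. *)
Lemma heat_partial_taylor s (k : R) : 0 < k <= 1 -> exists2 C, 0 <= C & forall x z,
  `|heat_partial s (x + z) - heat_partial s x - \sum_i z 0 i * heat_partial (i :: s) x|
  <= C * enorm z `^ (1 + k) * (envelope x + envelope (x + z)).
Proof.
move=> /andP[k0 k1]; have [C1 C10 h1] := heat_partial_taylor_near s.
have [C2 C20 h2] := heat_partial_le s.
have /all_sig2[C C0 hC] : forall i, {C | 0 <= C &
    forall x, `|heat_partial (i :: s) x| <= C * envelope x}.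
  by move=> i; apply: cid2; exact: heat_partial_le.
have S0 : 0 <= \sum_i C i by exact: sumr_ge0.
exists (C1 + C2 + \sum_i C i); first by rewrite !addr_ge0.
move=> x z; have ex := envelope_ge0 x; have exz := envelope_ge0 (x + z).
have z0 := enorm_ge0 z.
have [z1|z1] := leP (enorm z) 1.
  rewrite (le_trans (h1 x z z1))// ler_pM ?mulr_ge0 ?sqr_ge0 ?powR_ge0//; last by rewrite lerDl.
  rewrite ler_pM ?sqr_ge0//; first by rewrite -addrA lerDl addr_ge0.
  have [->|zn0] := eqVneq (enorm z) 0.
    by rewrite expr0n/= powR_ge0.
  rewrite -powR_mulrn// ger_powR//; first by rewrite lt_def zn0 z0.
  by rewrite (_ : 2%:R = 1 + 1 :> R)// lerD2l.
have p1 : 1 <= enorm z `^ (1 + k).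
  by rewrite -[leLHS](powRr0 (enorm z)) ler_powR ?(ltW z1)// addr_ge0// ltW.
have pz : enorm z <= enorm z `^ (1 + k).
  by rewrite -[leLHS]powRr1// ler_powR ?(ltW z1)// lerDl ltW.
have E : 0 <= envelope x + envelope (x + z) by exact: addr_ge0.
have t1 : `|heat_partial s (x + z) - heat_partial s x| <= C2 * (envelope x + envelope (x + z)).
  by rewrite (le_trans (ler_normB _ _))// (le_trans (lerD (h2 _) (h2 _)))// -mulrDr addrC.
have t2 : `|\sum_i z 0 i * heat_partial (i :: s) x| <=
    enorm z * (\sum_i C i) * (envelope x + envelope (x + z)).
  apply: le_trans (ler_norm_sum _ _ _) _; rewrite mulr_sumr mulr_suml.
  apply: ler_sum => i _; rewrite normrM -mulrA.
  apply: ler_pM; [exact: normr_ge0|exact: normr_ge0|exact: coord_le_enorm|].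
  by apply: le_trans (hC i x) _; rewrite ler_wpM2l// lerDl.
apply: le_trans (ler_normB _ _) _; apply: le_trans (lerD t1 t2) _.
rewrite -mulrDl ler_wpM2r// -addrA mulrDl.
apply: (@le_trans _ _ ((C2 + \sum_i C i) * enorm z `^ (1 + k))); last first.
  by rewrite lerDr mulr_ge0// powR_ge0.
rewrite mulrDl lerD//; first by rewrite ler_peMr.
by rewrite mulrC ler_wpM2l.
Qed.

End heat_kernel.

(** * Convolution of Gaussians with functions in L_p *)

Section convolution_bound.
Context (R : realType) (d : nat).
Local Notation Rd := 'rV[R]_d.
Local Notation T := (d.-tuple (measurableTypeR R)).
Local Notation mu := (@tuple_lebesgue R d).
Local Notation leb := (@lebesgue_measure R).
Local Notation row := (@row_of_tuple R d).
Local Notation gauss := (@gauss R d).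
Local Notation A := (gauss_mass R d).

Lemma tuple_of_rowK (x : Rd) : row (tuple_of_row x) = x.
Proof. by apply/rowP => i; rewrite mxE tnth_mktuple. Qed.

Lemma measurable_kernel (F : Rd -> R) dP (P : measurableType dP) (s : P -> R)
  (g1 g2 : P -> T) : continuous F -> measurable_fun setT s ->
  measurable_fun setT g1 -> measurable_fun setT g2 ->
  measurable_fun setT (fun p => F ((expR (s p / 2))^-1 *: (row (g1 p) - row (g2 p)))).
Proof.
move=> cF ms m1 m2.
have [h mh hE] := measurable_scale_row (@measurable_cst _ _ P R setT (-1)) m2.
have [k mk kE] := measurable_add_row m1 mh.
have me : measurable_fun setT (fun p => (expR (s p / 2))^-1).
  have -> : (fun p => (expR (s p / 2))^-1) = (fun p => expR (- (s p / 2))).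
    by apply/funext => p; rewrite expRN.
  apply: (measurableT_comp (@measurable_expR R)); apply: measurable_funN.
  exact: measurable_funM.
have [l ml lE] := measurable_scale_row me mk.
have -> : (fun p => F ((expR (s p / 2))^-1 *: (row (g1 p) - row (g2 p)))) =
    (fun p => F (row (l p))).
  by apply/funext => p; rewrite lE kE hE scaleN1r.
exact: measurable_row_comp.
Qed.

Lemma continuous_envelope : continuous (@envelope R d).
Proof.
move=> x; apply: differentiable_continuous; apply: differentiable_scale.
exact: differentiable_gauss.
Qed.

Variables (p : R) (p_gt1 : 1 < p).
Let q := 1 - p^-1.

Let p0 : 0 < p. Proof. exact: lt_trans p_gt1. Qed.

Lemma conj_exponent_gt0 : 0 < q.
Proof. by rewrite subr_gt0 invf_lt1. Qed.

Lemma conj_exponent_le1 : q <= 1.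
Proof. by rewrite lerBlDr lerDl invr_ge0 ltW. Qed.

Lemma gauss_le1 (x : Rd) : gauss x <= 1.
Proof. by rewrite gauss_enorm -expR0 ler_expR oppr_le0 sqr_ge0. Qed.

(** Hoelder's inequality. As a Gaussian is at most 1, its conjugate power is at
    most the Gaussian itself, whose integral scales like [c ^- d]. *)
Lemma gauss_conv_bound (h : Rd -> R) (H c : R) (y : Rd) : 0 < c -> 0 <= H ->
  measurable_fun setT (h \o row) -> (Lp_norm p h <= H%:E)%E ->
  (\int[mu]_t (gauss (c *: (y - row t)) * `|h (row t)|)%:E <=
   (H * (c ^- d * A) `^ q)%:E)%E.
Proof.
move=> c0 H0 mh hH; have q0 := conj_exponent_gt0.
pose f (t : T) := gauss (c *: (y - row t)).
have fE t : f t = gauss (c *: row t + - (c *: y)).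
  by rewrite /f -gaussN -scalerN opprB scalerBr.
have if_ : mu.-integrable setT (fun t => (f t)%:E).
  apply: (eq_integrable measurableT _ _ _ (integrable_gauss_affine (- (c *: y)) c0)).
  by move=> t _; rewrite fE.
have mf : measurable_fun setT f by apply/measurable_EFinP; exact: measurable_int if_.
have := @hoelder _ _ _ mu (h \o row) f p q^-1 mh mf p0.
rewrite invr_gt0 invrK => /(_ q0).
have -> : p^-1 + q = 1 by rewrite /q addrC subrK.
move=> /(_ erefl) hoe.
have -> : (\int[mu]_t (gauss (c *: (y - row t)) * `|h (row t)|)%:E =
    Lnorm mu 1 (EFin \o ((h \o row) \* f)%R))%E.
  rewrite Lnorm1; apply: eq_integral => t _.
  by rewrite /= normrM (ger0_norm (gauss_ge0 _)) mulrC.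
apply: le_trans hoe _; rewrite EFinM.
apply: lee_pmul => //; try exact: Lnorm_ge0.
rewrite unlock /= invrK -poweR_EFin.
apply: gt0_ler_poweR.
- exact: ltW.
- by rewrite in_itv/= leey andbT; apply: integral_ge0 => t _; rewrite ?lee_fin ?powR_ge0.
- by rewrite in_itv/= leey andbT lee_fin mulr_ge0 ?gauss_mass_ge0// invr_ge0 exprn_ge0// ltW.
rewrite -(integral_gauss_affine (- (c *: y)) c0).
apply: ge0_le_integral => //.
- apply/measurable_EFinP; apply: (measurableT_comp (measurable_powR _)).
  exact: (measurableT_comp (@normr_measurable R setT) mf).
- by have := measurable_int _ (integrable_gauss_affine (- (c *: y)) c0).
move=> t _; rewrite -fE lee_fin ger0_norm ?gauss_ge0//.
rewrite -[leRHS]powRr1 ?gauss_ge0// ger_powR ?gauss_le1 ?expR_gt0//.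
by rewrite invf_ge1// conj_exponent_le1.
Qed.

Definition conv_const : R := (8 ^+ d * A) `^ q.

Lemma conv_const_ge0 : 0 <= conv_const. Proof. exact: powR_ge0. Qed.

(** The previous bound integrated over the widths [expR (r / 2)] of the kernel;
    the weight [m] records what is gained or lost at each width. *)
Lemma envelope_X_bound (h : Rd -> R) (H : R) (m : R -> R) (v : R) (y : Rd) :
  0 <= H -> measurable_fun setT (h \o row) -> (Lp_norm p h <= H%:E)%E ->
  measurable_fun setT m -> (forall r, 0 <= m r) ->
  (\int[leb]_r (m r * expR (r / 2 * (d%:R * q)))%:E <= v%:E)%E ->
  (\int[leb \x mu]_z (m z.1 * (envelope ((expR (z.1 / 2))^-1 *: (y - row z.2)) *
     `|h (row z.2)|))%:E <= (conv_const * H * v)%:E)%E.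
Proof.
move=> H0 mh hH mm m0 hv.
have ma : measurable_fun setT (fun t => `|h (row t)|).
  exact: (measurableT_comp (@normr_measurable R setT) mh).
have mk : measurable_fun setT (fun z : measurableTypeR R * T =>
    envelope ((expR (z.1 / 2))^-1 *: (y - row z.2))).
  have -> : (fun z : measurableTypeR R * T => envelope ((expR (z.1 / 2))^-1 *: (y - row z.2)))
    = (fun z => envelope ((expR (z.1 / 2))^-1 *: (row (cst (tuple_of_row y) z) - row z.2))).
    by apply/funext => z; rewrite tuple_of_rowK.
  apply: (@measurable_kernel _ _ _ fst (cst (tuple_of_row y)) snd) => //.
  exact: continuous_envelope.
rewrite fubini_tonelli1//; last 2 first.
- apply/measurable_EFinP; apply: measurable_funM.
    exact: (measurableT_comp mm measurable_fst).
  apply: measurable_funM => //; exact: (measurableT_comp ma measurable_snd).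
- by move=> z /=; rewrite lee_fin !mulr_ge0 ?envelope_ge0.
rewrite /fubini_F /=.
apply: (@le_trans _ _ (\int[leb]_r ((conv_const * H)%:E * (m r * expR (r / 2 * (d%:R * q)))%:E))%E).
  have mi (r : R) : measurable_fun setT (fun t : T => (envelope ((expR (r / 2))^-1 *: (y - row t)) * `|h (row t)|)%:E).
    apply/measurable_EFinP; apply: measurable_funM => //.
    exact: (measurableT_comp mk (pair1_measurable (r : measurableTypeR R))).
  have E r : (\int[mu]_t (m r * (envelope ((expR (r / 2))^-1 *: (y - row t)) * `|h (row t)|))%:E
      = (m r)%:E * \int[mu]_t (envelope ((expR (r / 2))^-1 *: (y - row t)) * `|h (row t)|)%:E)%E.
    rewrite -ge0_integralZl ?lee_fin//.
      by move=> t _; rewrite lee_fin mulr_ge0// envelope_ge0.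
  apply: ge0_le_integral => //.
  - by move=> r _; apply: integral_ge0 => t _; rewrite lee_fin !mulr_ge0// envelope_ge0.
  - apply: (@measurable_fun_fubini_tonelli_F _ _ _ _ _ mu
      (fun z : measurableTypeR R * T => (m z.1 * (envelope ((expR (z.1 / 2))^-1 *: (y - row z.2)) * `|h (row z.2)|))%:E)).
      apply/measurable_EFinP; apply: measurable_funM.
        exact: (measurableT_comp mm measurable_fst).
      apply: measurable_funM => //; exact: (measurableT_comp ma measurable_snd).
    by move=> z /=; rewrite lee_fin !mulr_ge0 ?envelope_ge0.
  - apply: measurable_funeM; apply/measurable_EFinP; apply: measurable_funM => //.
    apply: (measurableT_comp (@measurable_expR R)).
    by apply: measurable_funM => //; exact: measurable_funM.
  move=> r _; rewrite E -!EFinM mulrCA EFinM lee_wpmul2l ?lee_fin//.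
  under eq_integral do rewrite /envelope scalerA.
  have c0 : 0 < 8^-1 * (expR (r / 2))^-1 by rewrite mulr_gt0// invr_gt0 expR_gt0.
  apply: le_trans (gauss_conv_bound y c0 H0 mh hH) _.
  have -> : ((8^-1 * (expR (r / 2))^-1) ^- d * A) `^ q =
      conv_const * expR (r / 2 * (d%:R * q)).
    rewrite -exprVn invfM !invrK exprMn mulrAC powRM; first last.
    - by rewrite exprn_ge0 ?expR_ge0.
    - by rewrite mulr_ge0 ?exprn_ge0// gauss_mass_ge0.
    congr (_ * _); rewrite -expRM_natl /powR gt_eqF ?expR_gt0// expRK.
    by congr expR; ring.
  by rewrite lee_fin mulrCA mulrA.
rewrite ge0_integralZl//; last 3 first.
- apply/measurable_EFinP; apply: measurable_funM => //.
  apply: (measurableT_comp (@measurable_expR R)).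
  by apply: measurable_funM => //; exact: measurable_funM.
- by move=> r _; rewrite lee_fin mulr_ge0// expR_ge0.
- by rewrite lee_fin mulr_ge0// conv_const_ge0.
by rewrite [leRHS]EFinM lee_wpmul2l// lee_fin mulr_ge0// conv_const_ge0.
Qed.

End convolution_bound.

(** * Regularity of the potentials *)

Lemma le_of_eq (disp : Order.disp_t) (T : porderType disp) (x y : T) :
  x = y -> (x <= y)%O.
Proof. by move=> ->. Qed.

Lemma Rintegral_sum dT (T : measurableType dT) (R : realType)
    (m : {measure set T -> \bar R}) (I : Type) (s : seq I) (f : I -> T -> R) :
  (forall i, m.-integrable setT (EFin \o f i)) ->
  m.-integrable setT (EFin \o (fun x => \sum_(i <- s) f i x)) /\
  \int[m]_x (\sum_(i <- s) f i x) = \sum_(i <- s) \int[m]_x f i x.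
Proof.
move=> fi; elim: s => [|i s [IH1 IH2]].
  split.
    apply: (eq_integrable measurableT _ _ _ (integrable0 m setT)).
    by move=> x _ /=; rewrite big_nil.
  by under eq_Rintegral do rewrite big_nil; rewrite big_nil Rintegral_cst// mul0r.
split.
  apply: (eq_integrable measurableT _ _ _ (integrableD measurableT (fi i) IH1)).
  by move=> x _ /=; rewrite big_cons EFinD.
under eq_Rintegral do rewrite big_cons.
by rewrite RintegralD// IH2 big_cons.
Qed.

Section potential.
Context (R : realType) (d : nat).
Local Notation Rd := 'rV[R]_d.
Local Notation T := (d.-tuple (measurableTypeR R)).
Local Notation mu := (@tuple_lebesgue R d).
Local Notation leb := (@lebesgue_measure R).
Local Notation row := (@row_of_tuple R d).
Local Notation X := (measurableTypeR R * T)%type.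
Local Notation mX := (leb \x mu)%E.
Variables (p : R) (p_gt1 : 1 < p) (g : R).
Local Notation q := (1 - p^-1).

Let p0 : 0 < p. Proof. exact: lt_trans p_gt1. Qed.

(** The smoothness that is left after [k] derivatives. *)
Definition sobolev_exponent (k : nat) : R := g - k%:R - d%:R / p.
Local Notation e := sobolev_exponent.

(** The factor [expR (r / 2) ^- d] normalizes the kernel of width [expR (r / 2)],
    and every derivative contributes one more factor [expR (r / 2) ^-1]. *)
Definition potential_weight (k : nat) (r : R) : R :=
  expR (g / 2 * r - expR r) * expR (r / 2) ^- (d + k).
Local Notation a := potential_weight.

Lemma potential_weight_ge0 k r : 0 <= a k r.
Proof. by rewrite mulr_ge0 ?expR_ge0// invr_ge0 exprn_ge0 ?expR_ge0. Qed.

Lemma potential_weightS k r : a k.+1 r = a k r * (expR (r / 2))^-1.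
Proof. by rewrite /potential_weight addnS exprSr invfM mulrA. Qed.

Lemma potential_weightE k r : a k r =
  expR (g / 2 * r - expR r - (d + k)%:R * (r / 2)).
Proof. by rewrite /potential_weight -expRM_natl -expRN -expRD. Qed.

Lemma measurable_potential_weight k : measurable_fun setT (a k).
Proof.
have -> : a k = (fun r => expR (g / 2 * r - expR r - (d + k)%:R * (r / 2))).
  by apply/funext => r; exact: potential_weightE.
apply: (measurableT_comp (@measurable_expR R)).
apply: measurable_funB; last by apply: measurable_funM => //; exact: measurable_funM.
by apply: measurable_funB => //; exact: measurable_funM.
Qed.

(** The loss [expR (r / 2 * (d * q))] from Hoelder's inequality leaves the
    exponent [g - k - d / p] of the Sobolev embedding. *)
Lemma potential_weight_conv k r :
  a k r * expR (r / 2 * (d%:R * q)) = expR (e k / 2 * r - expR r).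
Proof.
rewrite potential_weightE -expRD; congr expR; rewrite /sobolev_exponent natrD.
by field; rewrite gt_eqF.
Qed.

(** The values, the increments and the Taylor remainders of the potentials are all
    estimated by this lemma; they differ in the factor [m] only. *)
Lemma potential_estimate (k : nat) (m : R -> R) (C H v : R) (h : Rd -> R) (y z : Rd)
    (F : X -> R) : 0 <= C -> 0 <= H ->
  measurable_fun setT (h \o row) -> (Lp_norm p h <= H%:E)%E ->
  measurable_fun setT m -> (forall r, 0 <= m r) -> measurable_fun setT F ->
  (forall w, `|F w| <= a k w.1 * m w.1 * (C *
     (envelope ((expR (w.1 / 2))^-1 *: (y - row w.2)) +
      envelope ((expR (w.1 / 2))^-1 *: (z - row w.2)))) * `|h (row w.2)|) ->
  (\int[leb]_r (m r * expR (e k / 2 * r - expR r))%:E <= v%:E)%E ->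
  mX.-integrable setT (EFin \o F) /\
  `|\int[mX]_w F w| <= 2 * C * conv_const d p * H * v.
Proof.
move=> C0 H0 mh hH mm m0 mF hF hv.
pose U (y : Rd) (w : X) : R := a k w.1 * m w.1 *
  (envelope ((expR (w.1 / 2))^-1 *: (y - row w.2)) * `|h (row w.2)|).
have U0 x w : 0 <= U x w.
  by rewrite !mulr_ge0 ?potential_weight_ge0 ?envelope_ge0.
have mam : measurable_fun setT (fun r => a k r * m r).
  by apply: measurable_funM => //; exact: measurable_potential_weight.
have mU x : measurable_fun setT (U x).
  apply: measurable_funM; first exact: (measurableT_comp mam measurable_fst).
  apply: measurable_funM; last first.
    exact: (measurableT_comp (measurableT_comp (@normr_measurable R setT) mh) measurable_snd).
  have -> : (fun w : X => envelope ((expR (w.1 / 2))^-1 *: (x - row w.2)))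
    = (fun w => envelope ((expR (w.1 / 2))^-1 *: (row (cst (tuple_of_row x) w) - row w.2))).
    by apply/funext => w; rewrite tuple_of_rowK.
  apply: (@measurable_kernel _ _ _ _ _ fst (cst (tuple_of_row x)) snd) => //.
  exact: continuous_envelope.
have UE x : (\int[mX]_w (U x w)%:E <= (conv_const d p * H * v)%:E)%E.
  apply: (@envelope_X_bound R d p p_gt1 h H (fun r => a k r * m r) v x) => //.
    by move=> r; rewrite mulr_ge0// potential_weight_ge0.
  apply: le_trans hv; apply: le_of_eq; apply: eq_integral => r _.
  by rewrite mulrAC potential_weight_conv mulrC.
pose W w : R := C * (U y w + U z w).
have W0 w : 0 <= W w by rewrite mulr_ge0// addr_ge0.
have mW : measurable_fun setT W by apply: measurable_funM => //; exact: measurable_funD.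
have FW w : `|F w| <= W w.
  by apply: le_trans (hF w) _; rewrite /W /U; apply: le_of_eq; ring.
have IW : (\int[mX]_w (W w)%:E <= (2 * C * conv_const d p * H * v)%:E)%E.
  under eq_integral do rewrite /W EFinM EFinD.
  rewrite ge0_integralZl//=; last 2 first.
  - by apply: emeasurable_funD; apply: measurableT_comp => //; exact: EFin_measurable.
  - by move=> w _; rewrite adde_ge0// lee_fin.
  rewrite ge0_integralD//=; last 4 first.
  - by move=> w _; rewrite lee_fin.
  - exact/measurable_EFinP.
  - by move=> w _; rewrite lee_fin.
  - exact/measurable_EFinP.
  apply: (@le_trans _ _ (C%:E * ((conv_const d p * H * v)%:E + (conv_const d p * H * v)%:E))%E).
    by rewrite lee_wpmul2l ?lee_fin// leeD.
  by rewrite -EFinD -EFinM lee_fin; apply: le_of_eq; ring.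
have iW : mX.-integrable setT (EFin \o W).
  apply/integrableP; split; first exact/measurable_EFinP.
  apply: le_lt_trans (ltry (2 * C * conv_const d p * H * v)).
  by apply: le_trans IW; apply: le_of_eq; apply: eq_integral => w _; rewrite /= ger0_norm.
have iF : mX.-integrable setT (EFin \o F).
  apply: (le_integrable measurableT _ _ iW); first exact/measurable_EFinP.
  by move=> w _ /=; rewrite lee_fin (le_trans (FW w))// ler_norm.
split=> //; apply: le_trans (le_normr_Rintegral measurableT iF) _.
apply: (@le_trans _ _ (\int[mX]_w W w)).
  apply: le_Rintegral => //; exact: integrable_abse iF.
by rewrite -lee_fin /Rintegral fineK// integrable_fin_num.
Qed.

(** The integrand is at most [z `^ delta] times a function that decays
    exponentially away from the critical width [expR (r / 2) = z]. Its integral does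
    not depend on [z], by translation. The double exponential is needed only to
    bound [expR ((e k - delta) / 2 * r)], so that [delta = e k] is allowed. *)
Lemma integral_min_weight (k : nat) (delta : R) : 0 < delta < 1 -> delta <= e k ->
  exists2 V, 0 <= V & forall z, 0 <= z ->
  (\int[leb]_r (Num.min 1 (z * (expR (r / 2))^-1) * expR (e k / 2 * r - expR r))%:E
    <= (V * z `^ delta)%:E)%E.
Proof.
move=> /andP[d0 d1] de.
have [|C C0 hC] := @exp_bound R ((e k - delta) / 2).
  by rewrite divr_ge0// subr_ge0.
(* Below the critical width the minimum is 1 and the rate of decay is
   [delta / 2]; above it the minimum is [z * expR (- (r / 2))] and the rate is
   [(1 - delta) / 2]. *)
pose c := Num.min delta (1 - delta) / 2.
have c0 : 0 < c by rewrite divr_gt0// lt_min d0 subr_gt0.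
have iE := integrable_exp_abs c0.
pose V := C * \int[leb]_r expR (- (c * `|r|)).
exists V; first by rewrite mulr_ge0 ?(ltW C0)//; apply: Rintegral_ge0 => r _; exact: expR_ge0.
move=> z; rewrite le_eqVlt => /predU1P[<-|z0].
  rewrite (_ : (fun _ => _) = cst 0%E); last first.
    by apply/funext => r; rewrite mul0r min_r ?mul0r// ler01.
  by rewrite integral0 lee_fin mulr_ge0 ?powR_ge0// mulr_ge0 ?(ltW C0)//;
    apply: Rintegral_ge0 => r _; exact: expR_ge0.
have zd : z `^ delta = expR (delta * ln z) by rewrite /powR gt_eqF.
have mS : measurable_fun setT (fun r : R => (expR (- (c * `|1 * r + - (2 * ln z)|)))%:E).
  apply/measurable_EFinP.
  apply: (measurableT_comp (@measurable_expR R)); apply: measurable_funN.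
  apply: measurable_funM => //; apply: (measurableT_comp (@normr_measurable R setT)).
  by apply: measurable_funD => //; exact: measurable_funM.
apply: (@le_trans _ _ (\int[leb]_r ((C * z `^ delta)%:E *
    (expR (- (c * `|1 * r + - (2 * ln z)|)))%:E))%E).
  apply: ge0_le_integral => //.
  - by move=> r _; rewrite lee_fin mulr_ge0 ?expR_ge0// le_min ler01 mulr_ge0 ?invr_ge0 ?expR_ge0// ltW.
  - apply/measurable_EFinP; apply: measurable_funM.
      apply: measurable_minr => //; apply: measurable_funM => //.
      have -> : (fun r : R => (expR (r / 2))^-1) = (fun r => expR (- (r / 2))).
        by apply/funext => r; rewrite expRN.
      apply: (measurableT_comp (@measurable_expR R)); apply: measurable_funN.
      exact: measurable_funM.
    apply: (measurableT_comp (@measurable_expR R)).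
    by apply: measurable_funB => //; exact: measurable_funM.
  - exact: measurable_funeM.
  - move=> r _; rewrite -EFinM lee_fin mul1r.
    have -> : expR (e k / 2 * r - expR r) = expR ((e k - delta) / 2 * r - expR r) * expR (delta / 2 * r).
      by rewrite -expRD; congr expR; field.
    rewrite mulrCA -[leRHS]mulrA; apply: ler_pM => //.
    + by rewrite mulr_ge0 ?expR_ge0// le_min ler01 mulr_ge0 ?invr_ge0 ?expR_ge0// ltW.
    rewrite zd -expRD; set u := r - 2 * ln z.
    have [u0|u0] := leP 0 u.
      rewrite (@le_trans _ _ (z * (expR (r / 2))^-1 * expR (delta / 2 * r)))//.
        by rewrite ler_wpM2r ?expR_ge0// ge_min lexx orbT.
      have -> : z * (expR (r / 2))^-1 = expR (ln z - r / 2) by rewrite expRD expRN lnK.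
      rewrite -expRD ler_expR ger0_norm//.
      have : c * u <= (1 - delta) / 2 * u.
        by rewrite ler_wpM2r// ler_pM2r// ge_min lexx orbT.
      rewrite /u; lra.
    rewrite (@le_trans _ _ (1 * expR (delta / 2 * r)))//.
      by rewrite ler_wpM2r ?expR_ge0// ge_min lexx.
    rewrite mul1r ler_expR ltr0_norm//.
    have : delta / 2 * u <= c * u.
      by rewrite ler_wnM2r ?(ltW u0)// ler_pM2r// ge_min lexx.
    rewrite /u; lra.
have mE : measurable_fun setT (fun r : measurableTypeR R => (expR (- (c * `|r|)))%:E) := measurable_int _ iE.
rewrite ge0_integralZl ?lee_fin ?mulr_ge0 ?powR_ge0 ?(ltW C0)//.
have := @ge0_integral_affine R 1 (- (2 * ln z)) (fun r => (expR (- (c * `|r|)))%:E) ltr01 mE.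
move=> ->; last by move=> r; rewrite lee_fin expR_ge0.
rewrite invr1 mul1e /V -(@fineK _ (\int[leb]_x _)); last exact: integrable_fin_num.
by rewrite -EFinM lee_fin /Rintegral mulrAC.
Qed.

Definition potential_kernel (h : Rd -> R) (s : seq 'I_d) (y : Rd) (w : X) : R :=
  a (size s) w.1 * heat_partial s ((expR (w.1 / 2))^-1 *: (y - row w.2)) * h (row w.2).

(** Up to a constant factor, the derivative of order [s] of
    [(1 - Delta)^(-g/2) h]. *)
Definition potential (h : Rd -> R) (s : seq 'I_d) (y : Rd) : R :=
  \int[mX]_w potential_kernel h s y w.

Lemma measurable_potential_kernel h s y : measurable_fun setT (h \o row) ->
  measurable_fun setT (potential_kernel h s y).
Proof.
move=> mh; apply: measurable_funM; last exact: (measurableT_comp mh measurable_snd).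
apply: measurable_funM.
  exact: (measurableT_comp (@measurable_potential_weight (size s)) measurable_fst).
have -> : (fun w : X => heat_partial s ((expR (w.1 / 2))^-1 *: (y - row w.2)))
    = (fun w => heat_partial s ((expR (w.1 / 2))^-1 *: (row (cst (tuple_of_row y) w) - row w.2))).
  by apply/funext => w; rewrite tuple_of_rowK.
apply: (@measurable_kernel _ _ _ _ _ fst (cst (tuple_of_row y)) snd) => //.
exact: heat_partial_continuous.
Qed.

Let heat_mass_le (b : R) : 0 < b ->
  (\int[leb]_r (expR (b * r - expR r))%:E <= (heat_mass b)%:E)%E.
Proof.
move=> b0; rewrite /heat_mass /Rintegral fineK// integrable_fin_num//.
exact: integrable_heat_weight.
Qed.

(** The condition on the exponent makes the integral converge at small widths, that
    is as [r] tends to minus infinity. *)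
Lemma potential_bound s : 0 < e (size s) -> exists2 C, 0 <= C &
  forall h H, 0 <= H -> measurable_fun setT (h \o row) -> (Lp_norm p h <= H%:E)%E ->
  forall y, mX.-integrable setT (EFin \o potential_kernel h s y) /\
    \int[mX]_w `|potential_kernel h s y w| <= C * H.
Proof.
move=> e0; have [C C0 hC] := heat_partial_le R s.
have e20 : 0 < e (size s) / 2 by rewrite divr_gt0.
exists (2 * C * conv_const d p * heat_mass (e (size s) / 2)).
  by rewrite !mulr_ge0 ?conv_const_ge0// ltW// heat_mass_gt0.
move=> h H H0 mh hH y.
have mk := measurable_potential_kernel s y mh.
have kw w : `|potential_kernel h s y w| <= a (size s) w.1 * cst 1 w.1 * (C *
     (envelope ((expR (w.1 / 2))^-1 *: (y - row w.2)) +
      envelope ((expR (w.1 / 2))^-1 *: (y - row w.2)))) * `|h (row w.2)|.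
  rewrite /potential_kernel 2!normrM ler_wpM2r// mulr1.
  rewrite ger0_norm ?potential_weight_ge0// ler_wpM2l ?potential_weight_ge0//.
  by rewrite (le_trans (hC _))// ler_wpM2l// lerDl envelope_ge0.
have hm : (\int[leb]_r (cst 1 r * expR (e (size s) / 2 * r - expR r))%:E <=
    (heat_mass (e (size s) / 2))%:E)%E.
  by under eq_integral do rewrite mul1r; exact: heat_mass_le.
have m1 : measurable_fun setT (cst 1 : R -> R) by [].
have [i _] := @potential_estimate (size s) (cst 1) C H _ h y y _ C0 H0 mh hH m1
  (fun=> ler01) mk kw hm.
have kw' w := le_trans (le_of_eq (normr_id (potential_kernel h s y w))) (kw w).
have [_ b] := @potential_estimate (size s) (cst 1) C H _ h y y _ C0 H0 mh hH m1
  (fun=> ler01) (measurableT_comp (@normr_measurable R setT) mk) kw' hm.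
split=> //; apply: le_trans (ler_norm _) _; apply: le_trans b _.
by apply: le_of_eq; ring.
Qed.

Lemma potential_sup h s y C : mX.-integrable setT (EFin \o potential_kernel h s y) ->
  \int[mX]_w `|potential_kernel h s y w| <= C -> `|potential h s y| <= C.
Proof. by move=> i; apply: le_trans; exact: le_normr_Rintegral. Qed.

Lemma potential_holder s (delta : R) : 0 < delta < 1 -> delta <= e (size s) ->
  exists2 C, 0 <= C &
  forall h H, 0 <= H -> measurable_fun setT (h \o row) -> (Lp_norm p h <= H%:E)%E ->
  forall y z, `|potential h s (y + z) - potential h s y| <= C * H * enorm z `^ delta.
Proof.
move=> d01 de; have [C C0 hC] := heat_partial_lipschitz R s.
have e0 : 0 < e (size s) by apply: lt_le_trans de; case/andP: d01.
have [V V0 hV] := integral_min_weight d01 de.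
have [C1 C10 h1] := potential_bound e0.
exists (2 * C * conv_const d p * V); first by rewrite !mulr_ge0 ?conv_const_ge0.
move=> h H H0 mh hH y z.
have [iy _] := h1 h H H0 mh hH y; have [iyz _] := h1 h H H0 mh hH (y + z).
rewrite /potential -RintegralB//.
have [|||||_ b] := @potential_estimate (size s)
  (fun r => Num.min 1 (enorm z * (expR (r / 2))^-1)) C H (V * enorm z `^ delta) h y (y + z)
  (fun w => potential_kernel h s (y + z) w - potential_kernel h s y w) C0 H0 mh hH.
- apply: measurable_minr => //; apply: measurable_funM => //.
  have -> : (fun r : R => (expR (r / 2))^-1) = (fun r => expR (- (r / 2))).
    by apply/funext => r; rewrite expRN.
  apply: (measurableT_comp (@measurable_expR R)); apply: measurable_funN.
  exact: measurable_funM.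
- by move=> r; rewrite le_min ler01 mulr_ge0 ?enorm_ge0// invr_ge0 expR_ge0.
- by apply: measurable_funB; exact: measurable_potential_kernel.
- move=> w; rewrite /potential_kernel -mulrBl -mulrBr 2!normrM ler_wpM2r//.
  rewrite ger0_norm ?potential_weight_ge0// -[leRHS]mulrA ler_wpM2l ?potential_weight_ge0//.
  have -> : (expR (w.1 / 2))^-1 *: (y + z - row w.2) =
      (expR (w.1 / 2))^-1 *: (y - row w.2) + (expR (w.1 / 2))^-1 *: z.
    by rewrite -scalerDr addrAC.
  apply: le_trans (hC _ _) _; rewrite enormZ ger0_norm ?invr_ge0 ?expR_ge0//.
  by apply: le_of_eq; rewrite [_^-1 * enorm z]mulrC; ring.
- exact: (hV _ (enorm_ge0 z)).
by apply: le_trans b _; apply: le_of_eq; ring.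
Qed.

(** The integral of the Taylor remainder of the kernel. The remainder is used with
    the exponent [1 + delta / 2], which is below [e (size s)], whereas 2 might not
    be. *)
Lemma potential_differentiable s (delta : R) : 0 < delta < 1 -> delta <= e (size s).+1 ->
  forall h H, 0 <= H -> measurable_fun setT (h \o row) -> (Lp_norm p h <= H%:E)%E ->
  forall y, differentiable (potential h s) y /\
    forall i, partial i (potential h s) y = potential h (i :: s) y.
Proof.
move=> /andP[d0 d1] de h H H0 mh hH y; pose k := delta / 2.
have k0 : 0 < k by rewrite divr_gt0.
have k1 : k <= 1 by rewrite /k; lra.
have eS : e (size s) = e (size s).+1 + 1 by rewrite /sobolev_exponent -natr1; ring.
have e1 : 0 < e (size s).+1 by lra.
have e0 : 0 < e (size s) by lra.
have [|C C0 hC] := @heat_partial_taylor R d s k; first by rewrite k0.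
have [C1 C10 h1] := potential_bound e0.
have iy y' := (h1 h H H0 mh hH y').1.
have iS i : mX.-integrable setT (EFin \o potential_kernel h (i :: s) y).
  by have [C2 C20 h2] := @potential_bound (i :: s) e1; exact: (h2 h H H0 mh hH y).1.
pose b := (e (size s) - (1 + k)) / 2.
have b0 : 0 < b by rewrite divr_gt0// subr_gt0 eS /k; lra.
apply: (@differentiable_of_partial_bound R d _ y (fun i => potential h (i :: s) y)
  (2 * C * conv_const d p * H * heat_mass b) k k0) => z.
pose D (w : X) := potential_kernel h s (y + z) w - potential_kernel h s y w
   - \sum_i z 0 i * potential_kernel h (i :: s) y w.
have iB := integrableB measurableT (iy (y + z)) (iy y).
have iZ i : mX.-integrable setT (EFin \o (fun w => z 0 i * potential_kernel h (i :: s) y w)).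
  exact: (integrableZl measurableT (z 0 i) (iS i)).
have [iSum ESum] := Rintegral_sum (index_enum 'I_d) iZ.
have -> : potential h s (y + z) - potential h s y - \sum_i z 0 i * potential h (i :: s) y =
    \int[mX]_w D w.
  rewrite /D RintegralB//; congr (_ - _); first by rewrite RintegralB.
  by rewrite ESum; apply: eq_bigr => i _; rewrite RintegralZl.
have mD : measurable_fun setT D.
  apply: measurable_funB; last by apply/measurable_EFinP; exact: measurable_int iSum.
  by apply: measurable_funB; exact: measurable_potential_kernel.
have [|||||_ bd] := @potential_estimate (size s)
  (fun r => enorm z `^ (1 + k) * expR (- ((1 + k) * (r / 2)))) C H
  (enorm z `^ (1 + k) * heat_mass b) h y (y + z) D C0 H0 mh hH.
- apply: measurable_funM => //; apply: (measurableT_comp (@measurable_expR R)).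
  apply: measurable_funN; apply: measurable_funM => //; exact: measurable_funM.
- by move=> r; rewrite mulr_ge0 ?powR_ge0 ?expR_ge0.
- exact: mD.
- move=> w; set u := expR (w.1 / 2); have u0 : 0 < u by exact: expR_gt0.
  have DE : D w = a (size s) w.1 * (heat_partial s (u^-1 *: (y - row w.2) + u^-1 *: z) -
      heat_partial s (u^-1 *: (y - row w.2)) -
      \sum_i (u^-1 *: z) 0 i * heat_partial (i :: s) (u^-1 *: (y - row w.2))) * h (row w.2).
    rewrite /D /potential_kernel -/u.
    have -> : u^-1 *: (y + z - row w.2) = u^-1 *: (y - row w.2) + u^-1 *: z.
      by rewrite -scalerDr addrAC.
    rewrite !mulrBr !mulrBl; congr (_ - _).
    rewrite mulr_sumr mulr_suml; apply: eq_bigr => i _ /=.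
    by rewrite potential_weightS -/u mxE; ring.
  rewrite DE 2!normrM ler_wpM2r//.
  rewrite ger0_norm ?potential_weight_ge0// -[leRHS]mulrA ler_wpM2l ?potential_weight_ge0//.
  apply: le_trans (hC _ _) _; rewrite enormZ ger0_norm ?invr_ge0 ?(ltW u0)//.
  have -> : expR (- ((1 + k) * (w.1 / 2))) = u^-1 `^ (1 + k).
    by rewrite /u -expRN /powR gt_eqF ?expR_gt0// expRK mulrN.
  have -> : u^-1 *: (y + z - row w.2) = u^-1 *: (y - row w.2) + u^-1 *: z.
    by rewrite -scalerDr addrAC.
  rewrite powRM ?enorm_ge0 ?invr_ge0 ?(ltW u0)//.
  by apply: le_of_eq; ring.
- have E r : enorm z `^ (1 + k) * expR (- ((1 + k) * (r / 2))) *
      expR (e (size s) / 2 * r - expR r) = enorm z `^ (1 + k) * expR (b * r - expR r).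
    by rewrite -mulrA -expRD; congr (_ * expR _); rewrite /b; field.
  under eq_integral do rewrite E EFinM.
  have ib := integrable_heat_weight b0.
  have mb : measurable_fun setT (fun r : R => (expR (b * r - expR r))%:E).
    exact: (measurable_int _ ib).
  rewrite ge0_integralZl ?lee_fin ?powR_ge0//.
  by rewrite EFinM lee_wpmul2l ?lee_fin ?powR_ge0// heat_mass_le.
by apply: le_trans bd _; apply: le_of_eq; ring.
Qed.

End potential.

(** * The potential as a distribution *)

Lemma Rintegral_swap d1 d2 (T1 : measurableType d1) (T2 : measurableType d2)
    (R : realType) (m1 : {sigma_finite_measure set T1 -> \bar R})
    (m2 : {sigma_finite_measure set T2 -> \bar R}) (F : T1 * T2 -> R) :
  (m1 \x m2)%E.-integrable setT (EFin \o F) ->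
  (forall y, m1.-integrable setT (fun x => (F (x, y))%:E)) ->
  \int[(m1 \x m2)%E]_z F z = \int[m2]_y \int[m1]_x F (x, y).
Proof.
move=> iF i1; rewrite /Rintegral.
under [in RHS]eq_integral do rewrite fineK ?integrable_fin_num//.
by congr fine; rewrite -(integral21_prod_meas1 iF).
Qed.

Section sigma_finite_product.
Context d1 d2 (T1 : measurableType d1) (T2 : measurableType d2) (R : realType).
Variables (m1 : {sigma_finite_measure set T1 -> \bar R})
  (m2 : {sigma_finite_measure set T2 -> \bar R}).

(** The integral over the pairs of a width and a point is exchanged as a whole with
    an integral over space, for which the product has to be sigma-finite. *)
Definition sigma_finite_product : set (T1 * T2) -> \bar R := (m1 \x m2)%E.

HB.instance Definition _ := Measure.on sigma_finite_product.

Let sigma_finite_productT : sigma_finite setT sigma_finite_product.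
Proof.
have /sigma_finiteP[F [TF ndF Foo]] := sigma_finiteT m1.
have /sigma_finiteP[G [TG ndG Goo]] := sigma_finiteT m2.
exists (fun k => F k `*` G k).
  rewrite predeqE => -[x y]; split=> // _.
  have [k _ Fk] : (\bigcup_i F i) x by rewrite -TF.
  have [j _ Gj] : (\bigcup_i G i) y by rewrite -TG.
  exists (maxn k j) => //; split.
    by move: x Fk; exact/subsetPset/ndF/leq_maxl.
  by move: y Gj; exact/subsetPset/ndG/leq_maxr.
move=> k; have [mF Fk] := Foo k; have [mG Gk] := Goo k.
split; first exact: measurableX.
by rewrite /sigma_finite_product product_measure1E// lte_mul_pinfty// ge0_fin_numE.
Qed.

HB.instance Definition _ := Measure_isSigmaFinite.Build _ _ _
  sigma_finite_product sigma_finite_productT.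
End sigma_finite_product.

Section representation.
Context (R : realType) (d : nat).
Local Notation Rd := 'rV[R]_d.
Local Notation T := (d.-tuple (measurableTypeR R)).
Local Notation mu := (@tuple_lebesgue R d).
Local Notation leb := (@lebesgue_measure R).
Local Notation row := (@row_of_tuple R d).
Local Notation A := (gauss_mass R d).
Local Notation X := (measurableTypeR R * T)%type.
Local Notation mX := (sigma_finite_product leb mu).
Variables (p : R) (p_gt1 : 1 < p) (g : R) (e0 : 0 < sobolev_exponent d p g 0).

Definition bessel_const : R := (2 * pi) ^- d * (heat_mass (g / 2))^-1 * A.
Local Notation c0 := bessel_const.

Lemma bessel_order_gt0 : 0 < g.
Proof.
apply: lt_le_trans e0 _; rewrite /sobolev_exponent subr0 lerBlDr lerDl.
by rewrite divr_ge0// ltW// (lt_trans _ p_gt1).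
Qed.

Let g0 := bessel_order_gt0.

(** Moves the Bessel potential from the test function to [h]: the heat kernel is
    symmetric in its two points, and Fubini applies thanks to the absolute bound
    [potential_bound] for the triple integral. *)
Lemma bessel_representation (h : Rd -> R) (H : R) (phi : Rd -> R) : 0 <= H ->
  measurable_fun setT (h \o row) -> (Lp_norm p h <= H%:E)%E ->
  test_function setT phi ->
  integral_on setT (fun x => h x * bessel (- g) phi x) =
  integral_on setT (fun y => c0 * potential g h [::] y * phi y).
Proof.
move=> H0 mh hH tphi.
have [C1 C10 h1] := @potential_bound R d p p_gt1 g [::] e0.
have ik y : mX.-integrable setT (EFin \o potential_kernel g h [::] y) := (h1 h H H0 mh hH y).1.
have g20 : 0 < g / 2 by rewrite divr_gt0.
have cphi : continuous phi by apply: smooth_on_continuous; have [] := tphi.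
have mphi : measurable_fun setT (phi \o row) := measurable_continuous cphi.
have [C C0 hC] := test_function_bound tphi.
pose F (z : X * T) : R := c0 * (phi (row z.2) * potential_kernel g h [::] (row z.2) z.1).
have mF : measurable_fun setT F.
  apply: measurable_funM => //; apply: measurable_funM.
    exact: (measurableT_comp mphi measurable_snd).
  apply: measurable_funM; last first.
    exact: (measurableT_comp mh (measurableT_comp measurable_snd measurable_fst)).
  apply: measurable_funM.
    apply: (measurableT_comp (@measurable_potential_weight R d g 0)).
    exact: (measurableT_comp measurable_fst measurable_fst).
  apply: (@measurable_kernel _ _ _ _ _ (fun z : X * T => z.1.1) snd (fun z : X * T => z.1.2)).
  - exact: heat_partial_continuous.
  - exact: (measurableT_comp measurable_fst measurable_fst).
  - exact: measurable_snd.
  - exact: (measurableT_comp measurable_snd measurable_fst).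
have iFy y : mX.-integrable setT (fun w => (F (w, y))%:E).
  have := integrableZl measurableT (c0 * phi (row y)) (ik (row y)).
  by apply: eq_integrable => // w _; rewrite /F /= -EFinM mulrA.
have iphi : mu.-integrable setT (fun y => (C * gauss (row y))%:E).
  exact: (integrableZl measurableT C (integrable_gauss R d)).
have [CK CK0 hCK] := @heat_partial_le R d [::].
have env1 (x : Rd) : envelope x <= 1 by exact: gauss_le1.
have iF : (mX \x mu)%E.-integrable setT (EFin \o F).
  have mEF : measurable_fun setT (EFin \o F) by apply/measurable_EFinP.
  have [_ iff] := @integrable21ltyP _ _ _ _ R mX mu (EFin \o F) mEF.
  apply: iff.
  pose D := `|c0| * (C1 * H).
  apply: (@le_lt_trans _ _ (\int[mu]_y (D%:E * (C * gauss (row y))%:E))%E); last first.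
    have := integrable_fin_num measurableT (integrableZl measurableT D iphi).
    by rewrite fin_numE => /andP[_]; rewrite -ltey.
  apply: ge0_le_integral => //.
  - by move=> y _; exact: integral_ge0.
  - apply: (@measurable_fun_fubini_tonelli_G _ _ _ _ _ mX (fun z => `|(F z)%:E|%E)) => //.
    exact: (measurableT_comp (@abse_measurable R setT) mEF).
  - apply: measurable_funeM; exact: (measurable_int _ iphi).
  - move=> y _; have [i1 b1] := h1 h H H0 mh hH (row y).
    have ia : mX.-integrable setT (fun w => (`|potential_kernel g h [::] (row y) w|)%:E).
      exact: integrable_abse i1.
    apply: (@le_trans _ _ (\int[mX]_w ((`|c0| * `|phi (row y)|)%:E * (`|potential_kernel g h [::] (row y) w|)%:E))%E).
      by apply: le_of_eq; apply: eq_integral => w _; rewrite -EFinM; congr (_%:E); rewrite /F/= (normrM c0) (normrM (phi _)) mulrA.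
    apply: (@le_trans _ _ ((`|c0| * `|phi (row y)|)%:E * \int[mX]_w (`|potential_kernel g h [::] (row y) w|)%:E)%E).
      apply: le_of_eq; exact: (integralZl measurableT ia (`|c0| * `|phi (row y)|)).
    have -> : (\int[mX]_w (`|potential_kernel g h [::] (row y) w|)%:E)%E =
       (\int[mX]_w `|potential_kernel g h [::] (row y) w|)%:E.
      by rewrite /Rintegral fineK//; exact: integrable_fin_num.
    rewrite -!EFinM lee_fin /D.
    apply: (@le_trans _ _ (`|c0| * `|phi (row y)| * (C1 * H))).
      by rewrite ler_wpM2l// mulr_ge0.
    by rewrite mulrAC ler_wpM2l// !mulr_ge0.
have iFw w : mu.-integrable setT (fun y => (F (w, y))%:E).
  pose D := `|c0| * (potential_weight d g 0 w.1 * CK * `|h (row w.2)|).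
  apply: (le_integrable measurableT _ _ (integrableZl measurableT D iphi)).
    by apply/measurable_EFinP; exact: (measurableT_comp mF (pair1_measurable w)).
  move=> y _ /=; rewrite lee_fin (le_trans _ (ler_norm _))// /F /D (normrM c0) -[leRHS]mulrA ler_wpM2l//.
  rewrite (normrM (phi _)) mulrC /=; apply: ler_pM => //.
  rewrite /potential_kernel 2!normrM ler_wpM2r// ger0_norm ?potential_weight_ge0//.
  rewrite ler_wpM2l ?potential_weight_ge0//.
  by rewrite (le_trans (hCK _))// ler_piMr.
pose Q (w : X) : R := \int[mu]_y F (w, y).
have iQ : mX.-integrable setT (EFin \o Q).
  apply: (eq_integrable measurableT _ _ _ (integrable_fubini_F iF)) => w _.
  by rewrite /fubini_F /Q /Rintegral /= fineK//; exact: integrable_fin_num.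
have mQ : measurable_fun setT Q by apply/measurable_EFinP; exact: measurable_int iQ.
pose I (x : Rd) (r : R) := \int[mu]_y (phi (row y) * gauss ((2 * expR (r / 2))^-1 *: (row y - x))).
have igx x (c : R) : 0 < c -> mu.-integrable setT (fun y => (gauss (c *: (row y - x)))%:E).
  move=> cpos; apply: (eq_integrable measurableT _ _ _ (integrable_gauss_affine (- (c *: x)) cpos)).
  by move=> t _; rewrite scalerBr.
have ipg x (r : R) : mu.-integrable setT
    (fun y => (phi (row y) * gauss ((2 * expR (r / 2))^-1 *: (row y - x)))%:E).
  apply: (le_integrable measurableT _ _ iphi).
    apply/measurable_EFinP; apply: measurable_funM => //.
    have cpos : 0 < (2 * expR (r / 2))^-1 by rewrite invr_gt0 mulr_gt0// expR_gt0.
    by apply/measurable_EFinP; exact: measurable_int (igx x _ cpos).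
  move=> y _ /=; rewrite lee_fin normrM (ger0_norm (gauss_ge0 _)) (le_trans _ (ler_norm _))//.
  by rewrite (le_trans _ (hC _))// ler_piMr// gauss_le1.
have KE (r : R) (z : Rd) : heat_partial [::] ((expR (r / 2))^-1 *: z) =
    gauss ((2 * expR (r / 2))^-1 *: z).
  by rewrite /heat_partial /= /heat_kernel scalerA invfM.
have QE r x : Q (r, x) = c0 * potential_weight d g 0 r * h (row x) * I (row x) r.
  rewrite -(RintegralZl _ measurableT (ipg (row x) r)); apply: eq_Rintegral => y _.
  rewrite /F /potential_kernel [(r, x).1]/= [(r, x).2]/= KE [size _]/=; set G := gauss _; set P := potential_weight _ _ _ _; move: c0 => c1; ring.
have Qle r x : `|Q (r, x)| <= `|c0 * h (row x)| * (C * (2 ^+ d * A)) * expR (g / 2 * r - expR r).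
  rewrite QE; have cpos : 0 < (2 * expR (r / 2))^-1 by rewrite invr_gt0 mulr_gt0// expR_gt0.
  have Ile : `|I (row x) r| <= C * (2 ^+ d * expR (r / 2) ^+ d * A).
    apply: le_trans (le_normr_Rintegral measurableT (ipg _ _)) _.
    have -> : C * (2 ^+ d * expR (r / 2) ^+ d * A) =
        \int[mu]_y (C * gauss ((2 * expR (r / 2))^-1 *: (row y - row x))).
      rewrite RintegralZl//; last exact: igx.
      congr (_ * _); rewrite /Rintegral.
      under eq_integral do rewrite scalerBr.
      by rewrite (integral_gauss_affine _ cpos)/= -exprVn invrK exprMn.
    apply: le_Rintegral => //.
    - exact: (integrable_abse (ipg _ _)).
    - exact: (integrableZl measurableT C (igx _ _ cpos)).
    - move=> y _; rewrite normrM (ger0_norm (gauss_ge0 _)) ler_wpM2r ?gauss_ge0//.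
      by rewrite (le_trans (hC _))// ler_piMr// gauss_le1.
  have regroup (c a b e : R) : c * a * b * e = (c * b) * (a * e) by ring.
  rewrite regroup (normrM (c0 * _)) -[leRHS]mulrA ler_wpM2l// normrM.
  rewrite (ger0_norm (potential_weight_ge0 _ _ _ _)) /potential_weight addn0.
  apply: (@le_trans _ _ (expR (g / 2 * r - expR r) * expR (r / 2) ^- d *
      (C * (2 ^+ d * expR (r / 2) ^+ d * A)))).
    rewrite ler_wpM2l// mulr_ge0 ?expR_ge0// invr_ge0 exprn_ge0 ?expR_ge0.
  apply: le_of_eq; field; rewrite expf_neq0//.
  by rewrite gt_eqF ?expR_gt0.
have iw := integrable_heat_weight g20.
have iQr x : leb.-integrable setT (fun r => (Q (r, x))%:E).
  apply: (le_integrable measurableT _ _ (integrableZl measurableT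
      (`|c0 * h (row x)| * (C * (2 ^+ d * A))) iw)).
    by apply/measurable_EFinP; exact: (measurableT_comp mQ (pair2_measurable x)).
  by move=> r _ /=; rewrite lee_fin (le_trans (Qle r x))// ler_norm.
transitivity (\int[mX]_w Q w); last first.
  rewrite /Q (Rfubini iF iFw iFy) integral_onT; apply: eq_Rintegral => y _.
  transitivity (c0 * phi (row y) * potential g h [::] (row y)); last by rewrite mulrAC.
  rewrite -(RintegralZl _ measurableT (ik (row y))); apply: eq_Rintegral => w _.
  by rewrite /F mulrA.
rewrite (Rintegral_swap iQ iQr) integral_onT; apply: eq_Rintegral => x _.
rewrite (bessel_heat tphi (row x) g0).
pose G (r : R) := (heat_mass (g / 2))^-1 * expR (g / 2 * r - expR r) *
    \int[mu]_t (phi (row t) * (expR (r / 2) ^- d * A *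
      gauss ((2 * expR (r / 2))^-1 *: (row t - row x)))).
have GE r : h (row x) * (2 * pi) ^- d * G r = Q (r, x).
  rewrite QE /G.
  rewrite (_ : \int[mu]_t _ = expR (r / 2) ^- d * A * I (row x) r); last first.
    rewrite -(RintegralZl _ measurableT (ipg (row x) r)); apply: eq_Rintegral => t _.
    by rewrite mulrCA.
  rewrite /potential_weight addn0 /bessel_const.
  set J := I _ _; set M := _^-1; set B := _ ^- d; set E := expR (r / 2) ^- d; set D := expR _.
  by move: J M B E D (h _) => J M B E D hx; ring.
have [hx0|hx0] := eqVneq (h (row x)) 0.
  rewrite hx0 mul0r; under eq_Rintegral do rewrite -GE hx0 !mul0r.
  by rewrite Rintegral_cst// mul0r.
have k0 : h (row x) * (2 * pi) ^- d != 0.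
  by rewrite mulf_neq0// invr_neq0// expf_neq0// mulf_neq0// gt_eqF// pi_gt0.
have iG : leb.-integrable setT (EFin \o G).
  have := integrableZl measurableT (h (row x) * (2 * pi) ^- d)^-1 (iQr x).
  by apply: eq_integrable => // r _; rewrite -GE /= -EFinM mulKf.
rewrite mulrA -RintegralZl//.
by apply: eq_Rintegral => r _; rewrite GE.
Qed.

End representation.

(** * The Sobolev embedding *)

(** There are finitely many derivatives of order at most [n], so that their
    constants have a common bound. *)
Lemma uniform_over_seq (R : realDomainType) (I : finType) (n : nat)
    (P : seq I -> R -> Prop) :
  (forall s c c', c <= c' -> P s c -> P s c') ->
  (forall s, (size s <= n)%N -> exists2 c, 0 <= c & P s c) ->
  exists2 C, 0 <= C & forall s, (size s <= n)%N -> P s C.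
Proof.
elim: n P => [|n IH] P mono hP.
  by have [c c0 Pc] := hP [::] isT; exists c => // -[].
have /choice[c hc] : forall i, exists c, 0 <= c /\
    forall s, (size s <= n)%N -> P (i :: s) c.
  move=> i; have [s c c'||c c0 Pc] := IH (fun s => P (i :: s)); first exact: mono.
    by move=> s sn; exact: hP.
  by exists c.
have [a a0 Pa] := hP [::] isT.
have S0 : 0 <= \sum_i c i by apply: sumr_ge0 => i _; exact: (hc i).1.
exists (a + \sum_i c i); first exact: addr_ge0.
case=> [_|i s sn]; first by apply: mono Pa; rewrite lerDl.
apply: mono ((hc i).2 s sn); rewrite (bigD1 i)//= addrCA lerDl addr_ge0//.
by apply: sumr_ge0 => j _; exact: (hc j).1.
Qed.

Section holder.
Context (R : realType) (d : nat).
Local Notation Rd := 'rV[R]_d.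

Lemma holder_continuous (f : Rd -> R) (K delta : R) (x : Rd) : 0 < delta ->
  (forall y, `|f x - f y| <= K * enorm (x - y) `^ delta) ->
  {for x, continuous f}.
Proof.
move=> d0 hf; apply/continuous_dist_ltP => e e0.
pose K1 := `|K| + 1; have K10 : 0 < K1 by rewrite ltr_wpDl.
pose c : R := d%:R + 1; have c0 : 0 < c by rewrite ltr_wpDl.
have ek : 0 < (e / K1) `^ delta^-1 by rewrite powR_gt0// divr_gt0.
exists ((e / K1) `^ delta^-1 / c); first by rewrite divr_gt0.
move=> y; rewrite ltr_pdivlMr// => xy; apply: le_lt_trans (hf y) _.
have h1 : enorm (x - y) <= `|x - y| * c.
  apply: le_trans (enorm_le_norm _) _.
  by rewrite mulrC ler_wpM2l// lerDl.
have h2 : enorm (x - y) `^ delta < e / K1.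
  rewrite -[ltRHS](@powRr1 _ (e / K1)) ?divr_ge0// ?ltW// -(mulVf (lt0r_neq0 d0)) powRrM.
  by apply: gt0_ltr_powR => //; rewrite ?nnegrE ?enorm_ge0 ?powR_ge0// (le_lt_trans h1).
apply: (@le_lt_trans _ _ (K1 * enorm (x - y) `^ delta)).
  by rewrite ler_wpM2r ?powR_ge0// (le_trans (ler_norm _))// lerDl.
by rewrite mulrC -ltr_pdivlMr.
Qed.

Context (p : R) (p_gt1 : 1 < p) (delta : R) (n : nat) (g : R).
Hypothesis delta01 : 0 < delta < 1.
Hypothesis delta_le : n%:R + delta <= g - d%:R / p.

Let exponent_ge k : (k <= n)%N -> delta <= sobolev_exponent d p g k.
Proof.
rewrite -(ler_nat R) => kn; rewrite /sobolev_exponent addrAC lerBrDr [leLHS]addrC.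
by apply: le_trans delta_le; rewrite lerD2r.
Qed.

Let exponent_gt0 k : (k <= n)%N -> 0 < sobolev_exponent d p g k.
Proof. by move=> /exponent_ge; apply: lt_le_trans; case/andP: delta01. Qed.

Lemma partials_potential (c : R) (h : Rd -> R) (H : R) s : 0 <= H ->
  measurable_fun setT (h \o @row_of_tuple R d) -> (Lp_norm p h <= H%:E)%E ->
  (size s <= n)%N ->
  partials s (fun y => c * potential g h [::] y) =
  (fun y => c * potential g h s y).
Proof.
move=> H0 mh hH; elim: s => [//|i s IH] /= sn.
rewrite IH ?(ltnW sn)//; apply/funext => y.
have [dp pp] := potential_differentiable p_gt1 delta01 (exponent_ge sn) H0 mh hH y.
rewrite (partialM i (differentiable_cst c y) dp).
by rewrite partial_cst mulr0 addr0 pp.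
Qed.

(** The norm is an infimum over the densities [h], so a density is at hand for each
    strict upper bound [M] of it. *)
Lemma sobolev_strict : exists2 C, 0 <= C & forall (T : (Rd -> R) -> R) (M : R),
  (H_norm g p T < M%:E)%E -> exists v : Rd -> R,
  [/\ forall phi, test_function setT phi -> T phi = regular v phi,
      Ck_on n setT v,
      forall s y, (size s <= n)%N -> `|partials s v y| <= C * M &
      forall s y z, (size s <= n)%N ->
        `|partials s v y - partials s v z| <= C * M * enorm (y - z) `^ delta].
Proof.
pose c0 := bessel_const d g.
pose P s C := forall (h : Rd -> R) (H : R), 0 <= H ->
  measurable_fun setT (h \o @row_of_tuple R d) -> (Lp_norm p h <= H%:E)%E ->
  (forall y, `|c0 * potential g h s y| <= C * H) /\
  (forall y z, `|c0 * potential g h s y - c0 * potential g h s z| <=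
     C * H * enorm (y - z) `^ delta).
have [s c c' cc' Pc h H H0 mh hH|s sn|C C0 hC] := @uniform_over_seq R 'I_d n P.
- have [h1 h2] := Pc h H H0 mh hH; split=> [y|y z].
    by apply: le_trans (h1 y) _; rewrite ler_wpM2r.
  by apply: le_trans (h2 y z) _; rewrite ler_wpM2r ?powR_ge0// ler_wpM2r.
- have [C1 C10 h1] := potential_bound p_gt1 (exponent_gt0 sn).
  have [C2 C20 h2] := potential_holder p_gt1 delta01 (exponent_ge sn).
  exists (`|c0| * (C1 + C2)); first by rewrite mulr_ge0// addr_ge0.
  move=> h H H0 mh hH; split=> [y|y z].
    have [i1 b1] := h1 h H H0 mh hH y.
    rewrite normrM -mulrA ler_wpM2l// (le_trans (potential_sup i1 b1))//.
    by rewrite ler_wpM2r// lerDl.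
  rewrite -mulrBr normrM -!mulrA ler_wpM2l// -{1}(subrK z y) [y - z + z]addrC.
  rewrite (le_trans (h2 h H H0 mh hH _ _))// mulrA ler_wpM2r ?powR_ge0//.
  by rewrite ler_wpM2r// lerDr.
exists C => // T M /ereal_inf_lt[_ [h [[mh _] hT] <-] hM].
have M0 : 0 <= M.
  by rewrite -lee_fin (le_trans _ (ltW hM))// Lnorm_ge0.
have pE s (sn : (size s <= n)%N) := partials_potential c0 M0 mh (ltW hM) sn.
exists (fun y => c0 * potential g h [::] y); split.
- move=> phi tphi; rewrite hT// /regular.
  exact: (bessel_representation p_gt1 (exponent_gt0 (leq0n n)) M0 mh (ltW hM) tphi).
- move=> s sn x _; rewrite (pE s sn); split.
    apply: (@holder_continuous _ (C * M) delta); first by case/andP: delta01.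
    by move=> y; exact: (hC s sn h M M0 mh (ltW hM)).2.
  move=> sn'; apply: differentiableM; first exact: differentiable_cst.
  exact: (potential_differentiable p_gt1 delta01 (exponent_ge sn') M0 mh (ltW hM) x).1.
- by move=> s y sn; rewrite (pE s sn); exact: (hC s sn h M M0 mh (ltW hM)).1.
- by move=> s y z sn; rewrite (pE s sn); exact: (hC s sn h M M0 mh (ltW hM)).2.
Qed.

Lemma H_norm_ge0 T : (0 <= @H_norm R d g p T)%E.
Proof. by apply: le_ereal_inf_tmp => _ [h _ <-]; exact: Lnorm_ge0. Qed.

(** If the norm is positive, twice the norm is a strict upper bound of it. If it is
    zero, all positive numbers are, and letting them tend to zero shows that [T]
    vanishes on test functions. *)
Theorem sobolev_embedding : exists2 C, 0 <= C & forall T : (Rd -> R) -> R,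
  (H_norm g p T < +oo)%E -> exists v : Rd -> R,
  [/\ forall phi, test_function setT phi -> T phi = regular v phi,
      Ck_on n setT v,
      forall s y, (size s <= n)%N -> `|partials s v y| <= C * fine (H_norm g p T) &
      forall s y z, (size s <= n)%N ->
        `|partials s v y - partials s v z| <=
        C * fine (H_norm g p T) * enorm (y - z) `^ delta].
Proof.
have [C C0 hC] := sobolev_strict.
exists (C * 2); first by rewrite mulr_ge0.
move=> T Tfin; pose N := fine (H_norm g p T).
have NE : H_norm g p T = N%:E by rewrite fineK// ge0_fin_numE// H_norm_ge0.
have N0 : 0 <= N by rewrite -lee_fin -NE H_norm_ge0.
rewrite -/N -mulrA; have [Npos|] := ltP 0 N.
  by apply: hC; rewrite NE lte_fin ltr_pMl// ltr1n.
move=> Nle; have {Nle}N0 : N = 0 by apply/le_anti/andP.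
exists (fun=> 0); rewrite N0 !mulr0.
have p0 s : partials s (fun=> 0 : R) = (fun=> 0 : R) :> (Rd -> R).
  by elim: s => //= i s ->; exact: partial_cst.
split; last 1 first.
- by move=> s y z _; rewrite p0 subrr normr0 mul0r.
- move=> phi tphi.
  have -> : regular (fun=> 0) phi = 0.
    by rewrite /regular integral_onT; under eq_Rintegral do rewrite mul0r; rewrite Rintegral_cst// mul0r.
  have [K K0 hK] := test_function_bound tphi.
  have cphi : continuous phi by apply: smooth_on_continuous; have [] := tphi.
  pose D := K * gauss_mass R d.
  have bnd (M : R) : 0 < M -> `|T phi| <= C * M * D.
    move=> M0; have [|v [vT vn vb _]] := hC T M; first by rewrite NE N0 lte_fin.
    have cv : continuous v.
      by move=> x; apply: (Ck_on_continuous vn).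
    rewrite (vT _ tphi) /regular integral_onT.
    have i2 : (@tuple_lebesgue R d).-integrable setT
        (fun t => (C * M * K * gauss (row_of_tuple t))%:E).
      exact: (integrableZl measurableT _ (integrable_gauss R d)).
    have i1 : (@tuple_lebesgue R d).-integrable setT
        (fun t => (v (row_of_tuple t) * phi (row_of_tuple t))%:E).
      apply: (le_integrable measurableT _ _ i2).
        apply/measurable_EFinP; apply: measurable_funM.
          exact: measurable_continuous.
        exact: measurable_continuous.
      move=> t _ /=; rewrite lee_fin normrM (le_trans _ (ler_norm _))// -[leRHS]mulrA.
      by rewrite ler_pM//; exact: (vb [::] _ isT).
    apply: le_trans (le_normr_Rintegral measurableT i1) _.
    apply: (@le_trans _ _ (\int[@tuple_lebesgue R d]_t (C * M * K * gauss (row_of_tuple t)))).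
      apply: le_Rintegral => //; first exact: (integrable_abse i1).
      move=> t _; rewrite normrM -[leRHS]mulrA ler_pM//; exact: (vb [::] _ isT).
    rewrite (RintegralZl _ measurableT (integrable_gauss R d)) /D mulrA.
    by rewrite ler_wpM2l// ?mulr_ge0// ?(ltW M0).
  apply/eqP; rewrite -normr_le0; apply/ler_addgt0Pl => e e0; rewrite addr0.
  have CD0 : 0 <= C * D by rewrite mulr_ge0// mulr_ge0// gauss_mass_ge0.
  have M0 : 0 < e / (C * D + 1) by rewrite divr_gt0// ltr_wpDl.
  apply: le_trans (bnd _ M0) _.
  rewrite mulrAC mulrCA ler_piMr ?(ltW e0)// ler_pdivrMr ?mul1r ?ltr_wpDl//.
  by rewrite lerDl.
- exact: (@Ck_on_cst R d n setT 0).
- by move=> s y _; rewrite p0 normr0.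
Qed.
End holder.

(** * Hoelder classes at a given length scale *)

Section holder_class.
Context (R : realType) (d : nat) (delta : R).
Local Notation Rd := 'rV[R]_d.
Implicit Types (U : set Rd) (f g : Rd -> R) (A B r : R).

(** The bounds of a function that varies on the scale [r]: each derivative costs a
    factor [1 / r], and increments are measured in units of [r]. In these units the
    constant of a product is a multiple of the product of the constants, the same
    for all sets and all scales. *)
Definition holder_class U r (k : nat) A f : Prop :=
  Ck_on k U f /\ forall s, (size s <= k)%N ->
    (forall y, U y -> `|partials s f y| <= A * r ^- size s) /\
    (forall y z, U y -> U z -> `|partials s f y - partials s f z| <=
       A * r ^- size s * (enorm (y - z) / r) `^ delta).

Lemma holder_class_le U r k l A B f : 0 < r -> (l <= k)%N -> A <= B ->
  holder_class U r k A f -> holder_class U r l B f.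
Proof.
move=> r0 lk AB [cf bf]; split; first exact: Ck_onW cf.
move=> s sl; have [b1 b2] := bf s (leq_trans sl lk).
have ri : 0 <= r ^- size s by rewrite invr_ge0 exprn_ge0// ltW.
split=> [y Uy|y z Uy Uz]; first by rewrite (le_trans (b1 y Uy))// ler_wpM2r.
by rewrite (le_trans (b2 y z Uy Uz))// ler_wpM2r ?powR_ge0// ler_wpM2r.
Qed.

Lemma holder_class_eq U r k A f g : open U -> (forall x, U x -> f x = g x) ->
  holder_class U r k A f -> holder_class U r k A g.
Proof.
move=> oU fg [cf bf]; split; first exact: Ck_on_eq cf.
move=> s sl; have [b1 b2] := bf s sl; have E := partials_eq_open s oU fg.
by split=> [y Uy|y z Uy Uz]; rewrite -?(E y)// -?(E z)//; [exact: b1|exact: b2].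
Qed.

(** Recursion on the order; sums, products and powers are treated by induction
    along it. *)
Lemma holder_classS U r k A f : 0 < r ->
  holder_class U r 0 A f -> (forall x, U x -> differentiable f x) ->
  (forall i, holder_class U r k (A / r) (partial i f)) ->
  holder_class U r k.+1 A f.
Proof.
move=> r0 [c0 b0] df pf; split; first by apply/Ck_onS; split => // i; exact: (pf i).1.
move=> s; case: (lastP s) => [_|{}s i]; first exact: b0.
rewrite size_rcons ltnS => sk; have [b1 b2] := (pf i).2 s sk.
have E : A * r ^- (size s).+1 = A / r * r ^- size s.
  by rewrite exprS invfM mulrA.
by rewrite partials_rcons E.
Qed.

Lemma holder_class_partial U r k A f i : 0 < r ->
  holder_class U r k.+1 A f -> holder_class U r k (A / r) (partial i f).
Proof.
move=> r0 [/Ck_onS[df cf] bf]; split=> // s sk.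
have [] := bf (rcons s i); first by rewrite size_rcons.
have E : A * r ^- (size s).+1 = A / r * r ^- size s.
  by rewrite exprS invfM mulrA.
by rewrite partials_rcons size_rcons E.
Qed.

Lemma holder_class_differentiable U r k A f x :
  holder_class U r k.+1 A f -> U x -> differentiable f x.
Proof. by move=> [/Ck_onS[df _] _]; exact: df. Qed.

Lemma holder_class0 U r A f : (forall x, U x -> {for x, continuous f}) ->
  (forall y, U y -> `|f y| <= A) ->
  (forall y z, U y -> U z -> `|f y - f z| <= A * (enorm (y - z) / r) `^ delta) ->
  holder_class U r 0 A f.
Proof.
move=> cf b1 b2; split; first exact/Ck_on0.
by case=> //= _; split=> [y /b1|y z Uy Uz]; rewrite expr0 invr1 mulr1//; exact: b2.
Qed.

Lemma holder_class_bounds U r k A f : holder_class U r k A f ->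
  (forall y, U y -> `|f y| <= A) /\
  (forall y z, U y -> U z -> `|f y - f z| <= A * (enorm (y - z) / r) `^ delta).
Proof.
move=> [_ bf]; have [b1 b2] := bf [::] isT.
by move: b1 b2; rewrite /= expr0 invr1 mulr1.
Qed.

Lemma holder_class_low U r k A f : 0 < r ->
  holder_class U r k A f -> holder_class U r 0 A f.
Proof. by move=> r0; exact: holder_class_le. Qed.

Lemma holder_classD U r k A B f g : open U -> 0 < r ->
  holder_class U r k A f -> holder_class U r k B g ->
  holder_class U r k (A + B) (fun x => f x + g x).
Proof.
move=> oU r0.
have base a b u v : holder_class U r 0 a u -> holder_class U r 0 b v ->
    holder_class U r 0 (a + b) (fun x => u x + v x).
  move=> hu hv.
  have [u1 u2] := holder_class_bounds hu; have [v1 v2] := holder_class_bounds hv.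
  apply: holder_class0.
  - by move=> x Ux; exact: (Ck_on_continuous (Ck_onD oU hu.1 hv.1)).
  - by move=> y Uy; rewrite (le_trans (ler_normD _ _))// lerD// ?u1 ?v1.
  - move=> y z Uy Uz; rewrite opprD addrACA (le_trans (ler_normD _ _))// mulrDl.
    by rewrite lerD// ?u2 ?v2.
elim: k A B f g => [|k IH] A B f g hf hg; first exact: base.
have df x (Ux : U x) := holder_class_differentiable hf Ux.
have dg x (Ux : U x) := holder_class_differentiable hg Ux.
apply: holder_classS => //.
- exact: (base _ _ _ _ (holder_class_low r0 hf) (holder_class_low r0 hg)).
- by move=> x Ux; apply: differentiableD; [exact: df|exact: dg].
- move=> i; rewrite mulrDl.
  apply: (@holder_class_eq _ _ _ _ (fun x => partial i f x + partial i g x)) => //.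
    by move=> x Ux; rewrite partialD//; [exact: df|exact: dg].
  by apply: IH; exact: holder_class_partial.
Qed.

Lemma holder_class_cst U r k (a : R) : 0 < r -> holder_class U r k `|a| (fun=> a).
Proof.
move=> r0; have ps s : size s != 0 -> partials s (fun=> a) = (fun=> 0) :> (Rd -> R).
  elim: s => //= i [|j s] IH _; first exact: partial_cst.
  by rewrite IH//; exact: partial_cst.
split; first exact: Ck_on_cst.
have ri s : 0 <= r ^- size s by rewrite invr_ge0 exprn_ge0// ltW.
case=> [|i s] _; first by split => *; rewrite /= expr0 invr1 mulr1 ?subrr// normr0 mulr_ge0 ?powR_ge0.
by rewrite ps//; split => *; rewrite ?subrr normr0 !mulr_ge0 ?powR_ge0// invr_ge0 exprn_ge0// ltW.
Qed.

Lemma holder_class_sum U r k (I : Type) (s : seq I) (P : pred I) (A : I -> R) (f : I -> Rd -> R) :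
  open U -> 0 < r -> (forall i, P i -> holder_class U r k (A i) (f i)) ->
  holder_class U r k (\sum_(i <- s | P i) A i) (fun x => \sum_(i <- s | P i) f i x).
Proof.
move=> oU r0 hf; elim: s => [|i s IH].
  rewrite big_nil.
  have -> : (fun x : Rd => \sum_(i <- [::] | P i) f i x) = (fun=> 0).
    by apply/funext => x; rewrite big_nil.
  by have := holder_class_cst U k 0 r0; rewrite normr0.
rewrite big_cons; case: ifP => Pi.
  have -> : (fun x => \sum_(i <- i :: s | P i) f i x) = (fun x => f i x + \sum_(i <- s | P i) f i x).
    by apply/funext => x; rewrite big_cons Pi.
  by apply: holder_classD => //; exact: hf.
have -> : (fun x => \sum_(i <- i :: s | P i) f i x) = (fun x => \sum_(i <- s | P i) f i x).
  by apply/funext => x; rewrite big_cons Pi.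
by [].
Qed.

Lemma holder_classM U r k A B f g : open U -> 0 < r -> 0 <= A -> 0 <= B ->
  holder_class U r k A f -> holder_class U r k B g ->
  holder_class U r k (2 ^+ k.+1 * (A * B)) (fun x => f x * g x).
Proof.
move=> oU r0.
have base a b u v : 0 <= a -> 0 <= b -> holder_class U r 0 a u -> holder_class U r 0 b v ->
    holder_class U r 0 (2 * (a * b)) (fun x => u x * v x).
  move=> a0 b0 hu hv.
  have [u1 u2] := holder_class_bounds hu; have [v1 v2] := holder_class_bounds hv.
  apply: holder_class0.
  - by move=> x Ux; exact: (Ck_on_continuous (Ck_onM oU hu.1 hv.1)).
  - move=> y Uy; rewrite normrM mulr_natl mulr2n -[leLHS]addr0 lerD ?mulr_ge0//.
    by rewrite ler_pM// ?u1 ?v1.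
  - move=> y z Uy Uz.
    have -> : u y * v y - u z * v z = u y * (v y - v z) + (u y - u z) * v z by ring.
    rewrite (le_trans (ler_normD _ _))// !normrM mulr_natl mulr2n mulrDl lerD//.
      by rewrite -mulrA ler_pM// ?u1 ?v2.
    by rewrite mulrAC ler_pM// ?v1 ?u2.
elim: k A B f g => [|k IH] A B f g A0 B0 hf hg; first by rewrite expr1; exact: base.
have df x (Ux : U x) := holder_class_differentiable hf Ux.
have dg x (Ux : U x) := holder_class_differentiable hg Ux.
have AB0 : 0 <= A * B by exact: mulr_ge0.
apply: holder_classS => //.
- apply: (holder_class_le r0 (leqnn 0) _ (base _ _ _ _ A0 B0 (holder_class_low r0 hf) (holder_class_low r0 hg))).
  by rewrite ler_wpM2r// exprS ler_peMr// exprn_ege1// ler1n.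
- by move=> x Ux; apply: differentiableM; [exact: df|exact: dg].
- move=> i.
  apply: (@holder_class_eq _ _ _ _ (fun x => f x * partial i g x + g x * partial i f x)) => //.
    by move=> x Ux; rewrite partialM//; [exact: df|exact: dg].
  have -> : 2 ^+ k.+2 * (A * B) / r = 2 ^+ k.+1 * (A * (B / r)) + 2 ^+ k.+1 * (B * (A / r)).
    by rewrite [in LHS]exprS; ring.
  apply: holder_classD => //; apply: IH; rewrite ?divr_ge0 ?(ltW r0)//.
  + exact: holder_class_le hf.
  + exact: holder_class_partial.
  + exact: holder_class_le hg.
  + exact: holder_class_partial.
Qed.

(** On a convex set of diameter at most [r], one more bounded derivative controls
    the increments, by the mean value theorem. *)
Lemma holder_class_smooth U r k A f : 0 < delta < 1 -> 0 < r -> 0 <= A ->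
  (forall y z, U y -> U z -> enorm (y - z) <= r) ->
  (forall y z (t : R), U y -> U (y + z) -> 0 <= t <= 1 -> U (y + t *: z)) ->
  Ck_on k.+1 U f ->
  (forall s y, (size s <= k.+1)%N -> U y -> `|partials s f y| <= A * r ^- size s) ->
  holder_class U r k ((d%:R + 1) * A) f.
Proof.
move=> /andP[d0 d1] r0 A0 Ur Uc cf bf; split; first exact: Ck_onW cf.
move=> s sk; have ri k' : 0 <= r ^- k' by rewrite invr_ge0 exprn_ge0// ltW.
split=> [y Uy|y z Uy Uz].
  rewrite (le_trans (bf s y (leqW sk) Uy))// ler_wpM2r// ler_peMl//.
  by rewrite lerDr.
have Uyz : U (z + (y - z)) by rewrite addrC subrK.
have [t t01] := @mvt_segment R d (partials s f) z (y - z)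
  (fun t t01 => (cf s (leqW sk) _ (Uc z (y - z) t Uz Uyz t01)).2 sk).
rewrite [z + _]addrC subrK => ->.
apply: (@le_trans _ _ (\sum_i `|(y - z) 0 i| * (A * r ^- (size s).+1))).
  rewrite (le_trans (ler_norm_sum _ _ _))//; apply: ler_sum => i _.
  rewrite normrM ler_wpM2l//; apply: (bf (i :: s)) => //.
  exact: Uc.
rewrite -mulr_suml.
apply: (@le_trans _ _ (d%:R * enorm (y - z) * (A * r ^- (size s).+1))).
  by rewrite ler_wpM2r ?mulr_ge0// sum_coord_le_enorm.
have -> : d%:R * enorm (y - z) * (A * r ^- (size s).+1) =
   d%:R * A * r ^- size s * (enorm (y - z) / r) by rewrite exprS invfM; ring.
apply: ler_pM; [by rewrite !mulr_ge0|by rewrite divr_ge0 ?enorm_ge0 ?(ltW r0)| |].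
  by rewrite ler_wpM2r// ler_wpM2r// lerDl.
have e0 : 0 <= enorm (y - z) / r by rewrite divr_ge0 ?enorm_ge0 ?(ltW r0).
have e1 : enorm (y - z) / r <= 1 by rewrite ler_pdivrMr// mul1r Ur.
have [->|en0] := eqVneq (enorm (y - z) / r) 0; first by rewrite powR_ge0.
by apply: ger1_powR; rewrite ?(ltW d1)// lt_neqAle eq_sym en0 e0.
Qed.

(** Up to a factor that depends on [K] and [a], a value between [A / K] and [A] may
    be replaced by [A] in a power. *)
Lemma powR_pinch (K A t a : R) : 1 <= K -> 0 < A -> A / K <= t <= A ->
  t `^ a <= K `^ `|a| * A `^ a.
Proof.
move=> K1 A0 /andP[t1 t2]; have K0 : 0 < K by exact: lt_le_trans K1.
have t0 : 0 < t by apply: lt_le_trans t1; rewrite divr_gt0.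
have [a0|a0] := leP 0 a.
  rewrite (ger0_norm a0); apply: (@le_trans _ _ (A `^ a)).
    by apply: ge0_ler_powR => //; rewrite nnegrE ltW.
  by rewrite ler_peMl ?powR_ge0// -[leLHS](powRr0 K) ler_powR.
rewrite (ltr0_norm a0) -[a in leLHS]opprK -[a in X in _ <= _ * X]opprK.
have na : 0 <= - a by rewrite oppr_ge0 ltW.
rewrite (powRN t) (powRN A) ler_pdivlMr ?powR_gt0// mulrC ler_pdivrMr ?powR_gt0//.
rewrite -powRM ?(ltW K0) ?(ltW t0)//; apply: ge0_ler_powR => //; rewrite ?nnegrE ?mulr_ge0 ?(ltW K0) ?(ltW t0) ?(ltW A0)//.
by rewrite mulrC -ler_pdivrMr.
Qed.

Lemma powR_lipschitz (K A y z a : R) : 1 <= K -> 0 < A ->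
  A / K <= y <= A -> A / K <= z <= A ->
  `|y `^ a - z `^ a| <= `|a| * K `^ `|a - 1| * A `^ (a - 1) * `|y - z|.
Proof.
move=> K1 A0; wlog yz : y z / y <= z => [hw hy hz|hy hz].
  have [yz|/ltW zy] := leP y z; first exact: hw.
  by rewrite distrC (distrC y); exact: hw.
have K0 : 0 < K by exact: lt_le_trans K1.
have AK : 0 < A / K by rewrite divr_gt0.
have dpow (x : R) : 0 < x -> is_derive x 1 (fun t : R => t `^ a) (a * x `^ (a - 1)).
  move=> x0; apply: DeriveDef.
    by apply: derivable_powR; rewrite in_itv/= x0.
  by rewrite -derive1E powR_derive1// in_itv/= x0.
have pos x : x \in `[y, z] -> A / K <= x <= A.
  rewrite in_itv/= => /andP[yx xz]; case/andP: hy => h1 _; case/andP: hz => _ h2.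
  by rewrite (le_trans h1)//= (le_trans xz).
have pos0 x : x \in `[y, z] -> 0 < x.
  by move=> /pos/andP[h _]; exact: lt_le_trans h.
have [||x yxz] := @MVT_segment R (fun t : R => t `^ a) (fun x => a * x `^ (a - 1)) y z yz.
  by move=> x /subset_itv_oo_cc/pos0; exact: dpow.
  apply: derivable_within_continuous => x /pos0 x0.
  by apply: derivable_powR; rewrite in_itv/= andbT.
rewrite distrC => ->; rewrite (distrC y) normrM ler_wpM2r// normrM -!mulrA ler_wpM2l//.
by rewrite ger0_norm ?powR_ge0//; apply: powR_pinch => //; exact: pos.
Qed.

Lemma powRB1M (A b : R) : 0 < A -> A `^ (b - 1) * A = A `^ b.
Proof.
move=> A0; rewrite -{2}(powRr1 (ltW A0)) -powRD ?subrK//.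
by apply/implyP => _; rewrite gt_eqF.
Qed.

(** The constant [C] is the same for all sets and all scales, and [A] enters through
    [A `^ a] only: it can be used simultaneously at all points of an open set. *)
Lemma holder_class_powR k (a K : R) : 1 <= K -> exists2 C, 0 <= C &
  forall U r A f, open U -> 0 < r -> 0 < A ->
    (forall x, U x -> A / K <= f x) -> holder_class U r k A f ->
    holder_class U r k (C * A `^ a) (fun x => f x `^ a).
Proof.
move=> K1; have K0 : 0 < K by exact: lt_le_trans K1.
have base b : exists2 C, 0 <= C & forall U r A f, open U -> 0 < r -> 0 < A ->
    (forall x, U x -> A / K <= f x) -> holder_class U r 0 A f ->
    holder_class U r 0 (C * A `^ b) (fun x => f x `^ b).
  exists (K `^ `|b| + `|b| * K `^ `|b - 1|).
    by rewrite addr_ge0 ?mulr_ge0 ?powR_ge0.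
  move=> U r A f oU r0 A0 fA hf; have [f1 f2] := holder_class_bounds hf.
  have fK x : U x -> A / K <= f x <= A.
    by move=> Ux; rewrite fA// (le_trans (ler_norm _))// f1.
  have f0 x : U x -> 0 < f x.
    by move=> Ux; apply: lt_le_trans (fA x Ux); rewrite divr_gt0.
  apply: holder_class0.
  - by move=> x Ux; apply: (Ck_on_continuous (Ck_on_powR b oU f0 hf.1)).
  - move=> y Uy; rewrite ger0_norm ?powR_ge0// (le_trans (powR_pinch b K1 A0 (fK y Uy)))//.
    by rewrite ler_wpM2r ?powR_ge0// lerDl mulr_ge0 ?powR_ge0.
  - move=> y z Uy Uz; apply: le_trans (powR_lipschitz b K1 A0 (fK y Uy) (fK z Uz)) _.
    apply: (@le_trans _ _ (`|b| * K `^ `|b - 1| * A `^ (b - 1) * (A * (enorm (y - z) / r) `^ delta))).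
      by rewrite ler_wpM2l ?mulr_ge0 ?powR_ge0// f2.
    rewrite mulrA -[X in X * _ <= _]mulrA powRB1M//.
    by rewrite ler_wpM2r ?powR_ge0// ler_wpM2r ?powR_ge0// lerDr powR_ge0.
elim: k a => [|k IH] b; first exact: base.
have [C1 C10 h1] := base b; have [C2 C20 h2] := IH (b - 1).
exists (C1 + `|b| * (2 ^+ k.+1 * (2 ^+ k.+1 * C2))).
  by rewrite addr_ge0// !mulr_ge0// exprn_ge0.
move=> U r A f oU r0 A0 fA hf.
have f0 x : U x -> 0 < f x.
  by move=> Ux; apply: lt_le_trans (fA x Ux); rewrite divr_gt0.
have df x (Ux : U x) := holder_class_differentiable hf Ux.
have A0' := ltW A0.
apply: holder_classS => //.
- apply: (holder_class_le r0 (leqnn 0) _ (h1 U r A f oU r0 A0 fA (holder_class_low r0 hf))).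
  by rewrite ler_wpM2r ?powR_ge0// lerDl !mulr_ge0// exprn_ge0.
- by move=> x Ux; apply: differentiable_powR; [exact: f0|exact: df].
move=> i.
apply: (@holder_class_eq _ _ _ _ (fun x => b * (f x `^ (b - 1) * partial i f x))) => //.
  by move=> x Ux; rewrite partial_powR// ?mulrA//; [exact: f0|exact: df].
have hp := holder_class_partial i r0 hf.
have hq := h2 U r A f oU r0 A0 fA (holder_class_le r0 (leqnSn k) (lexx A) hf).
have q0 : 0 <= C2 * A `^ (b - 1) by rewrite mulr_ge0 ?powR_ge0.
have Ar0 : 0 <= A / r by rewrite divr_ge0 ?(ltW r0).
have pq0 : 0 <= 2 ^+ k.+1 * (C2 * A `^ (b - 1) * (A / r)).
  by rewrite mulr_ge0 ?exprn_ge0// mulr_ge0.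
have h := holder_classM oU r0 (normr_ge0 b) pq0 (holder_class_cst U k b r0)
  (holder_classM oU r0 q0 Ar0 hq hp).
apply: (holder_class_le r0 (leqnn k) _ h).
have -> : 2 ^+ k.+1 * (`|b| * (2 ^+ k.+1 * (C2 * A `^ (b - 1) * (A / r)))) =
  `|b| * (2 ^+ k.+1 * (2 ^+ k.+1 * C2)) * (A `^ (b - 1) * A) / r by ring.
rewrite powRB1M// ler_wpM2r ?invr_ge0 ?(ltW r0)// ler_wpM2r ?powR_ge0//.
by rewrite lerDr.
Qed.
End holder_class.

(** * Operations on test functions and linear functionals *)

Section test_function_calculus.
Context (R : realType) (d : nat).
Local Notation Rd := 'rV[R]_d.
Implicit Types (O : set Rd) (f g phi eta : Rd -> R).
Local Notation mu := (@tuple_lebesgue R d).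
Local Notation row := (@row_of_tuple R d).


Lemma test_function_mul O f eta : open O -> smooth_on O f ->
  test_function O eta -> test_function O (fun x => f x * eta x).
Proof.
move=> oO sf [se [K [cK KO K0]]].
have oK : open (~` K) by apply: closed_openC; exact: compact_closed_row.
split; last by exists K; split => // x /K0 ->; rewrite mulr0.
move=> k s sk x _; have [Ox|nOx] := pselect (O x).
  by apply: (Ck_onM oO (sf k) (@Ck_on_sub _ _ k O setT _ _ (se k))).
apply: (@Ck_on_eq _ _ k (~` K) (fun=> 0)) => //.
- by move=> y /K0 ->; rewrite mulr0.
- exact: Ck_on_cst.
- by move=> /KO.
Qed.

Lemma test_function0 O : test_function O (fun=> 0).
Proof.
split; first by move=> k; exact: Ck_on_cst.
by exists set0; split => //; exact: compact0.
Qed.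

Lemma test_function_sum O (I : Type) (s : seq I) (phi : I -> Rd -> R) :
  (forall i, test_function O (phi i)) ->
  test_function O (fun x => \sum_(i <- s) phi i x).
Proof.
move=> tphi; elim: s => [|i s IH].
  have -> : (fun x : Rd => \sum_(i <- [::]) phi i x) = (fun=> 0).
    by apply/funext => x; rewrite big_nil.
  exact: test_function0.
have -> : (fun x : Rd => \sum_(i <- i :: s) phi i x) =
    (fun x => 1 * phi i x + \sum_(i <- s) phi i x).
  by apply/funext => x; rewrite big_cons mul1r.
exact: test_function_lin.
Qed.

Definition linear_on O (u : (Rd -> R) -> R) : Prop :=
  forall (a : R) phi1 phi2, test_function O phi1 -> test_function O phi2 ->
    u (fun x => a * phi1 x + phi2 x) = a * u phi1 + u phi2.

Lemma linear_on0 O u : linear_on O u -> u (fun=> 0) = 0.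
Proof.
move=> lu; have := lu 1 _ _ (test_function0 O) (test_function0 O).
rewrite (_ : (fun x : Rd => _) = (fun=> 0 : R)); last by apply/funext => x; rewrite mulr0 addr0.
by rewrite mul1r => /eqP; rewrite -subr_eq0 opprD addrA subrr sub0r oppr_eq0 => /eqP.
Qed.

Lemma linear_on_sum O u (I : Type) (s : seq I) (phi : I -> Rd -> R) :
  linear_on O u -> (forall i, test_function O (phi i)) ->
  u (fun x => \sum_(i <- s) phi i x) = \sum_(i <- s) u (phi i).
Proof.
move=> lu tphi; elim: s => [|i s IH].
  rewrite big_nil -[RHS](linear_on0 lu); congr u.
  by apply/funext => x; rewrite big_nil.
rewrite big_cons -IH.
have -> : (fun x : Rd => \sum_(i <- i :: s) phi i x) =
    (fun x => 1 * phi i x + \sum_(i <- s) phi i x).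
  by apply/funext => x; rewrite big_cons mul1r.
by rewrite lu ?mul1r//; exact: test_function_sum.
Qed.

Lemma test_function_dilation (a : R) phi : 0 < a -> test_function setT phi ->
  test_function setT (fun x => phi (a *: x)).
Proof.
move=> a0 [sphi [K [cK _ K0]]]; split.
  by move=> k; apply: (@Ck_on_scale _ _ _ _ setT) => //; exact: openT.
exists ((fun x : Rd => a^-1 *: x) @` K); split => //.
  apply: continuous_compact => //; apply: continuous_subspaceT => x.
  exact: scaler_continuous.
move=> x nx; apply: K0 => Kax; apply: nx; exists (a *: x) => //.
by rewrite scalerA mulVf ?gt_eqF// scale1r.
Qed.

Lemma integrable_regular g (M : R) eta : continuous g -> (forall x, `|g x| <= M) ->
  test_function setT eta ->
  mu.-integrable setT (fun t => (g (row t) * eta (row t))%:E).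
Proof.
move=> cg gM teta; have [C C0 hC] := test_function_bound teta.
apply: (@integrable_le_gauss R d (fun x => g x * eta x) (M * C) 1) => //.
  apply: measurable_continuous; apply: continuousRdM => //.
  by apply: smooth_on_continuous; have [] := teta.
by move=> x; rewrite scale1r normrM -mulrA ler_pM.
Qed.

Lemma regular_dilation (a : R) g (M : R) eta : 0 < a -> continuous g ->
  (forall x, `|g x| <= M) -> test_function setT eta ->
  regular g (fun x => eta (a *: x)) = a ^- d * regular (fun y => g (a^-1 *: y)) eta.
Proof.
move=> a0 cg gM teta; rewrite /regular !integral_onT.
pose F (t : d.-tuple (measurableTypeR R)) := g (a^-1 *: row t) * eta (row t).
have iF : mu.-integrable setT (EFin \o F).
  apply: (@integrable_regular (fun y => g (a^-1 *: y)) M) => // x.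
  apply: (@continuous_comp _ _ _ (fun y : Rd => a^-1 *: y) g); last exact: cg.
  exact: scaler_continuous.
have E t : g (row t) * eta (a *: row t) = F (tuple_affine a (tuple_of_row (0 : Rd)) t).
  by rewrite /F row_affine addr0 scalerA mulVf ?gt_eqF// scale1r.
under eq_Rintegral do rewrite E.
rewrite /Rintegral (integral_tuple_affine (tuple_of_row 0) a0 iF).
by rewrite -[RHS]/(fine (a ^- d)%:E * _) -fineM//; exact: integrable_fin_num.
Qed.

End test_function_calculus.

(** * Localization at the scale of the distance to the boundary *)

Section window.
Context (R : realType).

(** A block of [L] consecutive integers in place of the exact set of the [m] with
    [lo < e^m < q * lo], whose size would depend on [lo]. *)
Definition window (lo : R) (L : nat) : seq int :=
  [seq Num.floor (ln lo) + Posz j | j <- iota 0 L].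

Lemma size_window lo L : size (window lo L) = L.
Proof. by rewrite size_map size_iota. Qed.

Lemma window_uniq lo L : uniq (window lo L).
Proof. by rewrite map_inj_uniq ?iota_uniq// => i j /addrI[]. Qed.

Lemma mem_window (lo q : R) (L : nat) (m : int) : 0 < lo -> 1 <= q ->
  1 + ln q <= L%:R -> lo < expR m%:~R < q * lo -> m \in window lo L.
Proof.
move=> lo0 q1 hL /andP[h1 h2]; have q0 : 0 < q by exact: lt_le_trans q1.
have l1 : ln lo < m%:~R by rewrite -(expRK m%:~R) ltr_ln// posrE expR_gt0.
have l2 : m%:~R < ln q + ln lo.
  by rewrite -lnM// -(expRK m%:~R) ltr_ln ?posrE ?expR_gt0// mulr_gt0.
set f := Num.floor (ln lo).
have f1 : f%:~R <= ln lo by have /andP[] := floor_itv (ln lo).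
have f2 : ln lo < (f + 1)%:~R by exact: Num.Theory.floorD1_gt.
have fm : f < m by rewrite -(ltr_int R) (le_lt_trans f1).
have mL : m < f + L%:Z.
  rewrite -(ltr_int R) intrD -pmulrn (lt_le_trans l2)//.
  move: f2 hL; rewrite intrD; lra.
apply/mapP; exists `|m - f|%N.
  by rewrite mem_iota add0n -ltz_nat gez0_abs ?subr_ge0 1?ltW// ltrBlDl mL.
by rewrite gez0_abs ?subr_ge0 1?ltW// addrCA subrr addr0.
Qed.

End window.

(** Sums over windows centred at nearby points agree, because each window contains
    the support of the summand. *)
Lemma big_uniq_support (V : nmodType) (I : eqType) (s1 s2 : seq I) (F : I -> V) :
  uniq s1 -> uniq s2 -> (forall i, F i != 0 -> (i \in s1) && (i \in s2)) ->
  \sum_(i <- s1) F i = \sum_(i <- s2) F i.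
Proof.
move=> u1 u2 F12.
rewrite (bigID (fun i => F i == 0))/= [in RHS](bigID (fun i => F i == 0))/=.
have z s : \sum_(i <- s | F i == 0) F i = 0 by apply: big1 => i /eqP.
rewrite !z.
congr (_ + _); rewrite -[LHS]big_filter -[RHS]big_filter; apply: perm_big; apply: uniq_perm.
- exact: filter_uniq.
- exact: filter_uniq.
move=> i; rewrite !mem_filter; have [//|Fi] := eqVneq (F i) 0.
by have /andP[-> ->] := F12 i Fi.
Qed.

Lemma esum_seq (R : realType) (s : seq int) (a : int -> R) : uniq s ->
  (forall i, 0 <= a i) -> (forall i, a i != 0 -> i \in s) ->
  (\esum_(i in [set: int]) (a i)%:E)%E = (\sum_(i <- s) a i)%:E.
Proof.
move=> us a0 as0.
rewrite -sumEFin fsbig_seq//.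
rewrite -esum_fset//; last by move=> i _; rewrite lee_fin.
rewrite [RHS]esum_mkcond; apply: eq_esum => i _; rewrite mem_setE.
by case: ifPn => // /negP h; have [->//|/as0] := eqVneq (a i) 0.
Qed.

Lemma partials_scale (R : realType) (d k : nat) (g : 'rV[R]_d -> R) (a : R) s :
  Ck_on k setT g -> (size s <= k)%N ->
  partials s (fun y => g (a *: y)) = (fun y => a ^+ size s * partials s g (a *: y)).
Proof.
move=> cg; elim: s => [|i s IH] sk; first by apply/funext => y; rewrite mul1r.
rewrite /= IH ?(ltnW sk)//; apply/funext => y.
have df : differentiable (partials s g) (a *: y) := (cg s (ltnW sk) _ I).2 sk.
rewrite (partialM i (differentiable_cst _ y) (differentiable_scale df)).
by rewrite partial_cst mulr0 addr0 partial_scale// mulrA exprSr.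
Qed.

Section geometry.
Context (R : realType) (d : nat).
Local Notation Rd := 'rV[R]_d.
Variables (O : set Rd) (oO : open O).

Definition bdist (x : Rd) : R := dist x (boundary O).
(** The radius is small enough for the distance to the boundary to be comparable, on
    the whole ball, to its value at the centre. *)
Definition half_ball (x : Rd) : set Rd := [set y | enorm (x - y) < bdist x / 2].

Lemma boundary_open x : O x -> ~ boundary O x.
Proof. by move=> Ox [_]; apply; exact: (oO Ox). Qed.

Lemma half_ball_open x : open (half_ball x).
Proof. exact: open_eball. Qed.

Lemma half_ball_self x : 0 < bdist x -> half_ball x x.
Proof. by move=> x0; rewrite /half_ball/= subrr enorm0 divr_gt0. Qed.

Lemma half_ball_sub x y : O x -> 0 < bdist x -> half_ball x y -> O y.
Proof.
move=> Ox x0 xy; apply: (eball_sub_open oO Ox); apply: lt_trans xy _.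
by rewrite -/(bdist x); move: (bdist x) x0 => r r0; lra.
Qed.

Lemma half_ball_bdist x y : half_ball x y -> bdist x / 2 < bdist y < 3 / 2 * bdist x.
Proof.
rewrite /half_ball /bdist/= => xy.
have h1 := dist_lipschitz x y (boundary O); have h2 := dist_lipschitz y x (boundary O).
rewrite [enorm (y - x)]enormB in h2.
move: (enorm _) (dist x _) (dist y _) xy h1 h2 => e r s xy h1 h2.
by apply/andP; split; lra.
Qed.

Lemma half_ball_diam x y z : half_ball x y -> half_ball x z -> enorm (y - z) <= bdist x.
Proof.
rewrite /half_ball/= => xy xz.
have := ler_enorm_dist y x z; rewrite [enorm (y - x)]enormB => h.
apply: le_trans h _; move: (bdist x) (enorm (x - y)) (enorm _) xy xz => r a b xy xz; lra.
Qed.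

Lemma half_ball_convex x y z (t : R) : half_ball x y -> half_ball x (y + z) ->
  0 <= t <= 1 -> half_ball x (y + t *: z).
Proof.
rewrite /half_ball/= => xy xz /andP[t0 t1].
have -> : x - (y + t *: z) = (1 - t) *: (x - y) + t *: (x - (y + z)).
  by apply/rowP => i; rewrite !mxE; ring.
apply: le_lt_trans (ler_enormD _ _) _; rewrite !enormZ !ger0_norm ?subr_ge0//.
move: (bdist x) (enorm (x - y)) (enorm (x - (y + z))) xy xz => r a b ha hb.
have [->|tn0] := eqVneq t 0; first by lra.
have tp : 0 < t by rewrite lt_neqAle eq_sym tn0.
have : t * b < t * (r / 2) by rewrite ltr_pM2l.
have : (1 - t) * a <= (1 - t) * (r / 2) by rewrite ler_wpM2l ?subr_ge0// ltW.
lra.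
Qed.

Variable delta : R.
Hypothesis delta01 : 0 < delta < 1.
Local Notation hclass x := (holder_class delta (half_ball x) (bdist x)).

Lemma half_ball_smooth k x A (f : Rd -> R) : 0 < bdist x -> 0 <= A ->
  Ck_on k.+1 (half_ball x) f ->
  (forall s y, (size s <= k.+1)%N -> half_ball x y ->
     `|partials s f y| <= A * bdist x ^- size s) ->
  hclass x k ((d%:R + 1) * A) f.
Proof.
move=> x0 A0; apply: holder_class_smooth => //; first exact: half_ball_diam.
by move=> y z t; exact: half_ball_convex.
Qed.

Variables (zeta : int -> Rd -> R) (k1 k2 : R).
Hypothesis k12 : 0 < k1 < k2.
Hypothesis zeta_smooth : forall n, smooth_on setT (zeta n).
Hypothesis zeta_supp : forall n, closure [set x | zeta n x != 0] `<=`
  [set x | O x /\ k1 * expR (- n%:~R) < dist x (boundary O) < k2 * expR (- n%:~R)].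
Hypothesis zeta_bound : forall m : nat, exists N : R, forall n s x, size s = m ->
  `|partials s (zeta n) x| <= N * expR (m%:R * n%:~R).

Let k10 : 0 < k1. Proof. by case/andP: k12. Qed.
Let k20 : 0 < k2. Proof. by case/andP: k12 => _; exact: lt_trans. Qed.

Lemma zeta_strip m y : zeta (- m) y != 0 -> bdist y / k2 < expR m%:~R < bdist y / k1.
Proof.
move=> zy; have [_] := @zeta_supp (- m) y (@subset_closure _ [set x | zeta (- m) x != 0] y zy).
rewrite rmorphN opprK -/(bdist y) => /andP[h1 h2].
by rewrite ltr_pdivrMr// ltr_pdivlMr// (mulrC _ k2) (mulrC _ k1) h1 h2.
Qed.

(** The constants are those of [zeta_strip] together with
    [bdist x / 2 < bdist y < 3 / 2 * bdist x]. *)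
Lemma zeta_active x y m : 0 < bdist x -> half_ball x y -> zeta (- m) y != 0 ->
  bdist x / (2 * k2) < expR m%:~R < (3 * k2 / k1) * (bdist x / (2 * k2)).
Proof.
move=> x0 /half_ball_bdist/andP[h1 h2] /zeta_strip/andP[h3 h4].
have i1 : 0 < k1^-1 by rewrite invr_gt0.
have i2 : 0 < k2^-1 by rewrite invr_gt0.
apply/andP; split.
  apply: lt_trans h3; rewrite invfM mulrA ltr_pM2r//.
apply: lt_trans h4 _.
have -> : 3 * k2 / k1 * (bdist x / (2 * k2)) = 3 / 2 * bdist x / k1.
  by field; rewrite !gt_eqF.
by rewrite ltr_pM2r.
Qed.

Variable L : nat.
Hypothesis hL : 1 + ln (3 * k2 / k1) <= L%:R.

Definition active_window (x : Rd) : seq int := window (bdist x / (2 * k2)) L.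

Lemma mem_active_window x y m : 0 < bdist x -> half_ball x y ->
  zeta (- m) y != 0 -> m \in active_window x.
Proof.
move=> x0 xy /(zeta_active x0 xy); apply: mem_window => //.
  by rewrite divr_gt0// mulr_gt0.
rewrite ler_pdivlMr// mul1r; case/andP: k12 => _ h.
by rewrite (le_trans (ltW h))// ler_peMl ?(ltW k20)// ler1n.
Qed.

Lemma active_window_sum x y (F : int -> R) : O x -> 0 < bdist x -> half_ball x y ->
  (forall m, zeta (- m) y = 0 -> F m = 0) ->
  \sum_(m <- active_window y) F m = \sum_(m <- active_window x) F m.
Proof.
move=> Ox x0 xy F0; apply: big_uniq_support; [exact: window_uniq|exact: window_uniq|].
have y0 : 0 < bdist y.
  by have /andP[h _] := half_ball_bdist xy; apply: lt_trans h; rewrite divr_gt0.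
move=> m Fm; have zm : zeta (- m) y != 0 by apply: contra_neq Fm; exact: F0.
by rewrite (mem_active_window y0 (half_ball_self y0) zm) (mem_active_window x0 xy zm).
Qed.

(** Unless [zeta (- m)] vanishes on the whole ball, [e^m] is comparable to
    [bdist x], and bounds in powers of [e^(-m)] are bounds at the scale of [x]. *)
Lemma zeta_holder k : exists2 A, 0 <= A & forall x m, 0 < bdist x ->
  hclass x k A (zeta (- m)).
Proof.
have [|s sk|C C0 hC] := @uniform_over_seq R 'I_d k.+1 (fun s C => forall x m y,
  0 < bdist x -> half_ball x y -> `|partials s (zeta (- m)) y| <= C * bdist x ^- size s).
- move=> s c c' cc' h x m y x0 xy; rewrite (le_trans (h x m y x0 xy))// ler_wpM2r//.
  by rewrite invr_ge0 exprn_ge0// ltW.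
- have [N hN] := zeta_bound (size s).
  exists (`|N| * (2 * k2) ^+ size s).
    by rewrite mulr_ge0// exprn_ge0// mulr_ge0// ltW.
  move=> x m y x0 xy.
  have [[z xz zz]|h] := pselect (exists2 z, half_ball x z & zeta (- m) z != 0); last first.
    have E z : half_ball x z -> zeta (- m) z = (fun=> 0 : R) z.
      by move=> xz; apply: contrapT => /eqP zz; apply: h; exists z.
    rewrite (partials_eq_open s (@half_ball_open x) E xy).
    have [_ /(_ s (leqnn _))[+ _]] := holder_class_cst delta (half_ball x) (size s) 0 x0.
    move=> /(_ y xy); rewrite normr0 mul0r => /le_trans; apply.
    by rewrite !mulr_ge0// ?invr_ge0 exprn_ge0 ?mulr_ge0 ?(ltW x0) ?(ltW k20).
  have /andP[h1 _] := zeta_active x0 xz zz.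
  apply: le_trans (hN (- m) s y erefl) _.
  apply: (@le_trans _ _ (`|N| * expR ((size s)%:R * (- m)%:~R))).
    by rewrite ler_wpM2r ?expR_ge0// ler_norm.
  rewrite -mulrA ler_wpM2l// mulrC expRM_natr -exprVn -exprMn lerXn2r ?nnegrE ?expR_ge0//.
    by rewrite mulr_ge0 ?mulr_ge0 ?invr_ge0 ?(ltW x0) ?(ltW k20).
  rewrite rmorphN expRN -[leRHS]invrK lef_pV2 ?posrE ?expR_gt0 ?invr_gt0 ?mulr_gt0 ?invr_gt0//.
  by rewrite invfM invrK mulrC ltW.
exists ((d%:R + 1) * C); first by rewrite mulr_ge0// addr_ge0.
move=> x m x0; apply: half_ball_smooth => //.
  by apply: (@Ck_on_sub R d k.+1 (half_ball x) setT) => //; exact: zeta_smooth.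
by move=> s y sk xy; exact: hC.
Qed.

Variable psi : Rd -> R.
Hypothesis hpsi : regularized_distance O psi.

Lemma psi_gt0 x : O x -> 0 < bdist x -> 0 < psi x.
Proof.
move=> Ox x0; have [_ [c1 [c2 [c10 _ h]]] _] := hpsi.
have /andP[h1 _] := h x (boundary_open Ox).
by apply: lt_le_trans h1; rewrite mulr_gt0.
Qed.

Lemma psi_smooth_on : smooth_on O psi.
Proof.
by move=> k; have [h _ _] := hpsi; apply: (Ck_on_sub _ (h k)) => x; exact: boundary_open.
Qed.

(** Since [psi] is comparable to the distance, it belongs to the class with a
    constant proportional to [bdist x], and is bounded below by a fixed part of that
    constant; so its powers are covered by [holder_class_powR]. *)
Lemma psi_powR_holder k b : exists2 A, 0 <= A & forall x, O x -> 0 < bdist x ->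
  hclass x k (A * bdist x `^ b) (fun y => psi y `^ b).
Proof.
have [_ [c1 [c2 [c10 c20 hc]]] hN] := hpsi.
have [|s sk|C C0 hC] := @uniform_over_seq R 'I_d k.+1 (fun s C => forall x y,
  O x -> 0 < bdist x -> half_ball x y ->
  `|partials s psi y| <= C * bdist x * bdist x ^- size s).
- move=> s c c' cc' h x y Ox x0 xy; rewrite (le_trans (h x y Ox x0 xy))// ler_wpM2r//.
    by rewrite invr_ge0 exprn_ge0// ltW.
  by rewrite ler_wpM2r// ltW.
- case: s sk => [_|i s sk].
    exists (c2 * (3 / 2)); first by rewrite mulr_ge0// ltW.
    move=> x y Ox x0 xy; rewrite /= expr0 invr1 mulr1.
    have Oy := half_ball_sub Ox x0 xy; have /andP[h1 h2] := half_ball_bdist xy.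
    have y0 : 0 < bdist y by apply: lt_trans h1; rewrite divr_gt0.
    rewrite gtr0_norm ?psi_gt0//; have /andP[_ h] := hc y (boundary_open Oy).
    by apply: le_trans h _; rewrite -mulrA ler_wpM2l ?ltW.
  have [N hN'] := hN (size s).
  exists (`|N| * 2 ^+ size s); first by rewrite mulr_ge0// exprn_ge0.
  move=> x y Ox x0 xy; have Oy := half_ball_sub Ox x0 xy.
  have /andP[h1 h2] := half_ball_bdist xy.
  have y0 : 0 < bdist y by apply: lt_trans h1; rewrite divr_gt0.
  have := hN' (i :: s) y erefl (boundary_open Oy); rewrite -/(bdist y) normrM => h.
  have dy0 : 0 < bdist y ^+ size s by rewrite exprn_gt0.
  rewrite (ger0_norm (ltW dy0)) mulrC -ler_pdivlMr// in h; apply: le_trans h _.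
  apply: (@le_trans _ _ (`|N| / bdist y ^+ size s)).
    by rewrite ler_wpM2r ?invr_ge0 ?(ltW dy0)// ler_norm.
  rewrite -!mulrA ler_wpM2l// /= exprS invfM !mulrA mulfK ?gt_eqF//.
  rewrite -2!exprVn.
  have -> : 2 ^+ size s * (bdist x)^-1 ^+ size s = (bdist x / 2)^-1 ^+ size s.
    by rewrite invfM invrK mulrC exprMn.
  rewrite lerXn2r ?nnegrE ?invr_ge0 ?(ltW y0) ?divr_ge0 ?(ltW x0)//.
  by rewrite lef_pV2 ?posrE ?divr_gt0// ltW.
pose A := (d%:R + 1) * (C + c1).
have A0 : 0 < A by rewrite mulr_gt0 ?ltr_wpDl// ltr_pwDr.
have K1 : 1 <= 2 * A / c1.
  rewrite ler_pdivlMr// mul1r /A; apply: (@le_trans _ _ (C + c1)); first by rewrite lerDr.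
  rewrite mulrA ler_peMl ?addr_ge0 ?(ltW c10)// mulrDr mulr1 (le_trans (_ : _ <= 2))//.
    by rewrite ler1n.
  by rewrite lerDr mulr_ge0.
have [C' C'0 hC'] := holder_class_powR d delta k b K1.
exists (C' * A `^ b); first by rewrite mulr_ge0// powR_ge0.
move=> x Ox x0.
rewrite -mulrA -powRM ?(ltW A0) ?(ltW x0)//; apply: hC' => //.
- exact: half_ball_open.
- by rewrite mulr_gt0.
- move=> y xy; have Oy := half_ball_sub Ox x0 xy.
  have /andP[h1 _] := half_ball_bdist xy; have /andP[h _] := hc y (boundary_open Oy).
  apply: le_trans h; rewrite -/(bdist y).
  have -> : A * bdist x / (2 * A / c1) = c1 * (bdist x / 2) by field; rewrite !gt_eqF.
  by rewrite ler_wpM2l ?ltW.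
- rewrite /A -mulrA; apply: half_ball_smooth => //.
  + by apply: mulr_ge0; [apply: addr_ge0 => //; exact: ltW|exact: ltW].
  + apply: (@Ck_on_sub R d k.+1 (half_ball x) O); first by move=> y; exact: half_ball_sub.
    exact: psi_smooth_on.
  + move=> s y sk xy; apply: le_trans (hC s sk x y Ox x0 xy) _.
    rewrite ler_wpM2r ?invr_ge0 ?exprn_ge0 ?(ltW x0)// ler_wpM2r ?(ltW x0)// lerDl.
    exact: ltW.
Qed.

Hypothesis zeta_ge0 : forall n x, 0 <= zeta n x.
Variable c : R.
Hypothesis c_gt0 : 0 < c.
Hypothesis zeta_cover : forall x, O x ->
  (c%:E < \esum_(n in [set: int]) (zeta n x)%:E)%E.

Lemma bdist_gt0 x : O x -> 0 < bdist x.
Proof.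
move=> Ox.
have [[n zn]|h] := pselect (exists n, zeta n x != 0).
  have [_] := @zeta_supp n x (@subset_closure _ [set x | zeta n x != 0] x zn).
  by case/andP=> h _; apply: lt_trans h; rewrite mulr_gt0// expR_gt0.
have := zeta_cover Ox; rewrite (@esum_seq R [::])//= => [|n zn]; last by case: h; exists n.
by rewrite big_nil lte_fin ltNge ltW.
Qed.

Let L_gt0 : 0 < L%:R :> R.
Proof.
apply: lt_le_trans hL; rewrite ltr_pwDl// ln_ge0// ler_pdivlMr// mul1r.
by case/andP: k12 => _ h; rewrite (le_trans (ltW h))// ler_peMl ?(ltW k20)// ler1n.
Qed.

Let q := c / L%:R.
Let q_gt0 : 0 < q. Proof. by rewrite divr_gt0. Qed.

(** Squares, since each [zeta (- m)] is used twice: once in the localized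
    distribution, and once more to cut off the function that represents it, which is
    known to be regular on the whole space but not to vanish far away. *)
Definition square_sum (x : Rd) : R := \sum_(m <- active_window x) zeta (- m) x ^+ 2.

Lemma square_sum_local x y : O x -> half_ball x y ->
  square_sum y = \sum_(m <- active_window x) zeta (- m) y ^+ 2.
Proof.
move=> Ox xy; apply: active_window_sum => //; first exact: bdist_gt0.
by move=> m ->; rewrite expr0n.
Qed.

(** One of the [L] terms of the window is at least the average [c / L]. *)
Lemma square_sum_ge x : O x -> q ^+ 2 <= square_sum x.
Proof.
move=> Ox; have x0 := bdist_gt0 Ox.
have [m mW qm] : exists2 m, m \in active_window x & q < zeta (- m) x.
  apply: contrapT => h.
  have := zeta_cover Ox; rewrite (@esum_seq R [seq - m | m <- active_window x]).
  - rewrite lte_fin big_map ltNge => /negP; apply.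
    apply: (@le_trans _ _ (\sum_(m <- active_window x) q)).
      rewrite big_seq [leRHS]big_seq; apply: ler_sum => m mW.
      by rewrite leNgt; apply/negP => qm; apply: h; exists m.
    rewrite big_const_seq count_predT size_window iter_addr_0 -mulr_natl /q.
    by rewrite mulrC divfK// gt_eqF.
  - by rewrite map_inj_uniq; [exact: window_uniq|exact: oppr_inj].
  - by move=> n; exact: zeta_ge0.
  - move=> n zn; apply/mapP; exists (- n); last by rewrite opprK.
    by apply: (@mem_active_window x x) => //; [exact: half_ball_self|rewrite opprK].
rewrite /square_sum (bigD1_seq m)//=; last exact: window_uniq.
rewrite -[leLHS]addr0 lerD//; last by apply: sumr_ge0 => i _; exact: sqr_ge0.
by rewrite lerXn2r ?nnegrE ?(ltW q_gt0)// ltW.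
Qed.

Lemma square_sum_gt0 x : O x -> 0 < square_sum x.
Proof. by move=> Ox; apply: lt_le_trans (square_sum_ge Ox); rewrite exprn_gt0. Qed.

Lemma sum_window_cst x (a : R) : \sum_(m <- active_window x) a = L%:R * a.
Proof. by rewrite big_const_seq count_predT size_window iter_addr_0 mulr_natl. Qed.

Lemma square_sum_holder k : exists2 A, 0 <= A & forall x, O x -> hclass x k A square_sum.
Proof.
have [A A0 hA] := zeta_holder k.
exists (L%:R * (2 ^+ k.+1 * (A * A))); first by rewrite !mulr_ge0// exprn_ge0.
move=> x Ox; have x0 := bdist_gt0 Ox.
apply: (@holder_class_eq _ _ _ _ _ _ _
  (fun y => \sum_(m <- active_window x) zeta (- m) y * zeta (- m) y)).
- exact: half_ball_open.
- by move=> y xy; rewrite (square_sum_local Ox xy).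
- rewrite -(sum_window_cst x); apply: holder_class_sum => // [|m _]; first exact: half_ball_open.
  by apply: holder_classM => //; first exact: half_ball_open; exact: hA.
Qed.

Lemma square_sum_inv_holder k : exists2 A, 0 <= A &
  forall x, O x -> hclass x k A (fun y => (square_sum y)^-1).
Proof.
have [A A0 hA] := square_sum_holder k.
have q2 : 0 < q ^+ 2 by rewrite exprn_gt0.
pose B := A + q ^+ 2; have B0 : 0 < B by rewrite ltr_wpDl.
have K1 : 1 <= B / q ^+ 2 by rewrite ler_pdivlMr// mul1r lerDr.
have [C C0 hC] := holder_class_powR d delta k (-1) K1.
exists (C * B `^ (-1)); first by rewrite mulr_ge0// powR_ge0.
move=> x Ox; have x0 := bdist_gt0 Ox; have oU := @half_ball_open x.
apply: (@holder_class_eq _ _ _ _ _ _ _ (fun y => square_sum y `^ (-1))) => //.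
  by move=> y xy; rewrite powR_inv1// ltW// square_sum_gt0//; exact: half_ball_sub xy.
apply: hC => //.
- move=> y xy; have Oy : O y by exact: half_ball_sub xy.
  by rewrite invfM invrK mulrA mulfV ?gt_eqF// mul1r square_sum_ge.
- by apply: holder_class_le (hA x Ox) => //; rewrite lerDl ltW.
Qed.

(** Multiplied by [zeta (- m)] and summed over [m], these weights give [psi `^ b]. *)
Definition gluing_weight (b : R) (m : int) (y : Rd) : R :=
  zeta (- m) y * psi y `^ b / square_sum y.

Lemma gluing_weight_holder k b : exists2 A, 0 <= A & forall x m, O x ->
  hclass x k (A * bdist x `^ b) (gluing_weight b m).
Proof.
have [A1 A10 h1] := zeta_holder k; have [A2 A20 h2] := psi_powR_holder k b.
have [A3 A30 h3] := square_sum_inv_holder k.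
exists (2 ^+ k.+1 * (2 ^+ k.+1 * (A1 * A2) * A3)).
  by rewrite !mulr_ge0// exprn_ge0.
move=> x m Ox; have x0 := bdist_gt0 Ox; have oU := @half_ball_open x.
have p0 : 0 <= A2 * bdist x `^ b by rewrite mulr_ge0// powR_ge0.
have h12 := holder_classM oU x0 A10 p0 (h1 x m x0) (h2 x Ox x0).
have q0 : 0 <= 2 ^+ k.+1 * (A1 * (A2 * bdist x `^ b)).
  by rewrite mulr_ge0 ?exprn_ge0// mulr_ge0.
have h := holder_classM oU x0 q0 A30 h12 (h3 x Ox).
by apply: holder_class_le h => //; rewrite le_eqVlt; apply/orP; left; apply/eqP; ring.
Qed.

(** The derivatives of the dilated function carry powers of [e^(-m)], which is at
    most [2 * k2 / bdist x]. *)
Lemma dilation_holder k x m (g : Rd -> R) (M : R) : 0 < bdist x -> 0 <= M ->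
  bdist x / (2 * k2) < expR m%:~R -> Ck_on k setT g ->
  (forall s y, (size s <= k)%N -> `|partials s g y| <= M) ->
  (forall s y z, (size s <= k)%N ->
     `|partials s g y - partials s g z| <= M * enorm (y - z) `^ delta) ->
  hclass x k ((1 + 2 * k2) ^+ k.+1 * M) (fun y => g (expR (- m%:~R) *: y)).
Proof.
move=> x0 M0 xm cg g1 g2; case/andP: delta01 => d0 d1.
set a := expR (- m%:~R); have a0 : 0 < a by exact: expR_gt0.
set r := bdist x in x0 xm *.
have r1 : 0 < r^-1 by rewrite invr_gt0.
have K0 : 0 <= 2 * k2 by rewrite mulr_ge0 ?(ltW k20).
have ar : a <= 2 * k2 * r^-1.
  rewrite /a expRN -[leRHS]invrK lef_pV2 ?posrE ?expR_gt0//.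
    by rewrite invfM invrK mulrC ltW.
  by rewrite invr_gt0 mulr_gt0// mulr_gt0.
have as_ (s : nat) : a ^+ s <= (2 * k2) ^+ s * r ^- s.
  by rewrite -exprVn -exprMn lerXn2r ?nnegrE ?(ltW a0)// mulr_ge0 ?(ltW r1).
have K1 : 1 <= 1 + 2 * k2 by rewrite lerDl.
have Ks (s : nat) : (s <= k)%N -> (2 * k2) ^+ s <= (1 + 2 * k2) ^+ k.
  move=> sk; apply: (@le_trans _ _ ((1 + 2 * k2) ^+ s)).
    by rewrite lerXn2r ?nnegrE// ?lerDr// addr_ge0.
  by rewrite ler_weXn2l.
have Kd : (2 * k2) `^ delta <= 1 + 2 * k2.
  apply: (@le_trans _ _ ((1 + 2 * k2) `^ delta)).
    by apply: ge0_ler_powR; rewrite ?(ltW d0)// ?nnegrE ?lerDr// addr_ge0.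
  by apply: ler1_powR => //; exact: ltW.
have rs (s : nat) : 0 <= r ^- s by rewrite invr_ge0 exprn_ge0// ltW.
split.
  by apply: (@Ck_on_scale _ _ _ _ setT) => //; exact: half_ball_open.
move=> s sk; rewrite (partials_scale a cg sk); split=> [y xy|y z xy xz].
  rewrite normrM ger0_norm ?exprn_ge0 ?(ltW a0)// exprS.
  apply: (@le_trans _ _ ((2 * k2) ^+ size s * r ^- size s * M)).
    by rewrite ler_pM ?exprn_ge0 ?(ltW a0)// g1.
  rewrite [leLHS]mulrAC ler_wpM2r// ler_wpM2r//.
  by rewrite (le_trans (Ks _ sk))// ler_peMl// exprn_ge0// addr_ge0.
rewrite -mulrBr normrM ger0_norm ?exprn_ge0 ?(ltW a0)//.
apply: (@le_trans _ _ (((2 * k2) ^+ size s * r ^- size s) *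
   (M * ((2 * k2) `^ delta * (enorm (y - z) / r) `^ delta)))).
  rewrite ler_pM ?exprn_ge0 ?(ltW a0)// (le_trans (g2 s _ _ sk))// ler_wpM2l//.
  rewrite -scalerBr enormZ (gtr0_norm a0) -powRM ?divr_ge0 ?enorm_ge0 ?(ltW x0)//.
  apply: ge0_ler_powR; first exact: ltW.
  - by rewrite nnegrE mulr_ge0 ?enorm_ge0 ?(ltW a0).
  - by rewrite nnegrE mulr_ge0 ?divr_ge0 ?enorm_ge0 ?(ltW x0).
  - by rewrite [leRHS]mulrA [leRHS]mulrAC ler_wpM2r ?enorm_ge0.
set E := (_ / _) `^ delta; set P := r ^- _.
have -> : (2 * k2) ^+ size s * P * (M * ((2 * k2) `^ delta * E)) =
  ((2 * k2) `^ delta * (2 * k2) ^+ size s) * (M * P * E) by ring.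
apply: (@le_trans _ _ ((1 + 2 * k2) * (1 + 2 * k2) ^+ k * (M * P * E))); last first.
  by apply: le_of_eq; rewrite exprS; ring.
rewrite ler_wpM2r//; first by apply: mulr_ge0; [apply: mulr_ge0 => //; exact: rs|exact: powR_ge0].
by apply: ler_pM; rewrite ?powR_ge0 ?exprn_ge0// Ks.
Qed.

Definition glue (b : R) (g : int -> Rd -> R) (y : Rd) : R :=
  \sum_(m <- active_window y) g m (expR (- m%:~R) *: y) * gluing_weight b m y.

(** Bounds for [g m] are required for the [m] that are active near [x] only; the
    other terms vanish on the ball. *)
Lemma glue_holder k b : exists2 C, 0 <= C & forall g M x, O x -> 0 <= M ->
  (forall m, bdist x / (2 * k2) < expR m%:~R < (3 * k2 / k1) * (bdist x / (2 * k2)) ->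
     [/\ Ck_on k setT (g m),
      forall s y, (size s <= k)%N -> `|partials s (g m) y| <= M &
      forall s y z, (size s <= k)%N ->
        `|partials s (g m) y - partials s (g m) z| <= M * enorm (y - z) `^ delta]) ->
  hclass x k (C * M * bdist x `^ b) (glue b g).
Proof.
have [A A0 hA] := gluing_weight_holder k b.
pose B := (1 + 2 * k2) ^+ k.+1.
have B0 : 0 <= B by rewrite exprn_ge0// addr_ge0// mulr_ge0// ltW.
exists (L%:R * (2 ^+ k.+1 * (B * A))); first by rewrite !mulr_ge0// exprn_ge0.
move=> g M x Ox M0 hg; have x0 := bdist_gt0 Ox; have oU := @half_ball_open x.
apply: (@holder_class_eq _ _ _ _ _ _ _ (fun y => \sum_(m <- active_window x)
   g m (expR (- m%:~R) *: y) * gluing_weight b m y)) => //.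
  move=> y xy; rewrite -(@active_window_sum x y)// => m zm.
  by rewrite /gluing_weight zm !mul0r mulr0.
have D0 : 0 <= A * bdist x `^ b by rewrite mulr_ge0// powR_ge0.
have E0 : 0 <= B * M by rewrite mulr_ge0.
have -> : L%:R * (2 ^+ k.+1 * (B * A)) * M * bdist x `^ b =
  L%:R * (2 ^+ k.+1 * (B * M * (A * bdist x `^ b))) by ring.
rewrite -(sum_window_cst x); apply: holder_class_sum => // m _.
have [[y xy zy]|h] := pselect (exists2 y, half_ball x y & zeta (- m) y != 0).
  have act := zeta_active x0 xy zy; have [g0 g1 g2] := hg m act.
  apply: holder_classM => //; last exact: hA.
  by apply: dilation_holder => //; case/andP: act.
apply: (@holder_class_eq _ _ _ _ _ _ _ (fun=> 0)) => //.
  move=> y xy; rewrite /gluing_weight.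
  have -> : zeta (- m) y = 0 by apply: contrapT => /eqP zy; apply: h; exists y.
  by rewrite !mul0r mulr0.
apply: (holder_class_le x0 (leqnn k) _ (holder_class_cst _ _ k 0 x0)).
by rewrite normr0 mulr_ge0 ?exprn_ge0// mulr_ge0.
Qed.

Lemma gluing_weight_smooth b m : smooth_on O (gluing_weight b m).
Proof.
move=> k s sk x Ox; have [A _ hA] := gluing_weight_holder k b.
exact: (hA x m Ox).1 s sk x (half_ball_self (bdist_gt0 Ox)).
Qed.

Lemma psi_powR_smooth b : smooth_on O (fun y => psi y `^ b).
Proof.
move=> k; apply: Ck_on_powR => // [x Ox|]; last exact: psi_smooth_on.
by apply: psi_gt0 => //; exact: bdist_gt0.
Qed.

(** Finitely many of the balls cover [K], and each of them has a finite window. *)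
Lemma compact_window (K : set Rd) : compact K -> K `<=` O ->
  exists2 s : seq int, uniq s & forall y m, K y -> zeta (- m) y != 0 -> m \in s.
Proof.
move=> cK KO; move: (cK); rewrite compact_cover => /(_ Rd K half_ball)[|y Ky|D DK KD].
- by move=> x _; exact: half_ball_open.
- by exists y => //; exact/half_ball_self/bdist_gt0/KO.
exists (undup (flatten [seq active_window x | x <- finmap.enum_fset D])).
  exact: undup_uniq.
move=> y m Ky zy; rewrite mem_undup; apply/flattenP.
have [x xD xy] := KD y Ky; exists (active_window x); first exact: map_f.
apply: (mem_active_window _ xy zy); apply: bdist_gt0; apply: KO.
by have := DK x xD; rewrite inE.
Qed.

(** Writes a test function as a finite sum of products with [zeta (- m)]; on each
    of them [u] acts through a localized distribution, evaluated at a dilated test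
    function. *)
Lemma glue_regular (a : R) u (g : int -> Rd -> R) (B : int -> R) : linear_on O u ->
  (forall m, continuous (g m)) -> (forall m x, `|g m x| <= B m) ->
  (forall m phi, test_function setT phi ->
     localize zeta (psi_mul psi a u) m phi = regular (g m) phi) ->
  eq_on O u (regular (glue (- a) g)).
Proof.
move=> lu cg gB hloc eta teta; have [seta [K [cK KO K0]]] := teta.
have [s us hs] := compact_window cK KO.
pose G m y := g m (expR (- m%:~R) *: y).
pose w m y := gluing_weight (- a) m y * eta y.
have tw m : test_function O (w m).
  by apply: test_function_mul => //; exact: gluing_weight_smooth.
have twT m := test_function_sub (tw m).
have a0 (m : int) : 0 < expR m%:~R :> R by exact: expR_gt0.
have cG m : continuous (G m).
  move=> x; apply: (@continuous_comp _ _ _ (fun y : Rd => expR (- m%:~R) *: y) (g m)); last exact: cg.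
  exact: scaler_continuous.
have GB m x : `|G m x| <= B m by exact: gB.
have piece m : u (fun x => psi x `^ a * (zeta (- m) x * w m x)) = regular (G m) (w m).
  have := hloc m _ (test_function_dilation (a0 m) (twT m)).
  rewrite (regular_dilation (a0 m) (cg m) (gB m) (twT m)) -expRN -/(G m).
  rewrite /localize /psi_mul.
  have -> : (fun x => psi x `^ a * (zeta (- m) x * w m (expR m%:~R *: (expR (- m%:~R) *: x)))) =
    (fun x => psi x `^ a * (zeta (- m) x * w m x)).
    by apply/funext => x; rewrite scalerA -expRD subrr expR0 scale1r.
  have -> : expR (- (m%:~R * d%:R)) = expR m%:~R ^- d :> R.
    by rewrite expRN mulrC expRM_natl.
  by apply: mulfI; rewrite invr_neq0// expf_neq0// gt_eqF.
have partition : eta = (fun x => \sum_(m <- s) psi x `^ a * (zeta (- m) x * w m x)).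
  apply/funext => x; have [Kx|nKx] := pselect (K x); last first.
    by rewrite K0// big1// => m _; rewrite /w K0// !mulr0.
  have Ox := KO x Kx; have x0 := bdist_gt0 Ox; have p0 := psi_gt0 Ox x0.
  have S0 := square_sum_gt0 Ox.
  rewrite -[LHS]mul1r -(mulfV (lt0r_neq0 S0)) [X in X / _]/square_sum -!mulrA mulr_suml.
  rewrite (@big_uniq_support _ _ (active_window x) s)//; [|exact: window_uniq|].
    apply: eq_bigr => m _; rewrite /w /gluing_weight powRN.
    by field; rewrite !gt_eqF ?powR_gt0.
  move=> m hm; have zm : zeta (- m) x != 0.
    by apply: contra_neq hm => ->; rewrite expr0n mul0r.
  by rewrite (mem_active_window x0 (half_ball_self x0) zm) (hs x m Kx zm).
rewrite {1}partition (linear_on_sum s lu); last first.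
  move=> m; apply: test_function_mul => //; first exact: psi_powR_smooth.
  by apply: test_function_mul => // k; apply: (@Ck_on_sub R d k O setT) => //; exact: zeta_smooth.
under eq_bigr do rewrite piece.
have iG m : (@tuple_lebesgue R d).-integrable setT
    (EFin \o (fun t => G m (row_of_tuple t) * w m (row_of_tuple t))).
  exact: (integrable_regular (cG m) (GB m) (twT m)).
rewrite /regular; under eq_bigr do rewrite integral_onT.
rewrite integral_onT -(Rintegral_sum s iG).2; apply: eq_Rintegral => t _.
set x := row_of_tuple t; have [Kx|nKx] := pselect (K x); last first.
  by rewrite K0// mulr0 big1// => m _; rewrite /w K0// !mulr0.
have Ox := KO x Kx; have x0 := bdist_gt0 Ox.
rewrite /glue mulr_suml (@big_uniq_support _ _ (active_window x) s)//; [|exact: window_uniq|].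
  by apply: eq_bigr => m _; rewrite /w mulrA.
move=> m hm; have zm : zeta (- m) x != 0.
  by apply: contra_neq hm => zm; rewrite /gluing_weight zm !mul0r mulr0 mul0r.
by rewrite (mem_active_window x0 (half_ball_self x0) zm) (hs x m Kx zm).
Qed.

End geometry.

(** * Distributions of finite weighted norm *)

Lemma esum_ge_term (R : realType) (a : int -> \bar R) m :
  (forall n, 0 <= a n)%E -> (a m <= \esum_(n in [set: int]) a n)%E.
Proof.
move=> a0; apply: esum_ge; exists [set m]; first by split => //; exact: finite_set1.
by rewrite fsbig_set1.
Qed.

Section gluing.
Context (R : realType) (d : nat).
Local Notation Rd := 'rV[R]_d.

(** Each term of a series of nonnegative terms is at most its sum. *)
Lemma H_norm_le_weighted_norm (zeta : int -> Rd -> R) (g p theta : R)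
    (u : (Rd -> R) -> R) (m : int) : 0 < p ->
  (weighted_norm zeta g p theta 0 u < +oo)%E ->
  (H_norm g p (localize zeta u m) <=
   (fine (weighted_norm zeta g p theta 0 u) * expR m%:~R `^ (- (theta / p)))%:E)%E.
Proof.
move=> p0; rewrite /weighted_norm; set F := fun n : int => _.
set E := (\esum_(n in _) F n)%E => Wfin.
have F0 n : (0 <= F n)%E by rewrite mule_ge0 ?poweR_ge0// lee_fin mulr_ge0 ?expR_ge0 ?powR_ge0.
have E0 : (0 <= E)%E by exact: esum_ge0.
have Efin : E \is a fin_num by rewrite ge0_fin_numE//; apply: lty_poweRy Wfin; rewrite invr_neq0 ?gt_eqF.
have [e eE] : exists e, E = e%:E by exists (fine E); rewrite fineK.
have e0 : 0 <= e by rewrite -lee_fin -eE.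
have := esum_ge_term m F0; rewrite -/E eE /F powRr0 mulr1 => hm.
have k0 : 0 < expR (m%:~R * theta) :> R by exact: expR_gt0.
move: hm; set H := H_norm _ _ _ => hm.
have H0 : (0 <= H)%E by exact: H_norm_ge0.
have Hfin : H \is a fin_num.
  rewrite ge0_fin_numE//; apply: (@lty_poweRy _ _ p); first by rewrite gt_eqF.
  rewrite ltey; apply/eqP => Hoo; by move: hm; rewrite Hoo gt0_muley ?lte_fin// leye_eq.
have [h hE] : exists h, H = h%:E by exists (fine H); rewrite fineK.
have h0 : 0 <= h by rewrite -lee_fin -hE.
rewrite poweR_EFin /= hE lee_fin; move: hm; rewrite hE poweR_EFin -EFinM lee_fin => hm.
have hp : h `^ p <= e * expR (- (m%:~R * theta)).
  by rewrite expRN ler_pdivlMr// mulrC.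
have : (h `^ p) `^ p^-1 <= (e * expR (- (m%:~R * theta))) `^ p^-1.
  by apply: ge0_ler_powR => //; rewrite ?invr_ge0 ?(ltW p0) ?nnegrE ?powR_ge0// mulr_ge0 ?expR_ge0.
rewrite -powRrM mulfV ?gt_eqF// powRr1// powRM ?expR_ge0//.
by rewrite -!expRM mulrN mulNr mulrA.
Qed.

(** Near [x] only the indices [m] with [e^m] comparable to [bdist x] matter, and
    there [e^(- m theta / p)] is comparable to [bdist x `^ (- theta / p)]. *)
Theorem gluing (O : set Rd) (zeta : int -> Rd -> R) (psi : Rd -> R)
    (p g theta a delta : R) (n : nat) : open O -> weight_family O O zeta ->
  regularized_distance O psi -> 1 < p -> 0 < delta < 1 ->
  n%:R + delta <= g - d%:R / p ->
  exists2 C, 0 <= C & forall u, linear_on O u ->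
    let W := weighted_norm zeta g p theta 0 (psi_mul psi a u) in (W < +oo)%E ->
    exists v : Rd -> R, eq_on O u (regular v) /\
    forall x, O x -> 0 < bdist O x /\
      holder_class delta (half_ball O x) (bdist O x) n
        (C * fine W * bdist O x `^ (- a - theta / p)) v.
Proof.
move=> oO [zge0 zs [k1 [k2 [k10 k12 zsupp]]] zb [c [c0 zc]]] hpsi p1 d01 hn.
have p0 : 0 < p by exact: lt_trans p1.
have kk : 0 < k1 < k2 by rewrite k10.
have k20 : 0 < k2 by exact: lt_trans k12.
(* The ratio of the two ends of the range in [zeta_active] is [3 * k2 / k1]; in
   the logarithmic scale, [L] consecutive integers cover such a range. *)
have [L hL] : exists L : nat, 1 + ln (3 * k2 / k1) <= L%:R :> R.
  by exists (Num.truncn (1 + ln (3 * k2 / k1))).+1; apply/ltW/Num.Theory.truncnS_gt.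
have [C0 C00 sob] := sobolev_embedding p1 d01 hn.
have [C1 C10 hglue] := glue_holder oO d01 kk zs zsupp zb hL hpsi zge0 c0 zc n (- a).
pose q := 3 * k2 / k1; pose tau := - (theta / p).
have q1 : 1 <= q.
  by rewrite ler_pdivlMr// mul1r (le_trans (ltW k12))// ler_peMl ?(ltW k20)// ler1n.
pose D := q `^ `|tau| * (q / (2 * k2)) `^ tau.
have D0 : 0 <= D by rewrite mulr_ge0// powR_ge0.
exists (C1 * (C0 * D)); first by apply: mulr_ge0 => //; exact: mulr_ge0.
move=> u lu W Wfin.
have hH m := H_norm_le_weighted_norm m p0 Wfin.
have /choice[G hG] : forall m, exists v : Rd -> R,
    [/\ forall phi, test_function setT phi ->
          localize zeta (psi_mul psi a u) m phi = regular v phi,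
      Ck_on n setT v,
      forall s y, (size s <= n)%N -> `|partials s v y| <=
         C0 * fine (H_norm g p (localize zeta (psi_mul psi a u) m)) &
      forall s y z, (size s <= n)%N ->
        `|partials s v y - partials s v z| <=
        C0 * fine (H_norm g p (localize zeta (psi_mul psi a u) m)) * enorm (y - z) `^ delta].
  by move=> m; apply: sob; apply: le_lt_trans (hH m) _; exact: ltry.
exists (glue O zeta k2 L psi (- a) G); split.
  apply: (glue_regular oO d01 kk zs zsupp zb hL hpsi zge0 c0 zc (B := fun m =>
     C0 * fine (H_norm g p (localize zeta (psi_mul psi a u) m)))) => //.
  - by move=> m x; have [_ cm _ _] := hG m; exact: (Ck_on_continuous cm).
  - by move=> m x; have [_ _ /(_ [::] x isT)] := hG m.
  - by move=> m phi tphi; have [->] := hG m.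
move=> x Ox; have x0 := bdist_gt0 kk zsupp zge0 c0 zc Ox; split=> //.
have W0 : 0 <= fine W by rewrite fine_ge0// poweR_ge0.
pose lo := bdist O x / (2 * k2).
have lo0 : 0 < lo by rewrite divr_gt0// mulr_gt0.
pose M := C0 * (fine W * (q `^ `|tau| * (q * lo) `^ tau)).
have M0 : 0 <= M by rewrite !mulr_ge0// powR_ge0.
have -> : C1 * (C0 * D) * fine W * bdist O x `^ (- a - theta / p) =
    C1 * M * bdist O x `^ (- a).
  rewrite powRD ?(gt_eqF x0) ?implybT// /M /D -/tau.
  have -> : q * lo = q / (2 * k2) * bdist O x by rewrite /lo; field; rewrite !gt_eqF.
  have A20 : 0 <= q / (2 * k2).
    by rewrite divr_ge0 ?(le_trans _ q1)// mulr_ge0 ?(ltW k20).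
  rewrite (powRM tau A20 (ltW x0)); ring.
apply: hglue => // m act; have [_ g1 g2 g3] := hG m.
have HM : C0 * fine (H_norm g p (localize zeta (psi_mul psi a u) m)) <= M.
  rewrite ler_wpM2l//.
  apply: (@le_trans _ _ (fine W * expR m%:~R `^ tau)).
    have Hm := hH m; rewrite -lee_fin fineK//.
    by rewrite ge0_fin_numE ?H_norm_ge0// (le_lt_trans Hm)// ltry.
  rewrite ler_wpM2l//; apply: powR_pinch => //; first by rewrite mulr_gt0// (lt_le_trans _ q1).
  rewrite mulrC mulKf; last by rewrite gt_eqF// (lt_le_trans _ q1).
  by case/andP: act => h1 h2; rewrite !ltW.
split=> // [s y sn|s y z sn]; first exact: le_trans (g2 s y sn) HM.
by apply: le_trans (g3 s y z sn) _; rewrite ler_wpM2r ?powR_ge0.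
Qed.

End gluing.

(** * The restriction of an element of the extension space *)

Section pairings.
Context (R : realType) (d : nat).
Local Notation Rd := 'rV[R]_d.

Lemma H_norm_eq0 (g p : R) (T : (Rd -> R) -> R) : 0 < p ->
  (forall phi, test_function setT phi -> T phi = 0) -> H_norm g p T = 0%E.
Proof.
move=> p0 T0; apply/eqP; rewrite eq_le H_norm_ge0 andbT.
have N0 : Lp_norm p (fun _ : Rd => 0 : R) = 0%E.
  have pE : p%:E != 0%E by rewrite eqe gt_eqF.
  exact: (@Lnorm0 _ _ R (@tuple_lebesgue R d) p%:E pE).
apply: ereal_inf_lbound; exists (fun=> 0) => //; split.
  by split; [exact: measurable_cst|rewrite N0].
move=> phi tphi; rewrite T0// integral_onT.
by under eq_Rintegral do rewrite mul0r; rewrite Rintegral_cst// mul0r.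
Qed.

Lemma weighted_norm_eq0 (zeta : int -> Rd -> R) (g p theta sigma : R)
    (u : (Rd -> R) -> R) : 0 < p ->
  (forall m phi, test_function setT phi -> localize zeta u m phi = 0) ->
  weighted_norm zeta g p theta sigma u = 0%E.
Proof.
move=> p0 h0; rewrite /weighted_norm esum1 ?poweR0r ?invr_neq0 ?gt_eqF//.
move=> m _; rewrite (H_norm_eq0 _ p0); last exact: h0.
by rewrite poweR0r ?gt_eqF// mule0.
Qed.

(** The constant sequence [phi] tends to [Phi] in the dual space as soon as [phi] and
    [Phi] agree where the weights do not vanish. *)
Lemma dual_pairing_eq (U : set Rd) (zeta : int -> Rd -> R)
    (g p theta sigma : R) (u : (Rd -> R) -> R) (Phi phi : Rd -> R) (l : R) :
  1 < p -> test_function U phi ->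
  (forall m y, zeta m y * (phi y - Phi y) = 0) ->
  dual_pairing U zeta g p theta sigma u Phi l -> l = u phi.
Proof.
move=> p1 tphi z0 [_ _ hl].
have p0 : 0 < p / (p - 1) by rewrite divr_gt0 ?subr_gt0// (lt_trans _ p1).
apply/esym; apply: (@cvg_unique _ (@norm_hausdorff R R) (u phi @[k --> \oo])); first exact: cvg_cst.
apply: (hl (fun=> phi)); split=> //.
rewrite weighted_norm_eq0//; first exact: cvg_cst.
move=> m eta _; rewrite /localize /regular integral_onT.
under eq_Rintegral do rewrite mulrA [_ * zeta _ _]mulrC z0 mul0r.
by rewrite Rintegral_cst// mul0r mulr0.
Qed.

(** A test function of [O] is its own approximation in the interior pairing, and is
    approximated by [0] in the exterior one. *)
Lemma extension_space_restriction (O : set Rd) (zetaO zetaC : int -> Rd -> R)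
    (alpha gamma lambda p theta sigma : R) (u : (Rd -> R) -> R) : 1 < p ->
  (forall m x, O x -> zetaC m x = 0) ->
  extension_space O zetaO zetaC alpha gamma lambda p theta sigma u ->
  exists2 v, weighted_space O zetaO (gamma + alpha) p (theta - alpha * p / 2) 0 v &
    eq_on O u v.
Proof.
move=> p1 zC [_ [v [w [hv [[lw _] _] huvw]]]]; exists v => // eta teta.
have [a [b [ha hb ->]]] := huvw eta (test_function_sub teta).
rewrite (dual_pairing_eq p1 teta _ ha); last by move=> m y; rewrite subrr mulr0.
rewrite (dual_pairing_eq p1 (@test_function0 R d _) _ hb); last first.
  move=> m y; have [_ [K [_ KO K0]]] := teta.
  have [Ky|/K0 ->] := pselect (K y); last by rewrite subrr mulr0.
  by rewrite zC ?mul0r//; exact: KO.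
by rewrite (linear_on0 lw) addr0.
Qed.

End pairings.

Lemma open_half_space (R : realType) (d : nat) (d_gt0 : (0 < d)%N) :
  open (@half_space R d d_gt0).
Proof.
rewrite /half_space; apply: (@open_comp _ _ (fun x : 'rV[R]_d => x 0 (Ordinal d_gt0)) [set t | 0 < t]).
  by move=> x _; exact: coord_continuous.
exact: open_gt.
Qed.

(** * The weighted estimate *)

Section weighted_bounds.
Context (R : realType) (d : nat) (O : set 'rV[R]_d) (oO : open O).
Local Notation Rd := 'rV[R]_d.
Variables (psi : Rd -> R) (hpsi : regularized_distance O psi).
Variables (delta : R) (delta01 : 0 < delta < 1).
Local Notation r := (bdist O).
Local Notation hclass x := (holder_class delta (half_ball O x) (bdist O x)).

Lemma max_partials_le (k : nat) (F : seq 'I_d -> \bar R) (c : R) : 0 <= c ->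
  (forall s, size s = k -> (F s <= c%:E)%E) -> (max_partials k F <= c%:E)%E.
Proof.
move=> c0 hF; rewrite /max_partials; apply/bigmax_leP; split; first by rewrite lee_fin.
by move=> s _; apply: hF; rewrite size_tuple.
Qed.

(** If neither point lies in the ball of the other, both distances to the boundary
    are at most twice the distance of the points, and the bound for the values
    suffices; it enters for both points, each time with [2 `^ delta <= 2]. *)
Lemma half_ball_holder_seminorm (F : Rd -> R) (c : R) : 0 <= c ->
  (forall x, O x -> 0 < r x) ->
  (forall x, O x -> `|F x| <= c * r x `^ delta) ->
  (forall x y, O x -> half_ball O x y -> `|F x - F y| <= c * enorm (x - y) `^ delta) ->
  (holder_seminorm O delta F <= (4 * c)%:E)%E.
Proof.
move=> c0 rpos F1 F2; apply: ge_ereal_sup => _ [[x y] /= [Ox Oy xy] <-].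
have e0 : 0 < enorm (x - y).
  by rewrite lt_neqAle enorm_ge0 andbT eq_sym; apply/eqP => /enorm_eq0/eqP; rewrite subr_eq0 => /eqP.
case/andP: delta01 => d0 d1.
rewrite lee_fin ler_pdivrMr ?powR_gt0//.
have e1 : 0 <= enorm (x - y) `^ delta by rewrite powR_ge0.
have [hxy|hxy] := ltP (enorm (x - y)) (r x / 2).
  rewrite (le_trans (F2 x y Ox hxy))// ler_wpM2r// ler_peMl// ler1n//.
have [hyx|hyx] := ltP (enorm (y - x)) (r y / 2).
  rewrite distrC (le_trans (F2 y x Oy hyx))// enormB ler_wpM2r// ?enormB// ler_peMl// ler1n//.
have big z : O z -> r z / 2 <= enorm (x - y) -> `|F z| <= 2 * c * enorm (x - y) `^ delta.
  move=> Oz hz; apply: le_trans (F1 z Oz) _; rewrite [2 * c]mulrC -mulrA ler_wpM2l//.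
  apply: (@le_trans _ _ ((2 * enorm (x - y)) `^ delta)).
    apply: ge0_ler_powR; rewrite ?(ltW d0) ?nnegrE ?(ltW (rpos z Oz)) ?mulr_ge0 ?enorm_ge0//.
    by rewrite mulrC -ler_pdivrMr.
  rewrite powRM ?enorm_ge0// ler_wpM2r//.
  by apply: ler1_powR; rewrite ?ler1n// ltW.
apply: le_trans (ler_normB _ _) _.
have -> : 4 * c * enorm (x - y) `^ delta =
  2 * c * enorm (x - y) `^ delta + 2 * c * enorm (x - y) `^ delta by ring.
by rewrite lerD// big// [enorm (x - y)]enormB.
Qed.

(** At [x], the power of [psi] is of size [bdist x `^ (k + e)] and the derivatives of
    order [k] of [v] are of size [bdist x `^ (- e - k)]. The additional [delta] in the
    Hoelder seminorm makes up for increments being measured in units of [bdist x]. *)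
Lemma weighted_bounds (n : nat) (e : R) : exists2 N, 0 <= N & forall (v : Rd -> R) (A : R),
  0 <= A -> (forall x, O x -> 0 < r x /\ hclass x n (A * r x `^ (- e)) v) ->
  (\sum_(0 <= k < n.+1)
      max_partials k (fun s => sup_norm O (fun x =>
        (psi x `^ (k%:R + e) * partials s v x)%R))
   + max_partials n (fun s => holder_seminorm O delta (fun x =>
        (psi x `^ (n%:R + delta + e) * partials s v x)%R))
   <= (N * A)%:E)%E.
Proof.
have /choice[B hB] : forall k : nat, exists B, 0 <= B /\ forall x, O x -> 0 < r x ->
    hclass x 0 (B * r x `^ (k%:R + e)) (fun y => psi y `^ (k%:R + e)).
  move=> k; have [B B0 h] := psi_powR_holder oO delta01 hpsi 0 (k%:R + e).
  by exists B.
have [B' B'0 hB'] := psi_powR_holder oO delta01 hpsi 0 (n%:R + delta + e).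
case/andP: (delta01) => d0 d1.
exists (\sum_(0 <= k < n.+1) B k + 4 * (2 * B')).
  by rewrite addr_ge0 ?mulr_ge0// sumr_ge0// => k _; exact: (hB k).1.
move=> v A A0 hv.
have vs s x : (size s <= n)%N -> O x ->
    [/\ 0 < r x, Ck_on 0 (half_ball O x) (partials s v),
     forall y, half_ball O x y -> `|partials s v y| <= A * r x `^ (- e) * r x ^- size s &
     forall y z, half_ball O x y -> half_ball O x z ->
       `|partials s v y - partials s v z| <=
       A * r x `^ (- e) * r x ^- size s * (enorm (y - z) / r x) `^ delta].
  move=> sn Ox; have [x0 [cv bv]] := hv x Ox; have [b1 b2] := bv s sn; split => //.
  by apply: (@Ck_onW _ _ (n - size s)) => //; exact: Ck_on_partials.
have rmerge x (b : R) (k : nat) : 0 < r x ->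
    r x `^ (k%:R + b + e) * (r x `^ (- e) * r x ^- k) = r x `^ b.
  move=> x0; rewrite mulrA -powRD; last by rewrite (gt_eqF x0) implybT.
  rewrite (_ : _ + _ + _ + _ = b + k%:R); last by ring.
  rewrite powRD; last by rewrite (gt_eqF x0) implybT.
  by rewrite powR_mulrn ?(ltW x0)// mulfK// expf_neq0// gt_eqF.
rewrite mulrDl EFinD; apply: leeD.
  rewrite mulr_suml -sumEFin; rewrite big_nat_cond [leRHS]big_nat_cond.
  apply: lee_sum => k /andP[/andP[_ kn] _].
  have [Bk0 hBk] := hB k.
  apply: max_partials_le => [|s sk]; first exact: mulr_ge0.
  have sn : (size s <= n)%N by rewrite sk -ltnS.
  apply: ge_ereal_sup => _ [x Ox <-]; have [x0 _ v1 _] := vs s x sn Ox.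
  have xx := half_ball_self x0; have [p1 _] := holder_class_bounds (hBk x Ox x0).
  rewrite lee_fin normrM; apply: le_trans (ler_pM _ _ (p1 x xx) (v1 x xx)) _ => //.
  have := rmerge x 0 k x0; rewrite addr0 powRr0 sk.
  set a := r x `^ (- e); set b := r x ^- k => ab.
  have -> : B k * r x `^ (k%:R + e) * (A * a * b) =
    B k * A * (r x `^ (k%:R + e) * (a * b)) by ring.
  by rewrite ab mulr1.
apply: (@le_trans _ _ (4 * (2 * (B' * A)))%:E); last by rewrite lee_fin le_eqVlt; apply/orP; left; apply/eqP; ring.
apply: max_partials_le; first by rewrite !mulr_ge0.
move=> s sn; have sn' : (size s <= n)%N by rewrite sn.
apply: half_ball_holder_seminorm; first by rewrite !mulr_ge0.
- by move=> x Ox; have [] := hv x Ox.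
- move=> x Ox; have [x0 _ v1 _] := vs s x sn' Ox.
  have [p1 _] := holder_class_bounds (hB' x Ox x0).
  have xx := half_ball_self x0.
  rewrite normrM; apply: le_trans (ler_pM _ _ (p1 x xx) (v1 x xx)) _ => //.
  rewrite sn; set a := r x `^ (- e); set b := r x ^- n.
  have -> : B' * r x `^ (n%:R + delta + e) * (A * a * b) =
    B' * A * (r x `^ (n%:R + delta + e) * (a * b)) by ring.
  by rewrite rmerge// ler_wpM2r ?powR_ge0// ler_peMl ?mulr_ge0// ler1n.
- move=> x y Ox xy; have [x0 cvs v1 v2] := vs s x sn' Ox.
  have hvs : hclass x 0 (A * r x `^ (- e) * r x ^- n) (partials s v).
    by apply: holder_class0; [exact: (Ck_on_continuous cvs)|rewrite -sn|rewrite -sn].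
  have P0 : 0 <= B' * r x `^ (n%:R + delta + e) by rewrite mulr_ge0 ?powR_ge0.
  have Q0 : 0 <= A * r x `^ (- e) * r x ^- n.
    by rewrite !mulr_ge0 ?powR_ge0// invr_ge0 exprn_ge0// ltW.
  have h := holder_classM (@half_ball_open R d O x) x0 P0 Q0 (hB' x Ox x0) hvs.
  have [_ h2] := holder_class_bounds h.
  apply: le_trans (h2 x y (half_ball_self x0) xy) _; rewrite expr1.
  set a := r x `^ (- e); set b := r x ^- n; set E := (_ / _) `^ delta.
  have -> : 2 * (B' * r x `^ (n%:R + delta + e) * (A * a * b)) * E =
    2 * (B' * A) * (r x `^ (n%:R + delta + e) * (a * b) * E) by ring.
  rewrite rmerge// /E -powRM ?divr_ge0 ?enorm_ge0 ?(ltW x0)//.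
  by rewrite [r x * _]mulrC divfK// gt_eqF.
Qed.
End weighted_bounds.

Theorem proposition2p12 (R : realType) (d : nat) (d_gt0 : (0 < d)%N)
  (alpha : R) (alpha_gt0 : 0 < alpha) (alpha_lt2 : alpha < 2)
  (O : set 'rV[R]_d)
  (hO : O = half_space d_gt0 \/ (bounded_set O /\ C11_open_set d_gt0 O))
  (zetaO zetaC : int -> 'rV[R]_d -> R)
  (hzetaO : weight_family O O zetaO)
  (hzetaC : weight_family O (~` closure O) zetaC)
  (psi : 'rV[R]_d -> R) (hpsi : regularized_distance O psi)
  (p gamma theta : R) (p_gt1 : 1 < p)
  (theta_gt : d%:R - 1 < theta) (theta_lt : theta < d%:R - 1 + p)
  (delta : R) (delta_gt0 : 0 < delta) (delta_lt1 : delta < 1) :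
  exists N : R, forall (lambda sigma : R) (f g u : ('rV[R]_d -> R) -> R)
    (n : nat),
    (O = half_space d_gt0 -> sigma = 0) ->
    (bounded_set O -> - theta - alpha * p / 2 < sigma) ->
    psi_weighted_space O zetaO psi (alpha / 2) gamma p theta 0 f ->
    psi_weighted_space (~` closure O) zetaC psi (- (alpha / 2))
      lambda p theta sigma g ->
    extension_space O zetaO zetaC alpha gamma lambda p theta sigma u ->
    weak_solution O zetaO zetaC alpha gamma lambda p theta sigma f g u ->
    n%:R + delta <= gamma + alpha - d%:R / p ->
    exists v : 'rV[R]_d -> R,
      [/\ Ck_on n O v, eq_on O u (regular v) &
        (\sum_(0 <= k < n.+1)
            max_partials k (fun s => sup_norm O (fun x =>
              (psi x `^ (k%:R + theta / p - alpha / 2) * partials s v x)%R))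
         + max_partials n (fun s => holder_seminorm O delta (fun x =>
              (psi x `^ (n%:R + delta + theta / p - alpha / 2)
               * partials s v x)%R))
         <= N%:E * weighted_norm zetaO (gamma + alpha) p theta 0
                     (psi_mul psi (- (alpha / 2)) u))%E].
Proof.
have p0 : 0 < p by exact: lt_trans p_gt1.
have d01 : 0 < delta < 1 by rewrite delta_gt0.
have oO : open O by case: hO => [->|[_ []]//]; exact: open_half_space.
have zC0 m x : O x -> zetaC m x = 0.
  move=> Ox; apply: contrapT => /eqP zx.
  case: hzetaC => _ _ [k1 [k2 [_ _ supp]]] _ _.
  have [nOx _] := @supp m x (@subset_closure _ [set x | zetaC m x != 0] x zx).
  by apply: nOx; exact: subset_closure.
pose mu := gamma + alpha.
pose e := theta / p - alpha / 2.
pose concl n N := forall u, linear_on O u ->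
  (exists2 v, weighted_space O zetaO mu p (theta - alpha * p / 2) 0 v & eq_on O u v) ->
  exists v : 'rV[R]_d -> R,
      [/\ Ck_on n O v, eq_on O u (regular v) &
        (\sum_(0 <= k < n.+1)
            max_partials k (fun s => sup_norm O (fun x =>
              (psi x `^ (k%:R + theta / p - alpha / 2) * partials s v x)%R))
         + max_partials n (fun s => holder_seminorm O delta (fun x =>
              (psi x `^ (n%:R + delta + theta / p - alpha / 2)
               * partials s v x)%R))
         <= N%:E * weighted_norm zetaO mu p theta 0
                     (psi_mul psi (- (alpha / 2)) u))%E].
have step n : exists2 N, 0 <= N & n%:R + delta <= mu - d%:R / p ->
    forall N', N < N' -> concl n N'.
  have [hn|hn] := leP (n%:R + delta) (mu - d%:R / p); last first.
    by exists 0 => // h; rewrite leNgt hn in h.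
  have [C C0 hC] := gluing theta (- (alpha / 2)) oO hzetaO hpsi p_gt1 d01 hn.
  have [C' _ hC'] := gluing (theta - alpha * p / 2) 0 oO hzetaO hpsi p_gt1 d01 hn.
  have [N N0 hN] := weighted_bounds oO hpsi d01 n e.
  exists (N * C); first exact: mulr_ge0.
  move=> _ N' NN' u lu [v0 [[lv0 _] v0fin] uv0].
  have N'0 : 0 < N' by apply: le_lt_trans NN'; exact: mulr_ge0.
  set W := weighted_norm _ _ _ _ _ _.
  have Ck v (A : 'rV[R]_d -> R) : (forall x, O x -> 0 < bdist O x /\
      holder_class delta (half_ball O x) (bdist O x) n (A x) v) -> Ck_on n O v.
    move=> h s sn x Ox; have [x0 [cv _]] := h x Ox.
    exact: cv s sn x (half_ball_self x0).
  have [Wfin|Winf] := ltP W +oo%E; last first.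
    (* The right-hand side is infinite, and any regular representative will do; one is
       provided by the norm in which the interior part of [u] is known to be finite. *)
    have E0 : psi_mul psi 0 v0 = v0.
      apply/funext => phi; rewrite /psi_mul; congr v0.
      by apply/funext => x; rewrite powRr0 mul1r.
    have [|v [v0v hv]] := hC' v0 lv0; first by rewrite E0.
    exists v; split; first exact: Ck hv.
      by move=> phi tphi; rewrite uv0// v0v.
    by move: Winf; rewrite leye_eq => /eqP ->; rewrite gt0_muley ?leey// lte_fin.
  have [v [uv hv]] := hC u lu Wfin.
  exists v; split => //; first exact: Ck hv.
  have W0 : (0 <= W)%E by exact: poweR_ge0.
  have WE : W = (fine W)%:E by rewrite fineK// ge0_fin_numE.
  have fW0 : 0 <= fine W by exact: fine_ge0.
  have ee : - - (alpha / 2) - theta / p = - e by rewrite /e opprK opprB.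
  have := hN v (C * fine W).
  have -> : (N * (C * fine W))%:E = ((N * C)%:E * W)%E by rewrite {2}WE -EFinM mulrA.
  move=> h; have {}h := h (mulr_ge0 C0 fW0).
  apply: (@le_trans _ _ ((N * C)%:E * W)%E); last first.
    by rewrite lee_wpmul2r// lee_fin ltW.
  have hv' x : O x -> 0 < bdist O x /\
    holder_class delta (half_ball O x) (bdist O x) n (C * fine W * bdist O x `^ (- e)) v.
    by move=> /hv; rewrite ee.
  apply: le_trans (h hv'); apply: le_of_eq; congr (_ + _)%E.
    by apply: eq_bigr => k _; rewrite /e addrA.
  by rewrite /e addrA.
(* Finitely many orders [n] are compatible with the hypothesis on [n + delta], so
   that a single constant can serve all of them. *)
have /choice[Nn hNn] : forall n, exists N, 0 <= N /\ (n%:R + delta <= mu - d%:R / p ->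
    forall N', N < N' -> concl n N').
  by move=> n; have [N N0 hN] := step n; exists N.
pose B := (Num.truncn (mu - d%:R / p)).+1.
exists (\sum_(n < B) Nn n + 1) => lambda sigma f g u n _ _ _ _ hu _ hn.
have nB : (n < B)%N.
  rewrite -(ltr_nat R); apply: le_lt_trans (Num.Theory.truncnS_gt _).
  by apply: le_trans hn; rewrite lerDl ltW.
apply: (hNn n).2 => //.
- rewrite (bigD1 (Ordinal nB))//= -addrA ltrDl ltr_wpDl// sumr_ge0// => i _.
  exact: (hNn i).1.
- case: hu => [[lu _] _] a phi1 phi2 t1 t2.
  exact: (lu _ _ _ (test_function_sub t1) (test_function_sub t2)).
- exact: extension_space_restriction hu.
Qed.
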